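(* Let $n\ge 1$, $c\in\mathbb{C}^n\setminus\{0\}$, let $p,p_1,\dots,p_6$ be polynomials on $\mathbb{C}^n$ with $p$ non-zero and irreducible, and let $L(f)=\sum_{j=1}^s q_{t_j}f_{z_{t_j}}$, where $1\le s\le n$, $1\le t_1<\dots<t_s\le n$ and the $q_{t_j}$ are non-zero polynomials on $\mathbb{C}^n$. Assume $D\equiv 0$ and $d_2\not\equiv 0$. Then for every entire solution $f$ on $\mathbb{C}^n$ of $$(p_{1} L(f)+p_{2}\overline{f}+p_5 f)^{2}+(p_{3}L(f)+p_{4}\overline{f}+p_6 f)^{2}=p$$ there exist $k\in\{1,-1\}$ and an entire function $g$ on $\mathbb{C}^n$ such that $$f=\frac{p\,a_2e^{-ig}-a_1e^{ig}}{2id_2}\qquad( * )$$ and $g$ has one of the following properties: (i) $g$ is constant; (ii) $L(g)$ is a polynomial, and: either $\overline{g}+g$ or $\overline{g}-g$ is constant if $d_1\not\equiv 0$, while $a_1a_2\not\equiv 0$ if $d_1\equiv 0$. In addition, for $j\in\{1,\dots,n\}$, if $L(f)=f_{z_j}$ and $d_1\equiv D\equiv 0$ (still with $d_2\not\equiv 0$), then every entire solution $f$ has the form $( * )$ for some $k\in\{1,-1\}$ and some entire function $g$ with one of the following properties: (a) $g$ is constant; (b) $g_{z_j}\equiv 0$, and either $\deg_{z_j}\tilde b_1<\deg_{z_j}a_1$ or $\deg_{z_j}\tilde b_2<\deg_{z_j}a_2$; (c) $g_{z_j}$ is a non-zero polynomial and $\deg_{z_j}g_{z_j}=\deg_{z_j}\tilde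 b_1-\deg_{z_j}a_1=\deg_{z_j}\tilde b_2-\deg_{z_j}a_2\ge 0$.
   Context: For a function $h$ on $\mathbb{C}^n$ and the fixed $c$, the bars denote shifts (not complex conjugation): $\overline{h}(z)=h(z+c)$, $\underline{h}(z)=h(z-c)$; $h_{z_j}=\partial h/\partial z_j$. For $k\in\{1,-1\}$ put $a_1=kp_1-ip_3$, $a_2=kp_1+ip_3$, $\tilde b_1=kp_5-ip_6$, $\tilde b_2=kp_5+ip_6$, and put $d_1=p_2p_6-p_4p_5$, $d_2=p_3p_5-p_1p_6$, $D=p_1p_4-p_2p_3$. $\deg_{z_j}b$ is the degree of the polynomial $b$ in the variable $z_j$ (the zero polynomial has degree $-\infty$). ''Irreducible'' means not a product of two non-constant polynomials; non-zero constants are allowed. *)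

(* Defs.v *)
From HB Require Import structures.
From mathcomp Require Import all_boot all_order all_algebra.
From mathcomp Require Import all_classical all_reals all_analysis.
From mathcomp Require Import complex.
(* Some notations of mpoly conflict with those of MathComp-Analysis. *)
From mathcomp Require Import -(notations) mpoly.

Set Implicit Arguments.
Unset Strict Implicit.
Unset Printing Implicit Defensive.

Import Order.TTheory GRing.Theory Num.Theory.
Import numFieldNormedType.Exports.
Local Open Scope ring_scope.

(* Packing R[i] as a numClosedFieldType gives it the topology and the normed
   module structure over itself that MathComp-Analysis attaches to numeric
   fields; in particular [differentiable] and ['D_v] below are over C. *)
Definition Cplx (R : realType) : numClosedFieldType := R[i].

Definition cexp (R : realType) (z : Cplx R) : Cplx R :=
  let: (x +i* y)%C := (z : R[i]) in
  ((expR x * cos y) +i* (expR x * sin y))%C.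

Section Defs.
Variables (R : realType) (n : nat).
Local Notation C := (Cplx R).
Local Notation Cn := 'rV[C]_n.
Local Notation poly_n := (mpoly n C).
Implicit Types (f g : Cn -> C) (b : poly_n) (z c : Cn).

Definition entire f : Prop := forall z, differentiable f z.

Definition partial (j : 'I_n) f : Cn -> C :=
  fun z => 'D_(delta_mx ord0 j) f z.

Definition translate c f : Cn -> C := fun z => f (z + c).

Definition is_cst f : Prop := exists x : C, forall z, f z = x.

Definition peval b : Cn -> C := fun z => meval (z ord0) b.

Definition is_poly f : Prop := exists b, forall z, f z = peval b z.

(* Non-zero constants satisfy this, and so does 0. *)
Definition irreducible_mpoly (p : poly_n) : Prop :=
  forall u v : poly_n, p = u * v ->
    (exists x : C, u = mpolyC n x) \/ (exists x : C, v = mpolyC n x).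

(* For differences of degrees, recall that (-oo) - (-oo) = -oo in \bar int, so
   an equality deg u - deg v = m%:E implies that u and v are non-zero. *)
Definition deg (j : 'I_n) b : \bar int :=
  if b == 0 then -oo%E else ((\max_(m <- msupp b) m j)%N%:Z)%:E.

Definition diffop (s : nat) (t : 'I_s -> 'I_n) (q : 'I_s -> poly_n) f :
    Cn -> C :=
  fun z => \sum_(j < s) peval (q j) z * partial (t j) f z.

Definition solution (L : (Cn -> C) -> (Cn -> C)) c
    (p p1 p2 p3 p4 p5 p6 : poly_n) f : Prop :=
  forall z,
    (peval p1 z * L f z + peval p2 z * translate c f z + peval p5 z * f z) ^+ 2
  + (peval p3 z * L f z + peval p4 z * translate c f z + peval p6 z * f z) ^+ 2
  = peval p z.

(* The equality f = (p a2 e^(-ig) - a1 e^(ig)) / (2 i d2) of meromorphic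
   functions: f is entire, d2 <> 0, and division by 0 yields 0 in MathComp,
   so the zeros of d2 are excluded. *)
Definition has_form (p a1 a2 d2 : poly_n) g f : Prop :=
  forall z, peval d2 z != 0 ->
    f z = (peval p z * peval a2 z * cexp (- ('i * g z))
           - peval a1 z * cexp ('i * g z)) / (2 * 'i * peval d2 z).

End Defs.

(* Main.v *)
(* Put U = p1 L(f) + p2 f(z+c) + p5 f and V = p3 L(f) + p4 f(z+c) + p6 f. Then (U + iV)(U - iV) = p, and
   since p is irreducible one factor has no zeros: in a direction b in which p is monic, the power sums
   of the zeros of one factor on the lines z + Cb are entire in z and of polynomial growth, hence
   polynomials, and Newton's identities would split p if both factors had zeros. So U + ikV = e^phi and
   U - ikV = p e^(-phi) with k = 1 or k = -1 and phi = ig. As D = 0, p3 U - p1 V = d2 f, which is the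
   representation of f. Likewise -p6 U + p5 V = d2 L(f) - d1 f(z+c); eliminating f and L(f) gives
   A e^(-phi) + B e^phi = E e^(-psi) + F e^psi with psi(z) = phi(z+c), where E and F are polynomials and
   A and B are polynomials of degree 1 in L(phi). By a theorem of Borel type (obtained from the Jensen
   and Schwarz formulas and a growth lemma) the terms on both sides agree in pairs if phi is not
   constant. If d1 = 0, so that E = F = 0, this says A = B = 0, which determines L(phi) and gives the
   degree conditions. Otherwise AB = EF is an equation of degree 2 for L(phi) over the polynomials, so
   L(phi) is a polynomial, and comparing a pair of terms shows that psi - phi or psi + phi is constant. *)
Require Import Defs.
From HB Require Import structures.
From mathcomp Require Import all_boot all_order all_algebra.
From mathcomp Require Import all_classical all_reals all_analysis.
From mathcomp Require Import complex.
From mathcomp Require Import -(notations) mpoly.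
From mathcomp Require Import ring lra zify.

Set Implicit Arguments.
Unset Strict Implicit.
Unset Printing Implicit Defensive.

Import Order.TTheory GRing.Theory Num.Theory.
Import numFieldNormedType.Exports.
Local Open Scope ring_scope.

(** * Complex derivatives *)

(** The coefficients A and B contain L(phi), which is not yet known to be a polynomial, and phi(z +
    c) may grow much faster than phi: a theorem of Borel type for polynomial coefficients does not
    apply. Coefficients are therefore measured against the maximum modulus of phi itself, by a
    notion of smallness that is stable under products and derivatives, and the relation between the
    exponentials is what shows that psi is small too. Jensen's formula needs a base point where a
    coefficient does not vanish, so base points range over the complement of a zero set, and
    conclusions are extended by the identity theorem. The zeros of a factor on the lines z + Cb are
    chosen separately for each z, with no control on their dependence on z. The argument principle,
    in the algebraic form of a residue functional attached to p on the line, expresses their power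
    sums through the two factors alone. No integral occurs: averages over the 2^m-th roots of unity
    take the place of contour integrals, and power series that of primitives. *)

Section Modulus.
Variable R : realType.
Local Notation C := (Cplx R).
Implicit Types (x y z : C) (r e : R).

(** Real-valued, whereas the norm of [Cplx R] takes its values in [Cplx R]: estimates become goals
    for [lra] and [nra]. *)
Definition cn (z : C) : R := Normc.normc (z : R[i]).
Definition rc (r : R) : C := (r%:C)%C.
Definition re (z : C) : R := complex.Re (z : R[i]).

Lemma cn0 : cn 0 = 0. Proof. exact: Normc.normc0. Qed.
Lemma cn1 : cn 1 = 1. Proof. exact: Normc.normc1. Qed.
Lemma cnD x y : cn (x + y) <= cn x + cn y. Proof. exact: le_normcD. Qed.
Lemma cnM x y : cn (x * y) = cn x * cn y. Proof. exact: Normc.normcM. Qed.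
Lemma cnN x : cn (- x) = cn x. Proof. exact: normcN. Qed.
Lemma cnV x : cn x^-1 = (cn x)^-1. Proof. exact: Normc.normcV. Qed.
Lemma cn_ge0 x : 0 <= cn x.
Proof. by rewrite /cn; case: x => a b /=; rewrite sqrtr_ge0. Qed.
Lemma cn_eq0 x : (cn x == 0) = (x == 0).
Proof. by apply/eqP/eqP => [/(@Normc.eq0_normc R)//|->]; rewrite cn0. Qed.
Lemma cn_gt0 x : (0 < cn x) = (x != 0).
Proof. by rewrite lt_neqAle cn_ge0 andbT eq_sym cn_eq0. Qed.
Lemma cnB x y : cn (x - y) <= cn x + cn y.
Proof. by rewrite -(cnN y) cnD. Qed.
Lemma cnBC x y : cn (x - y) = cn (y - x). Proof. by rewrite -cnN opprB. Qed.
Lemma cn_dist x y : cn x - cn y <= cn (x - y).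
Proof. by rewrite lerBlDr; apply: le_trans (cnD _ _); rewrite subrK. Qed.
Lemma cn_split y x z : cn (x - z) <= cn (x - y) + cn (y - z).
Proof. by have := cnD (x - y) (y - z); rewrite addrA subrK. Qed.
Lemma cnX x n : cn (x ^+ n) = cn x ^+ n.
Proof. by elim: n => [|n IH]; rewrite ?expr0 ?cn1 // !exprS cnM IH. Qed.
Lemma cn_sum (I : Type) (s : seq I) (P : pred I) (F : I -> C) :
  cn (\sum_(i <- s | P i) F i) <= \sum_(i <- s | P i) cn (F i).
Proof.
elim/big_ind2: _ => [|a b c d H1 H2|//]; first by rewrite cn0.
by apply: le_trans (cnD _ _) _; apply: lerD.
Qed.
Lemma cn_prod (I : Type) (s : seq I) (P : pred I) (F : I -> C) :
  cn (\prod_(i <- s | P i) F i) = \prod_(i <- s | P i) cn (F i).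
Proof. by elim/big_ind2: _ => [|a b c d <- <-|//]; rewrite ?cn1 ?cnM. Qed.
Lemma normE x : `|x| = rc (cn x).
Proof. by rewrite /cn; case: x => a b; rewrite normc_def. Qed.
Lemma lt_rc r e : (rc r < rc e) = (r < e). Proof. exact: ltcR. Qed.
Lemma le_rc r e : (rc r <= rc e) = (r <= e). Proof. exact: lecR. Qed.
Lemma rcD r e : rc (r + e) = rc r + rc e. Proof. exact: rmorphD. Qed.
Lemma rcM r e : rc (r * e) = rc r * rc e. Proof. exact: rmorphM. Qed.
Lemma rcV r : rc r^-1 = (rc r)^-1.
Proof. exact: fmorphV. Qed.
Lemma rc0 : rc 0 = 0. Proof. exact: rmorph0. Qed.
Lemma rc1 : rc 1 = 1. Proof. exact: rmorph1. Qed.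
Lemma rcX r n : rc (r ^+ n) = rc r ^+ n. Proof. exact: rmorphXn. Qed.
Lemma rc_nat n : rc n%:R = n%:R. Proof. exact: rmorph_nat. Qed.
Lemma cn_rc r : cn (rc r) = `|r|.
Proof. by rewrite /cn /= expr0n addr0 sqrtr_sqr. Qed.
Lemma cn_nat n : cn n%:R = n%:R. Proof. by rewrite -rc_nat cn_rc normr_nat. Qed.
Lemma reD x y : re (x + y) = re x + re y.
Proof. by case: x y => a b [c d]. Qed.
Lemma reN x : re (- x) = - re x.
Proof. by case: x. Qed.
Lemma re_le x : `|re x| <= cn x.
Proof.
case: x => a b; rewrite /re /cn /= -sqrtr_sqr ler_sqrt ?addr_ge0 ?sqr_ge0 //.
by rewrite lerDl sqr_ge0.
Qed.
Lemma cn_le x : cn x <= `|re x| + `|complex.Im (x : R[i])|.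
Proof.
case: x => a b; rewrite /re /cn /= -[leRHS]ger0_norm ?addr_ge0 // -sqrtr_sqr ler_sqrt ?sqr_ge0 //.
rewrite sqrrD !real_normK ?num_real //.
by rewrite -addrA addrCA lerDr; rewrite pmulrn_lge0 // mulr_ge0.
Qed.
Lemma im_le x : `|complex.Im (x : R[i])| <= cn x.
Proof.
case: x => a b; rewrite /cn /= -sqrtr_sqr ler_sqrt ?addr_ge0 ?sqr_ge0 //.
by rewrite lerDr sqr_ge0.
Qed.

Definition climit (u : nat -> C) l :=
  forall e, 0 < e -> exists N, forall n, (N <= n)%N -> cn (u n - l) <= e.

Lemma le_of_lee (a b : R) : (forall e, 0 < e -> a <= b + e) -> a <= b.
Proof. by move=> H; apply/ler_addgt0Pr => e /H. Qed.

Lemma climit_uniq u l l' : climit u l -> climit u l' -> l = l'.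
Proof.
move=> H H'; apply/eqP; rewrite -subr_eq0 -cn_eq0 eq_le cn_ge0 andbT.
apply: le_of_lee => e e0; rewrite add0r.
have [N HN] := H _ (divr_gt0 e0 (ltr0n _ 2)).
have [N' HN'] := H' _ (divr_gt0 e0 (ltr0n _ 2)).
apply: le_trans (cn_split (u (maxn N N')) _ _) _; rewrite cnBC.
by rewrite [leRHS]splitr lerD ?HN ?HN' ?leq_maxl ?leq_maxr.
Qed.

Lemma real_cauchy (p : nat -> R) :
  (forall e, 0 < e -> exists N, forall m n, (N <= m)%N -> (N <= n)%N ->
     `|p m - p n| <= e) ->
  exists l : R, forall e, 0 < e -> exists N, forall n, (N <= n)%N -> `|p n - l| <= e.
Proof.
move=> H.
(* The eventual lower bounds of the sequence; their supremum is its limit inferior. *)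
pose A : set R := fun x : R => exists N, forall n, (N <= n)%N -> x <= p n.
have key e : 0 < e -> exists N, [/\ A (p N - e), ubound A (p N + e) &
    forall n, (N <= n)%N -> `|p n - p N| <= e].
  move=> e0; have [N HN] := H _ e0; exists N; split.
  - by exists N => n Nn; have := HN _ _ (leqnn N) Nn; rewrite ler_norml => /andP[_]; lra.
  - move=> x [M HM]; apply: le_trans (HM (maxn N M) (leq_maxr _ _)) _.
    have := HN _ _ (leq_maxl N M) (leqnn N); rewrite ler_norml => /andP[_]; lra.
  - by move=> n Nn; apply: HN.
exists (sup A) => e e0.
have [N [AN uN HN]] := key _ (divr_gt0 e0 (ltr0n _ 2)).
exists N => n Nn; have := HN _ Nn.
have : p N - e / 2 <= sup A by apply: ub_le_sup => //; exists (p N + e / 2).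
have : sup A <= p N + e / 2 by apply: ge_sup => //; exists (p N - e / 2).
by rewrite !ler_norml => h1 h2 /andP[h3 h4]; apply/andP; split; lra.
Qed.

Lemma climit_cauchy (u : nat -> C) :
  (forall e, 0 < e -> exists N, forall m n, (N <= m)%N -> (N <= n)%N ->
     cn (u m - u n) <= e) -> exists l, climit u l.
Proof.
move=> H.
have [a Ha] : exists l : R, forall e, 0 < e -> exists N, forall n, (N <= n)%N ->
    `|re (u n) - l| <= e.
  apply: real_cauchy => e /H[N HN]; exists N => m n Nm Nn.
  by rewrite -reN -reD; apply: le_trans (re_le _) (HN _ _ Nm Nn).
have [b Hb] : exists l : R, forall e, 0 < e -> exists N, forall n, (N <= n)%N ->
    `|complex.Im (u n : R[i]) - l| <= e.
  apply: real_cauchy => e /H[N HN]; exists N => m n Nm Nn.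
  apply: le_trans (HN _ _ Nm Nn); apply: le_trans (im_le _).
  by case: (u m) (u n) => x y [x' y'].
exists ((a +i* b)%C : C) => e e0.
have [N HN] := Ha _ (divr_gt0 e0 (ltr0n _ 2)).
have [N' HN'] := Hb _ (divr_gt0 e0 (ltr0n _ 2)).
exists (maxn N N') => n; rewrite geq_max => /andP[Nn N'n].
apply: le_trans (cn_le _) _; rewrite [leRHS]splitr.
have := HN _ Nn; have := HN' _ N'n; case: (u n) => x y /= h1 h2.
exact: lerD.
Qed.

Lemma climit_ext (u v : nat -> C) l : (forall n, u n = v n) -> climit u l -> climit v l.
Proof. by move=> uv H e /H[N HN]; exists N => n /HN; rewrite uv. Qed.

Lemma climitD u v l m : climit u l -> climit v m -> climit (fun n => u n + v n) (l + m).
Proof.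
move=> H K e e0; have [N HN] := H _ (divr_gt0 e0 (ltr0n _ 2)).
have [N' HN'] := K _ (divr_gt0 e0 (ltr0n _ 2)).
exists (maxn N N') => n; rewrite geq_max => /andP[Nn N'n].
rewrite opprD addrACA; apply: le_trans (cnD _ _) _.
by rewrite [leRHS]splitr lerD ?HN ?HN'.
Qed.

Lemma climit_cst l : climit (fun=> l) l.
Proof. by move=> e e0; exists 0%N => n _; rewrite subrr cn0 ltW. Qed.

Lemma climitZ a u l : climit u l -> climit (fun n => a * u n) (a * l).
Proof.
move=> H e e0; have a1 : 0 < cn a + 1 by have := cn_ge0 a; lra.
have [N HN] := H _ (divr_gt0 e0 a1); exists N => n /HN.
rewrite -mulrBr cnM ler_pdivlMr // => h; apply: le_trans h.
rewrite mulrC ler_wpM2l ?cn_ge0 //; lra.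
Qed.

Lemma climit_le u l M : climit u l -> (exists N, forall n, (N <= n)%N -> cn (u n) <= M) ->
  cn l <= M.
Proof.
move=> H [N' HN']; apply: le_of_lee => e /H[N HN].
have := HN _ (leq_maxl N N'); have := HN' _ (leq_maxr N N').
by have := cn_dist l (u (maxn N N')); rewrite (cnBC l); lra.
Qed.

(** f(h) = o(h) as h tends to 0; the weak inequality includes h = 0 and forces f 0 = 0. Derivatives
    are kept as a relation, [cder], so that the rules of calculus involve no choice. *)
Definition lilo (f : C -> C) := forall e, 0 < e ->
  exists2 d, 0 < d & forall h, cn h < d -> cn (f h) <= e * cn h.
Definition cder (f : C -> C) z l := lilo (fun h => f (z + h) - f z - l * h).
Definition entire1 f := forall z, exists l, cder f z l.

Lemma lilo_ext f g : (forall h, f h = g h) -> lilo f -> lilo g.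
Proof. by move=> fg H e /H[d d0 Hd]; exists d => // h; rewrite -fg; apply: Hd. Qed.

Lemma liloD f g : lilo f -> lilo g -> lilo (fun h => f h + g h).
Proof.
move=> H K e e0; have [d d0 Hd] := H _ (divr_gt0 e0 (ltr0n _ 2)).
have [d' d'0 Hd'] := K _ (divr_gt0 e0 (ltr0n _ 2)).
exists (Num.min d d'); first by rewrite lt_min d0.
move=> h; rewrite lt_min => /andP[/Hd h1 /Hd' h2].
by apply: le_trans (cnD _ _) _; lra.
Qed.

Lemma lilo_bound f g K d0 : lilo f -> 0 < d0 -> 
  (forall h, cn h < d0 -> cn (g h) <= K * cn (f h)) -> lilo g.
Proof.
move=> H d00 gK e e0.
have K0 : 0 < `|K| + 1 by have := normr_ge0 K; lra.
have [d d0' Hd] := H _ (divr_gt0 e0 K0).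
exists (Num.min d d0); first by rewrite lt_min d0'.
move=> h; rewrite lt_min => /andP[/Hd h1 /gK h2]; apply: le_trans h2 _.
apply: (@le_trans _ _ ((`|K| + 1) * cn (f h))).
  by rewrite ler_wpM2r ?cn_ge0 //; have := ler_norm K; lra.
by move: h1; rewrite mulrAC ler_pdivlMr // mulrC.
Qed.

Lemma lilo_quad f K d0 : 0 < d0 -> (forall h, cn h < d0 -> cn (f h) <= K * cn h ^+ 2) ->
  lilo f.
Proof.
move=> d00 H e e0; have K0 : 0 < `|K| + 1 by have := normr_ge0 K; lra.
exists (Num.min d0 (e / (`|K| + 1))); first by rewrite lt_min d00 divr_gt0.
move=> h; rewrite lt_min => /andP[/H h1 h2]; apply: le_trans h1 _.
rewrite expr2 mulrA ler_wpM2r ?cn_ge0 //.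
move: h2; rewrite ltr_pdivlMr // => h2; apply: le_trans (ltW h2).
rewrite mulrC ler_wpM2l ?cn_ge0 //; have := ler_norm K; lra.
Qed.

Lemma cder_ext f g z l : (forall w, f w = g w) -> cder f z l -> cder g z l.
Proof. by move=> fg; apply: lilo_ext => h; rewrite !fg. Qed.

Lemma cder_lip f z l : cder f z l ->
  exists2 d, 0 < d & forall h, cn h < d -> cn (f (z + h) - f z) <= (cn l + 1) * cn h.
Proof.
move=> /(_ _ ltr01)[d d0 H]; exists d => // h /H h1.
have := cn_dist (f (z + h) - f z) (l * h); rewrite cnM; lra.
Qed.

Lemma cder_cont f z l : cder f z l -> forall e, 0 < e ->
  exists2 d, 0 < d & forall h, cn h < d -> cn (f (z + h) - f z) <= e.
Proof.
move=> /cder_lip[d d0 H] e e0; have K0 : 0 < cn l + 1 by have := cn_ge0 l; lra.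
exists (Num.min d (e / (cn l + 1))); first by rewrite lt_min d0 divr_gt0.
move=> h; rewrite lt_min => /andP[/H h1 h2]; apply: le_trans h1 _.
by move: h2; rewrite ltr_pdivlMr // mulrC => /ltW.
Qed.

Lemma cder_uniq f z l l' : cder f z l -> cder f z l' -> l = l'.
Proof.
move=> H H'; apply/eqP; rewrite -subr_eq0 -cn_eq0 eq_le cn_ge0 andbT.
apply: le_of_lee => e e0; rewrite add0r.
have [d d0 Hd] := H _ (divr_gt0 e0 (ltr0n _ 2)).
have [d' d'0 Hd'] := H' _ (divr_gt0 e0 (ltr0n _ 2)).
pose m := Num.min d d' / 2; have m0 : 0 < m by rewrite divr_gt0 // lt_min d0.
have mlt : m < Num.min d d' by rewrite /m; move: m0; rewrite /m; lra.
have cm : cn (rc m) = m by rewrite cn_rc gtr0_norm.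
have := Hd (rc m); have := Hd' (rc m); rewrite cm.
move: mlt; rewrite lt_min => /andP[/[dup] m1 -> /[dup] m2 ->] /(_ isT) h1 /(_ isT) h2.
rewrite -(@ler_pM2r _ m) // -{1}cm -cnM mulrBl.
have -> : l * rc m - l' * rc m = (f (z + rc m) - f z - l' * rc m) - (f (z + rc m) - f z - l * rc m) by ring.
apply: le_trans (cnB _ _) _; lra.
Qed.

Lemma cder_cst a z : cder (fun=> a) z 0.
Proof. by move=> e e0; exists 1 => // h _; rewrite subrr mul0r subr0 cn0 mulr_ge0 ?cn_ge0 // ltW. Qed.

Lemma cder_aff a b z : cder (fun w => a * w + b) z a.
Proof.
move=> e e0; exists 1 => // h _.
have -> : a * (z + h) + b - (a * z + b) - a * h = 0 by ring.
by rewrite cn0 mulr_ge0 ?cn_ge0 // ltW.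
Qed.

Lemma cder_id z : cder id z 1.
Proof. by apply: cder_ext (cder_aff 1 0 z) => w; rewrite mul1r addr0. Qed.

Lemma cderD f g z l m : cder f z l -> cder g z m -> cder (fun w => f w + g w) z (l + m).
Proof. by move=> H K; apply: lilo_ext (liloD H K) => h; ring. Qed.

Lemma cderM f g z l m : cder f z l -> cder g z m ->
  cder (fun w => f w * g w) z (l * g z + f z * m).
Proof.
move=> H K.
have [d d0 Hd] := cder_lip H.
pose A h := f (z + h) - f z - l * h; pose B h := g (z + h) - g z - m * h.
have lA : lilo (fun h => A h * g z) .
  by apply: (@lilo_bound A _ (cn (g z)) 1) => // h _; rewrite cnM mulrC.
have lB : lilo (fun h => B h * f z).
  by apply: (@lilo_bound B _ (cn (f z)) 1) => // h _; rewrite cnM mulrC.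
have [d' d'0 Hd'] := cder_lip K.
have lC : lilo (fun h => (f (z + h) - f z) * (g (z + h) - g z)).
  apply: (@lilo_quad _ ((cn l + 1) * (cn m + 1)) (Num.min d d')).
    by rewrite lt_min d0.
  move=> h; rewrite lt_min => /andP[/Hd h1 /Hd' h2].
  by rewrite cnM expr2 mulrACA ler_pM ?cn_ge0.
apply: lilo_ext (liloD (liloD lA lB) lC) => h; rewrite /A /B; ring.
Qed.

Lemma cderZ a f z l : cder f z l -> cder (fun w => a * f w) z (a * l).
Proof. by move=> H; have := cderM (cder_cst a z) H; rewrite mul0r add0r. Qed.

Lemma cderN f z l : cder f z l -> cder (fun w => - f w) z (- l).
Proof.
by move=> /(cderZ (-1)); rewrite mulN1r; apply: cder_ext => w; rewrite mulN1r.
Qed.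

Lemma cderB f g z l m : cder f z l -> cder g z m -> cder (fun w => f w - g w) z (l - m).
Proof. by move=> H /cderN; apply: cderD. Qed.

Lemma cder_comp f g z l m : cder g z m -> cder f (g z) l -> cder (fun w => f (g w)) z (l * m).
Proof.
move=> K H.
have lB : lilo (fun h => l * (g (z + h) - g z - m * h)).
  by apply: (@lilo_bound (fun h => g (z + h) - g z - m * h) _ (cn l) 1) => // h _; rewrite cnM.
pose k h := g (z + h) - g z.
have lA : lilo (fun h => f (g z + k h) - f (g z) - l * k h).
  move=> e e0; have m1 : 0 < cn m + 1 by have := cn_ge0 m; lra.
  have [d d0 Hd] := H _ (divr_gt0 e0 m1).
  have [d' d'0 Hd'] := cder_lip K.
  have [d2 d20 Hd2] := cder_cont K (divr_gt0 d0 (ltr0n _ 2)).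
  exists (Num.min d' d2); first by rewrite lt_min d'0.
  move=> h; rewrite lt_min => /andP[/Hd' h1 /Hd2 h2].
  have /Hd h3 : cn (k h) < d by apply: le_lt_trans h2 _; lra.
  apply: le_trans h3 _; rewrite mulrAC ler_pdivrMr // -mulrA ler_wpM2l ?(ltW e0) //.
  by rewrite mulrC.
by apply: lilo_ext (liloD lA lB) => h; rewrite /k [g z + _]addrC subrK; ring.
Qed.

Lemma cderV f z l : f z != 0 -> cder f z l -> cder (fun w => (f w)^-1) z (- l / f z ^+ 2).
Proof.
move=> fz H; have f0 : 0 < cn (f z) by rewrite cn_gt0.
have [d d0 Hd] := cder_cont H (divr_gt0 f0 (ltr0n _ 2)).
have [d' d'0 Hd'] := cder_lip H.
have nz h : cn h < d -> f (z + h) != 0 /\ cn (f z) / 2 <= cn (f (z + h)).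
  move=> /Hd h1; have : cn (f z) / 2 <= cn (f (z + h)).
    have := cn_dist (f z) (f (z + h)); rewrite cnBC; lra.
  by move=> h2; split=> //; rewrite -cn_gt0; lra.
pose A h := f (z + h) - f z - l * h.
have lA : lilo (fun h => - A h / (f z ^+ 2)).
  apply: (@lilo_bound A _ (cn (f z ^+ 2))^-1 1) => // h _.
  by rewrite cnM cnN cnV mulrC.
(* The remainder of 1/f is exactly [lA] plus this term, which is quadratic in the increment of f. *)
have lB : lilo (fun h => (f (z + h) - f z) ^+ 2 / (f z ^+ 2 * f (z + h))).
  apply: (@lilo_quad _ ((cn l + 1) ^+ 2 * (cn (f z) ^+ 2 * (cn (f z) / 2))^-1) (Num.min d d')).
    by rewrite lt_min d0.
  move=> h; rewrite lt_min => /andP[/nz[nz1 nz2] /Hd' h2].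
  rewrite cnM cnX cnV cnM cnX; set fi := (cn (f z) ^+ 2 * (cn (f z) / 2))^-1.
  rewrite [leRHS]mulrAC -exprMn; apply: ler_pM => //.
  - by rewrite sqr_ge0.
  - by rewrite invr_ge0 mulr_ge0 ?sqr_ge0 ?cn_ge0.
  - by rewrite lerXn2r ?nnegrE ?mulr_ge0 ?addr_ge0 ?cn_ge0.
  have f2 : 0 < cn (f z) ^+ 2 by rewrite exprn_gt0.
  rewrite /fi lef_pV2 ?posrE ?mulr_gt0 ?divr_gt0 ?cn_gt0 //.
  by rewrite ler_wpM2l ?sqr_ge0.
move=> e e0; have [d2 d20 H2] := liloD lA lB e0.
exists (Num.min d d2); first by rewrite lt_min d0.
move=> h; rewrite lt_min => /andP[/nz[nz1 _] /H2].
suff -> : - A h / f z ^+ 2 + (f (z + h) - f z) ^+ 2 / (f z ^+ 2 * f (z + h)) =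
   (f (z + h))^-1 - (f z)^-1 - - l / f z ^+ 2 * h by [].
by rewrite /A; field; rewrite fz nz1.
Qed.
End Modulus.

(** * The complex exponential *)

Section ComplexExp.
Variable R : realType.
Local Notation C := (Cplx R).

Lemma le_of_eq (a b : R) : a = b -> a <= b. Proof. by move=> ->. Qed.

Lemma real_derive_expansion (f : R -> R) (x df : R) : is_derive x 1 f df ->
  forall e, 0 < e -> exists2 d, 0 < d & forall h, `|h| < d ->
    `|f (x + h) - f x - df * h| <= e * `|h|.
Proof.
move=> [dv dE] e e0.
have := dv; rewrite /derivable => /cvg_ex[l Hl].
have lE : l = df by rewrite -dE /derive; apply/esym/cvg_lim.
move: Hl; rewrite lE => /cvgrPdist_le/(_ _ e0).
rewrite near_withinE => /nbhs_ballP[d /= d0 Hd].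
exists d => // h hd; have [->|h0] := eqVneq h 0.
  by rewrite addr0 subrr mulr0 subr0 normr0 mulr0.
have := Hd h; rewrite /ball /= sub0r normrN => /(_ hd h0).
rewrite [X in `|X| <= _ -> _](_ : _ = - (f (x + h) - f x - df * h) * h^-1).
  by rewrite normrM normfV normrN ler_pdivrMr ?normr_gt0.
by rewrite /GRing.scale /= mulr1 [h + x]addrC; field.
Qed.

Lemma cexpD (z w : C) : cexp (z + w) = cexp z * cexp w.
Proof.
case: z w => a b [c d]; rewrite /cexp /= expRD cosD sinD; apply/eqP.
by rewrite eq_complex /=; apply/andP; split; apply/eqP; ring.
Qed.

Lemma cexp0 : cexp (0 : C) = 1.
Proof.
rewrite /cexp /= expR0 cos0 sin0; apply/eqP.
by rewrite eq_complex /= mulr0 mulr1 !eqxx.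
Qed.

Lemma cexpN (z : C) : cexp (- z) * cexp z = 1.
Proof. by rewrite -cexpD addNr cexp0. Qed.

Lemma cexp_neq0 (z : C) : cexp z != 0.
Proof.
apply/eqP => h; have := cexpN z; rewrite h mulr0 => /eqP.
by rewrite eq_sym oner_eq0.
Qed.

Lemma cexpNV (z : C) : cexp (- z) = (cexp z)^-1.
Proof. by apply: (mulIf (cexp_neq0 z)); rewrite cexpN mulVf ?cexp_neq0. Qed.

Lemma cexpMn (z : C) n : cexp (n%:R * z) = cexp z ^+ n.
Proof.
elim: n => [|n IH]; first by rewrite mul0r cexp0.
by rewrite -natr1 mulrDl mul1r cexpD IH exprSr.
Qed.

Lemma cn_cexp (z : C) : cn (cexp z) = expR (re z).
Proof.
case: z => a b; rewrite /cn /cexp /re /= !exprMn -mulrDr cos2Dsin2 mulr1.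
by rewrite sqrtr_sqr ger0_norm ?expR_ge0.
Qed.

Lemma lilo_re (f : R -> R) (a : C) :
  (forall e, 0 < e -> exists2 d, 0 < d & forall h, `|h| < d -> `|f h| <= e * `|h|) ->
  lilo (fun h : C => a * rc (f (re h))) /\
  lilo (fun h : C => a * rc (f (complex.Im (h : R[i])))).
Proof.
move=> H.
have K0 : 0 < cn a + 1 by have := cn_ge0 a; lra.
split=> e e0; have [d d0 Hd] := H _ (divr_gt0 e0 K0); exists d => // h hd;
  rewrite cnM cn_rc.
  have h1 := re_le h; have := Hd _ (le_lt_trans h1 hd).
  have : 0 <= `|f (re h)| by []. 
  move: `|f _| => x x0 hx; apply: (@le_trans _ _ ((cn a + 1) * x)); first by nra.
  by move: hx; rewrite mulrAC ler_pdivlMr // => hx; nra.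
have h1 := im_le h; have := Hd _ (le_lt_trans h1 hd).
have : 0 <= `|f (complex.Im (h : R[i]))| by [].
move: `|f _| => x x0 hx; apply: (@le_trans _ _ ((cn a + 1) * x)); first by nra.
by move: hx; rewrite mulrAC ler_pdivlMr // => hx; nra.
Qed.

(** By [cexpD] only the point 0 matters. For h = a + ib, the remainder e^h - 1 - h is (e^a - 1 - a)
    + e^a ((cos b - 1) + i (sin b - b)) + (e^a - 1) i b: two terms that are o(h) by the real
    derivatives, and a quadratic one. *)
Lemma cder_cexp (z : C) : cder (@cexp R) z (cexp z).
Proof.
suff H : lilo (fun h : C => cexp h - 1 - h).
  have [H' _] : lilo (fun h : C => cexp h - 1 - h) /\ True by [].
  apply: (@lilo_bound _ _ _ (cn (cexp z)) 1 H) => // h _.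
  rewrite -cnM cexpD; apply: le_of_eq; congr cn; ring.
have E0 e : 0 < e -> exists2 d, 0 < d & forall h : R, `|h| < d -> `|expR h - 1 - h| <= e * `|h|.
  move=> /(real_derive_expansion (is_derive_expR 0))[d d0 Hd]; exists d => // h /Hd.
  by rewrite add0r expR0 mul1r.
have C0 e : 0 < e -> exists2 d, 0 < d & forall h : R, `|h| < d -> `|cos h - 1| <= e * `|h|.
  move=> /(real_derive_expansion (is_derive_cos 0))[d d0 Hd]; exists d => // h /Hd.
  by rewrite add0r cos0 sin0 oppr0 mul0r subr0.
have S0 e : 0 < e -> exists2 d, 0 < d & forall h : R, `|h| < d -> `|sin h - h| <= e * `|h|.
  move=> /(real_derive_expansion (is_derive_sin 0))[d d0 Hd]; exists d => // h /Hd.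
  by rewrite add0r cos0 sin0 subr0 mul1r.
pose im (h : C) := complex.Im (h : R[i]).
pose I : C := (0 +i* 1)%C.
have [LE _] := @lilo_re (fun h => expR h - 1 - h) 1 E0.
have [_ LC] := @lilo_re (fun h => cos h - 1) 1 C0.
have [_ LS] := @lilo_re (fun h => sin h - h) I S0.
pose Q (h : C) := rc (cos (im h) - 1) + I * rc (sin (im h)  - im h).
have [d d0 Hd] := E0 1 ltr01.
have bd (h : C) : cn h < Num.min d 1 -> `|expR (re h) - 1| <= 2 * cn h /\ cn h <= 1.
  rewrite lt_min => /andP[h1 /ltW h2]; split => //.
  have := Hd _ (le_lt_trans (re_le h) h1); have := re_le h; rewrite mul1r.
  rewrite !ler_norml => /andP[a1 a2]; have : `|re h| <= cn h by apply: re_le.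
  by move=> a3 /andP[a4 a5]; apply/andP; split; lra.
have d1 : 0 < Num.min d 1 by rewrite lt_min d0 ltr01.
have LQ : lilo (fun h : C => rc (expR (re h)) * Q h).
  have LQ : lilo Q by apply: lilo_ext (liloD LC LS) => h; rewrite /Q mul1r.
  apply: (@lilo_bound _ _ _ 3 _ LQ d1) => h /bd[h1 h2].
  rewrite cnM ler_wpM2r ?cn_ge0 // cn_rc.
  by move: h1; rewrite !ler_norml => /andP[a1 a2]; apply/andP; split; lra.
have LP : lilo (fun h : C => rc (expR (re h) - 1) * (I * rc (im h))).
  apply: (@lilo_quad _ _ 2 _ d1) => h /bd[h1 h2].
  have I1 : cn I = 1 by rewrite /cn /= expr0n expr1n add0r sqrtr1.
  rewrite !cnM !cn_rc I1 mul1r expr2 mulrA; apply: ler_pM => //.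
  exact: im_le.
apply: lilo_ext (liloD (liloD LE LQ) LP) => -[a b].
rewrite /Q /im /I /re /= mul1r; apply/eqP; rewrite eq_complex /=.
by apply/andP; split; apply/eqP; ring.
Qed.

End ComplexExp.

(** * Bisection and the mean value inequality *)

Section Goursat.
Variable R : realType.
Local Notation C := (Cplx R).

Lemma exp2_gt0 k : (0 : R) < 2 ^+ k. Proof. by rewrite exprn_gt0. Qed.

Lemma half_pow_small (K e : R) : 0 < e -> exists N, forall n, (N <= n)%N -> K / 2 ^+ n <= e.
Proof.
move=> e0; exists (Num.bound (`|K| / e)) => n Nn.
have h : `|K| / e <= n%:R.
  apply: le_trans (ltW (archi_boundP _)) _; first by rewrite divr_ge0 // ltW.
  by rewrite ler_nat.
have n2 : n%:R <= 2 ^+ n :> R by rewrite -natrX ler_nat ltnW // ltn_expl.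
rewrite ler_pdivrMr ?exp2_gt0 //; apply: le_trans (ler_norm _) _.
by rewrite -ler_pdivrMl // mulrC; apply: le_trans h n2.
Qed.

(** Bisection in the abstract: a bad object of scale k leads to one of scale k + 1 at distance at
    most K / 2^k, so the objects accumulate, and the tail of the geometric series gives the factor
    2. The family [coord] covers points of C as well as of C^n. *)
Lemma descent_coord (T I : Type) (coord : I -> T -> C) (Bad : nat -> T -> Prop)
    (K : R) (w0 : T) : 0 <= K -> Bad 0%N w0 ->
  (forall k w, Bad k w -> exists w', Bad k.+1 w' /\
     forall i, cn (coord i w' - coord i w) <= K / 2 ^+ k) ->
  exists ws : I -> C, forall k, exists w, Bad k w /\
     forall i, cn (coord i w - ws i) <= 2 * K / 2 ^+ k.
Proof.
move=> K0 B0 step.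
have [f Hf] : exists f : nat * T -> T, forall p, Bad p.1 p.2 ->
    Bad p.1.+1 (f p) /\ forall i, cn (coord i (f p) - coord i p.2) <= K / 2 ^+ p.1.
  suff /choice[f Hf] : forall p : nat * T, exists w', Bad p.1 p.2 -> Bad p.1.+1 w' /\
      forall i, cn (coord i w' - coord i p.2) <= K / 2 ^+ p.1 by exists f.
  move=> [k w] /=; case: (pselect (Bad k w)) => [/step[w' Hw']|nB]; first by exists w'.
  by exists w => /nB.
pose u := fix u n := if n is m.+1 then f (m, u m) else w0.
have Bu k : Bad k (u k) by elim: k => [//|k /(Hf (k, _))[]].
have du i k : cn (coord i (u k.+1) - coord i (u k)) <= K / 2 ^+ k.
  by have [_ /(_ i)] := Hf (k, u k) (Bu k).
have duj i k j : cn (coord i (u (k + j)%N) - coord i (u k)) <=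
    2 * K / 2 ^+ k - 2 * K / 2 ^+ (k + j).
  elim: j => [|j IH]; first by rewrite addn0 !subrr cn0.
  apply: le_trans (cn_split (coord i (u (k + j)%N)) _ _) _; rewrite addnS.
  have := du i (k + j)%N; rewrite exprS => h; apply: le_trans (lerD h IH) _.
  have : (2 ^+ (k + j) : R) != 0 by rewrite gt_eqF ?exp2_gt0.
  have : (2 ^+ k : R) != 0 by rewrite gt_eqF ?exp2_gt0.
  by move=> n1 n2; apply: le_of_eq; field; exact/andP.
have dle i k n : (k <= n)%N -> cn (coord i (u n) - coord i (u k)) <= 2 * K / 2 ^+ k.
  move=> /subnKC <-; apply: le_trans (duj _ _ _) _.
  by rewrite gerBl divr_ge0 ?mulr_ge0 // ltW // exp2_gt0.
have /choice[ws Hws] : forall i, exists l, climit (fun k => coord i (u k)) l.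
  move=> i; apply: climit_cauchy => e e0.
  have [N HN] := half_pow_small (4 * K) e0; exists N => m n Nm Nn.
  apply: le_trans (cn_split (coord i (u N)) _ _) _; apply: le_trans (HN N (leqnn _)).
  rewrite (cnBC (coord i (u N))); have := dle i _ _ Nm; have := dle i _ _ Nn; lra.
exists ws => k; exists (u k); split => // i.
apply: le_of_lee => e /(Hws i)[N HN].
have := HN _ (leq_maxl N k); have := dle i _ _ (leq_maxr N k).
move: (u (maxn N k)) (u k) => x y h1 h2.
by apply: le_trans (cn_split (coord i x) _ _) _; rewrite cnBC; lra.
Qed.

Lemma descent (Bad : nat -> C -> Prop) (K : R) (w0 : C) : 0 <= K -> Bad 0%N w0 ->
  (forall k w, Bad k w -> exists w', Bad k.+1 w' /\ cn (w' - w) <= K / 2 ^+ k) ->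
  exists ws, forall k, exists w, Bad k w /\ cn (w - ws) <= 2 * K / 2 ^+ k.
Proof.
move=> K0 B0 step; have [|ws Hws] := @descent_coord C unit (fun=> id) Bad K w0 K0 B0.
  by move=> k w /step[w' [? ?]]; exists w'.
by exists (ws tt) => k; have [w [? /(_ tt)]] := Hws k; exists w.
Qed.

(** If a segment violates the bound with slope K + e, so does one of its halves. The halves shrink
    to a point, where the bound on the derivative contradicts the violation. *)
Lemma mean_value_le (k : C -> C) (z h : C) (K : R) :
  (forall w, cn (w - z) <= cn h -> exists2 l, cder k w l & cn l <= K) ->
  cn (k (z + h) - k z) <= K * cn h.
Proof.
move=> H; apply: le_of_lee => e1 e10.
have [->|hn0] := eqVneq h 0; first by rewrite addr0 subrr cn0 mulr0; lra.
have h0 : 0 < cn h by rewrite cn_gt0.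
pose e := e1 / cn h; have e0 : 0 < e by rewrite divr_gt0.
have -> : e1 = e * cn h by rewrite /e divfK // gt_eqF.
rewrite -mulrDl leNgt; apply/negP => bad.
pose Bad j w := (exists2 t : R, 0 <= t /\ t + 1 / 2 ^+ j <= 1 & w = z + rc t * h) /\
  (K + e) * cn h / 2 ^+ j < cn (k (w + h / 2 ^+ j) - k w).
have B0 : Bad 0%N z.
  split; first by exists 0; rewrite ?rc0 ?mul0r ?addr0 // expr0; split; lra.
  by rewrite !expr0 !divr1.
have p2 j : (2 ^+ j : C) != 0 by rewrite expf_neq0 // pnatr_eq0.
have p2r j : (2 ^+ j : R) != 0 by rewrite gt_eqF ?exp2_gt0.
have [ws Hws] : exists ws, forall j, exists w, Bad j w /\ cn (w - ws) <= 2 * cn h / 2 ^+ j.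
  apply: descent (cn_ge0 h) B0 _ => j w [[t [t0 t1] wE] Hw].
  case: (ltP ((K + e) * cn h / 2 ^+ j.+1) (cn (k (w + h / 2 ^+ j.+1) - k w))) => H1.
    exists w; split; last by rewrite subrr cn0 divr_ge0 ?cn_ge0 // ltW // exp2_gt0.
    split => //; exists t => //; split => //; apply: le_trans t1.
    rewrite lerD2l !mul1r lef_pV2 ?posrE ?exp2_gt0 // exprS.
    by have := exp2_gt0 j; lra.
  exists (w + h / 2 ^+ j.+1); split; last first.
    rewrite addrAC subrr add0r cnM cnV cnX cn_nat ler_wpM2l ?cn_ge0 //.
    rewrite lef_pV2 ?posrE ?exp2_gt0 // exprS; by have := exp2_gt0 j; lra.
  split.
    exists (t + 1 / 2 ^+ j.+1).
      split; first by rewrite addr_ge0 // divr_ge0 // ltW ?exp2_gt0.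
      by apply: le_trans t1; rewrite -addrA lerD2l exprS; apply: le_of_eq; field.
    by rewrite wE rcD rcM rcV rcX rc1 rc_nat; field.
  have := cn_split (k (w + h / 2 ^+ j.+1)) (k (w + h / 2 ^+ j)) (k w).
  have -> : w + h / 2 ^+ j.+1 + h / 2 ^+ j.+1 = w + h / 2 ^+ j by rewrite exprS; field.
  have : (K + e) * cn h / 2 ^+ j = (K + e) * cn h / 2 ^+ j.+1 + (K + e) * cn h / 2 ^+ j.+1.
    by rewrite exprS; field.
  lra.
have wsb : cn (ws - z) <= cn h.
  apply: le_of_lee => d d0; have [N /(_ N (leqnn _)) HN] := half_pow_small (2 * cn h) d0.
  have [w [[[t [t0 t1] wE] _] hw]] := Hws N.
  apply: le_trans (cn_split w _ _) _; rewrite cnBC addrC lerD //; last exact: le_trans hw HN.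
  rewrite wE addrAC subrr add0r cnM cn_rc ger0_norm // ler_piMl ?cn_ge0 //.
  by apply: le_trans t1; rewrite lerDl divr_ge0 // ltW ?exp2_gt0.
have [l dl lK] := H _ wsb.
(* The ends of the N-th segment, of length a, lie within 2a and 3a of [ws]. Expanding at [ws] costs
   (e / 6) (2a + 3a), which is less than e a. *)
have [d d0 Hd] := dl _ (divr_gt0 e0 (ltr0n _ 6)).
have [N /(_ N (leqnn _)) HN] := half_pow_small (4 * cn h) d0.
have [w [[_ hw] wws]] := Hws N.
set h' := h / 2 ^+ N in hw.
have ch' : cn h' = cn h / 2 ^+ N by rewrite /h' cnM cnV cnX cn_nat.
set a := cn h / 2 ^+ N in ch'.
have a0 : 0 < a by rewrite divr_gt0 ?exp2_gt0.
have {}HN : 4 * a <= d by rewrite /a mulrA.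
have {}wws : cn (w - ws) <= 2 * a by rewrite /a mulrA.
have {}hw : (K + e) * a < cn (k (w + h') - k w) by rewrite /a mulrA.
have w2 : cn (w + h' - ws) <= 3 * a.
  by rewrite addrAC; apply: le_trans (cnD _ _) _; rewrite ch'; lra.
have h1 := Hd (w - ws) (le_lt_trans wws _).
have h2 := Hd (w + h' - ws) (le_lt_trans w2 _).
have {}h1 := h1 ltac:(lra); have {}h2 := h2 ltac:(lra).
move: h1 h2; rewrite ![ws + _]addrC !subrK => h1 h2.
have : cn (k (w + h') - k w - l * h') <= e / 6 * cn (w + h' - ws) + e / 6 * cn (w - ws).
  apply: le_trans (lerD h2 h1); rewrite -(cnN (k w - _ - _)).
  by apply: le_trans _ (cnD _ _); apply: le_of_eq; congr cn; ring.
have := cn_dist (k (w + h') - k w) (l * h'); rewrite cnM ch'.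
have : cn l * a <= K * a by rewrite ler_wpM2r // ltW.
have : e / 6 * cn (w + h' - ws) <= e / 6 * (3 * a) by rewrite ler_wpM2l // divr_ge0 // ltW.
have : e / 6 * cn (w - ws) <= e / 6 * (2 * a) by rewrite ler_wpM2l // divr_ge0 // ltW.
have : 0 < e * a by rewrite mulr_gt0.
move: hw; rewrite mulrDl; lra.
Qed.

Lemma der0_cst (f : C -> C) : (forall z, cder f z 0) -> forall z, f z = f 0.
Proof.
move=> H z; apply/eqP; rewrite -subr_eq0 -cn_eq0 eq_le cn_ge0 andbT.
have -> : 0 = 0 * cn z by rewrite mul0r.
rewrite -{1}[z]add0r; apply: mean_value_le => w _; exists 0 => //; by rewrite cn0.
Qed.

End Goursat.

(** * Goursat's lemma and mean values over roots of unity *)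

Section CauchyTheory.
Variable R : realType.
Local Notation C := (Cplx R).

(** The left Riemann sum with 2^m steps for the integral of F from w to w + v; [rect] is its
    analogue for the boundary of the parallelogram spanned by v and v' at w. *)
Definition seg (m : nat) (F : C -> C) (w v : C) : C :=
  v / 2 ^+ m * \sum_(k < 2 ^ m) F (w + k%:R / 2 ^+ m * v).
Definition rect m F (w v v' : C) : C :=
  seg m F w v + seg m F (w + v) v' - seg m F (w + v') v - seg m F w v'.

Lemma p2C k : (2 ^+ k : C) != 0. Proof. by rewrite expf_neq0 // pnatr_eq0. Qed.
Hint Resolve p2C : core.

Lemma seg_half m F w v :
  seg m.+1 F w v = seg m F w (v / 2) + seg m F (w + v / 2) (v / 2).
Proof.
have e2 : (2 ^ m.+1 = 2 ^ m + 2 ^ m)%N by rewrite expnS mul2n addnn.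
rewrite /seg e2 big_split_ord /= mulrDr exprS; congr (_ + _); congr (_ * _).
- by field.
- by apply: eq_bigr => k _; congr F; field.
- by field.
by apply: eq_bigr => k _; congr F; rewrite natrD natrX; field.
Qed.

Lemma rect_quarter m F w v v' : rect m.+1 F w v v' =
  rect m F w (v / 2) (v' / 2) + rect m F (w + v / 2) (v / 2) (v' / 2) +
  (rect m F (w + v' / 2) (v / 2) (v' / 2) +
   rect m F (w + v / 2 + v' / 2) (v / 2) (v' / 2)).
Proof.
rewrite /rect !seg_half.
have -> : w + v / 2 + v / 2 = w + v by field.
have -> : w + v' / 2 + v' / 2 = w + v' by field.
have -> : w + v / 2 + v' / 2 + v / 2 = w + v + v' / 2 by field.
have -> : w + v / 2 + v' / 2 + v' / 2 = w + v' + v / 2 by field.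
have -> : w + v' / 2 + v / 2 = w + v / 2 + v' / 2 by ring.
ring.
Qed.

Lemma segB m F G w v : seg m (fun z => F z - G z) w v = seg m F w v - seg m G w v.
Proof. by rewrite /seg sumrB mulrBr. Qed.

Lemma seg_aff m (a b w v : C) : seg m (fun z => a * z + b) w v =
  v * (a * w + b) + v ^+ 2 * (a / 2 ^+ m / 2 ^+ m * \sum_(k < 2 ^ m) k%:R).
Proof.
rewrite /seg; have -> : \sum_(k < 2 ^ m) (a * (w + k%:R / 2 ^+ m * v) + b) =
   2 ^+ m * (a * w + b) + a / 2 ^+ m * v * \sum_(k < 2 ^ m) k%:R.
  transitivity (\sum_(k < 2 ^ m) ((a * w + b) + a / 2 ^+ m * v * k%:R)).
    by apply: eq_bigr => k _; field.
  by rewrite big_split /= sumr_const card_ord -mulr_sumr -[X in X + _]mulr_natl natrX.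
by move: (\sum_(_ < _) _) => S; field.
Qed.

Lemma rect_aff m (a b w v v' : C) : rect m (fun z => a * z + b) w v v' = 0.
Proof. by rewrite /rect !seg_aff; move: (_ * \sum_(_ < _) _) => S; ring. Qed.

Lemma seg_bound m F (w v : C) M : 
  (forall t : R, 0 <= t <= 1 -> cn (F (w + rc t * v)) <= M) ->
  cn (seg m F w v) <= cn v * M.
Proof.
move=> H; rewrite /seg !cnM cnV cnX cn_nat -mulrA ler_wpM2l ?cn_ge0 //.
rewrite ler_pdivrMl ?exp2_gt0 //; apply: le_trans (cn_sum _ _ _) _.
apply: (@le_trans _ _ (\sum_(k < 2 ^ m) M)); last first.
  by rewrite sumr_const card_ord -natrX mulr_natl.
apply: ler_sum => k _; have -> : (k%:R / 2 ^+ m : C) = rc (k%:R / 2 ^+ m).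
  by rewrite rcM rcV rcX !rc_nat.
apply: H; rewrite divr_ge0 ?(ltW (exp2_gt0 _ _)) //= ler_pdivrMr ?exp2_gt0 // mul1r.
by rewrite -natrX ler_nat ltnW.
Qed.

Lemma rect_bound m F (w v v' : C) M :
  (forall z, cn (z - w) <= cn v + cn v' -> cn (F z) <= M) ->
  cn (rect m F w v v') <= 2 * (cn v + cn v') * M.
Proof.
move=> H.
have sb (u x : C) : (forall t : R, 0 <= t <= 1 -> cn (u + rc t * x - w) <= cn v + cn v') ->
   cn (seg m F u x) <= cn x * M by move=> h; apply: seg_bound => t /h /H.
have tb (t : R) x : 0 <= t <= 1 -> cn (rc t * x) <= cn x.
  by move=> /andP[t0 t1]; rewrite cnM cn_rc ger0_norm // ler_piMl ?cn_ge0.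
have hv := cn_ge0 v; have hv' := cn_ge0 v'.
have h1 := sb w v _; have h2 := sb (w + v) v' _; have h3 := sb (w + v') v _.
have h4 := sb w v' _.
have {}h1 : cn (seg m F w v) <= cn v * M.
  by apply: sb => t /(tb _ v) h; rewrite addrAC subrr add0r; lra.
have {}h2 : cn (seg m F (w + v) v') <= cn v' * M.
  apply: sb => t /(tb _ v') h; rewrite addrAC [w + v]addrC addrK.
  by apply: le_trans (cnD _ _) _; lra.
have {}h3 : cn (seg m F (w + v') v) <= cn v * M.
  apply: sb => t /(tb _ v) h; rewrite addrAC [w + v']addrC addrK.
  by apply: le_trans (cnD _ _) _; lra.
have {}h4 : cn (seg m F w v') <= cn v' * M.
  by apply: sb => t /(tb _ v') h; rewrite addrAC subrr add0r; lra.
rewrite /rect; apply: le_trans (cnB _ _) _; apply: le_trans (lerD (cnB _ _) (lexx _)) _.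
apply: le_trans (lerD (lerD (cnD _ _) (lexx _)) (lexx _)) _; nra.
Qed.

(* Goursat's lemma: [rect] vanishes exactly on affine maps and is additive
   under quartering, so that no integral is needed, only its dyadic sums. *)
Lemma goursat F (w v v' : C) : entire1 F -> climit (fun m => rect m F w v v') 0.
Proof.
move=> dF e e0; apply: contrapT => bad.
(* Large sums for arbitrarily fine subdivisions, not for one fixed m: if each quarter had a
   threshold beyond which its sums are small, the maximum of the four would serve for the whole. The
   shift from m + 1 to m in [rect_quarter] does no harm. *)
pose Bad k w := forall M, exists2 m, (M <= m)%N &
   e / 4 ^+ k < cn (rect m F w (v / 2 ^+ k) (v' / 2 ^+ k)).
have B0 : Bad 0%N w.
  move=> M; apply: contrapT => h; apply: bad; exists M => m Mm.
  rewrite subr0 leNgt; apply/negP => hm; apply: h; exists m => //.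
  by rewrite !expr0 !divr1.
have [ws Hws] : exists ws, forall k, exists w, Bad k w /\
    cn (w - ws) <= 2 * (cn v + cn v') / 2 ^+ k.
  apply: descent (addr_ge0 (cn_ge0 _) (cn_ge0 _)) B0 _ => k x Bx.
  pose u := v / 2 ^+ k / 2; pose u' := v' / 2 ^+ k / 2.
  have uE : u = v / 2 ^+ k.+1 by rewrite /u exprSr; field.
  have uE' : u' = v' / 2 ^+ k.+1 by rewrite /u' exprSr; field.
  have cu : cn u + cn u' <= (cn v + cn v') / 2 ^+ k.
    rewrite uE uE' !cnM !cnV !cnX !cn_nat -mulrDl ler_wpM2l ?addr_ge0 ?cn_ge0 //.
    rewrite lef_pV2 ?posrE ?exp2_gt0 // exprS; by have := exp2_gt0 R k; lra.
  have [x' [Bx' hx']] : exists x', Bad k.+1 x' /\ cn (x' - x) <= cn u + cn u'.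
    apply: contrapT => nB.
    have nb y : cn (y - x) <= cn u + cn u' -> exists M, forall m, (M <= m)%N ->
        cn (rect m F y u u') <= e / 4 ^+ k.+1.
      move=> hy; apply: contrapT => h; apply: nB; exists y; split => // M.
      apply: contrapT => h'; apply: h; exists M => m Mm; rewrite leNgt; apply/negP => hm.
      by apply: h'; exists m => //; rewrite -uE -uE'.
    have c0 := cn_ge0 u; have c0' := cn_ge0 u'.
    have [|M1 H1] := nb x; first by rewrite subrr cn0; lra.
    have [|M2 H2] := nb (x + u); first by rewrite addrAC subrr add0r; lra.
    have [|M3 H3] := nb (x + u'); first by rewrite addrAC subrr add0r; lra.
    have [|M4 H4] := nb (x + u + u').
      by rewrite (_ : x + u + u' - x = u + u') ?cnD //; ring.
    have [[//|m]] := Bx (maxn (maxn M1 M2) (maxn M3 M4)).+1.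
    rewrite ltnS !geq_max => /andP[/andP[m1 m2] /andP[m3 m4]].
    rewrite rect_quarter -/u -/u' ltNge => /negP; apply.
    apply: le_trans (cnD _ _) _; apply: le_trans (lerD (cnD _ _) (cnD _ _)) _.
    apply: le_trans (lerD (lerD (H1 _ m1) (H2 _ m2)) (lerD (H3 _ m3) (H4 _ m4))) _.
    have f0 : (4 ^+ k : R) != 0 by rewrite expf_neq0 // pnatr_eq0.
    by rewrite exprS; apply: le_of_eq; field.
  by exists x'; split => //; apply: le_trans hx' cu.
have [l dl] := dF ws.
set V := cn v + cn v' in Hws.
have V0 : 0 <= V by rewrite addr_ge0 ?cn_ge0.
(* A perimeter of 2 V / 2^N times a remainder of e' (3 V / 2^N) is 6 V^2 e' / 4^N; the summand 1
   keeps the denominator positive. *)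
have K0 : 0 < 6 * V ^+ 2 + 1 by have := sqr_ge0 V; lra.
have [d d0 Hd] := dl _ (divr_gt0 e0 K0).
have [N /(_ N (leqnn _)) HN] := half_pow_small (3 * V) (divr_gt0 d0 (ltr0n _ 2)).
have [x [Bx hx]] := Hws N; have [m _] := Bx 0%N; rewrite ltNge => /negP; apply.
set u := v / 2 ^+ N; set u' := v' / 2 ^+ N.
have cu : cn u + cn u' = V / 2 ^+ N.
  by rewrite /u /u' !cnM !cnV !cnX !cn_nat -mulrDl.
have -> : rect m F x u u' = rect m (fun z => F z - (l * z + (F ws - l * ws))) x u u'.
  have := rect_aff m l (F ws - l * ws) x u u'; rewrite /rect !segB => h.
  by rewrite -[LHS]subr0 -h; ring.
have p2 := exp2_gt0 R N.
apply: le_trans (@rect_bound _ _ _ _ _ (e / (6 * V ^+ 2 + 1) * (3 * V / 2 ^+ N)) _) _.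
  move=> z; rewrite cu => hz.
  have h3 : cn (z - ws) <= 3 * V / 2 ^+ N.
    apply: le_trans (cn_split x _ _) _; have := lerD hz hx.
    move=> h; apply: le_trans h _; apply: le_of_eq; field; exact: lt0r_neq0.
  have := Hd (z - ws); rewrite [ws + _]addrC subrK => h.
  rewrite (_ : F z - _ = F z - F ws - l * (z - ws)); last by ring.
  apply: le_trans (h _) _.
  - by apply: le_lt_trans h3 _; apply: le_lt_trans HN _; lra.
  - by rewrite ler_wpM2l // divr_ge0 // ltW.
rewrite cu; apply: (@le_trans _ _ (e / 4 ^+ N * (6 * V ^+ 2 / (6 * V ^+ 2 + 1)))).
  apply: le_of_eq; have -> : (4 : R) = 2 * 2 by ring.
  rewrite exprMn; field; by rewrite !lt0r_neq0.
rewrite ler_piMr ?divr_ge0 ?exprn_ge0 ?(ltW e0) // ler_pdivrMr // mul1r; lra.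
Qed.

Definition imunit : C := (0 +i* 1)%C.
(** Orders that are powers of 2 match the dyadic subdivisions of [seg]. *)
Definition w2 (m : nat) : C := cexp (2 * rc pi * imunit / 2 ^+ m).

Lemma cexp_2pi : cexp (2 * rc pi * imunit) = 1 :> C.
Proof.
have -> : 2 * rc pi * imunit = rc (pi *+ 2) * imunit by rewrite -rc_nat -rcM mulr_natl.
rewrite /cexp /imunit /rc /= !mul0r !mulr0 mulr1 subr0 addr0 expR0 !mul1r cos2pi sin2pi //.
Qed.

Lemma cexp_pi : cexp (rc pi * imunit) = -1 :> C.
Proof.
rewrite /cexp /imunit /rc /= !mul0r !mulr0 mulr1 subr0 addr0 expR0 !mul1r cospi sinpi.
by apply/eqP; rewrite eq_complex /= oppr0 !eqxx.
Qed.

Lemma w2_pow m k : w2 m ^+ k = cexp (k%:R / 2 ^+ m * (2 * rc pi * imunit)).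
Proof. by rewrite -cexpMn; congr cexp; field. Qed.

(** The order divides 2^m; were it smaller, the power with exponent 2^(m-1) would be 1, but it is
    e^(pi i) = -1. *)
Lemma w2_prim m : (2 ^ m).-primitive_root (w2 m).
Proof.
have wN : w2 m ^+ (2 ^ m) = 1.
  by rewrite w2_pow natrX divff ?mul1r ?cexp_2pi.
have [d dp dm] := prim_order_exists (expn_gt0 2 m) wN.
have [j jm dj] : exists2 j, (j <= m)%N & d = (2 ^ j)%N.
  by apply/(dvdn_pfactor _ _ (isT : prime 2)).
move: jm; rewrite leq_eqVlt => /predU1P[jm|jm]; first by move: dp; rewrite dj jm.
have : w2 m ^+ (2 ^ m.-1) = 1.
  apply/eqP; rewrite -(prim_order_dvd dp) dj dvdn_exp2l //.
  by rewrite -ltnS prednK // (leq_ltn_trans _ jm).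
case: m jm {wN dm dp} => // m _.
rewrite w2_pow natrX /= => h; have := cexp_pi.
have -> : rc pi * imunit = 2 ^+ m / 2 ^+ m.+1 * (2 * rc pi * imunit) by rewrite exprS; field.
rewrite h => /eqP; rewrite -addr_eq0 -[1 + 1]/(2%:R) pnatr_eq0 //.
Qed.

Lemma sum_w2 m j : ~~ (2 ^ m %| j)%N -> \sum_(k < 2 ^ m) (w2 m ^+ j) ^+ k = 0.
Proof.
move=> h; have h1 : w2 m ^+ j != 1 by rewrite -(prim_order_dvd (w2_prim m)).
apply: (mulfI (_ : w2 m ^+ j - 1 != 0)); first by rewrite subr_eq0.
rewrite mulr0 -subrX1 -exprM mulnC exprM (prim_expr_order (w2_prim m)) expr1n subrr //.
Qed.

Lemma cn_w2 m : cn (w2 m) = 1.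
Proof.
have : cn (w2 m) ^+ (2 ^ m) = 1 by rewrite -cnX (prim_expr_order (w2_prim m)) cn1.
by move/eqP; rewrite pexpr_eq1 ?expn_gt0 ?cn_ge0 // => /eqP.
Qed.

Definition mean (m : nat) (f : C -> C) (r : C) : C :=
  (\sum_(k < 2 ^ m) f (r * w2 m ^+ k)) / 2 ^+ m.

Lemma mean_cn m f r M : (forall z, cn z = cn r -> cn (f z) <= M) -> cn (mean m f r) <= M.
Proof.
move=> H; rewrite /mean cnM cnV cnX cn_nat ler_pdivrMr ?exp2_gt0 //.
apply: le_trans (cn_sum _ _ _) _; apply: (@le_trans _ _ (\sum_(k < 2 ^ m) M)); last first.
  by rewrite sumr_const card_ord -natrX mulr_natr.
by apply: ler_sum => k _; apply: H; rewrite cnM cnX cn_w2 expr1n mulr1.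
Qed.

Lemma meanB m f g r : mean m (fun z => f z - g z) r = mean m f r - mean m g r.
Proof. by rewrite /mean sumrB mulrBl. Qed.

Lemma mean_const m a r : mean m (fun=> a) r = a.
Proof.
by rewrite /mean sumr_const card_ord -[a *+ _]mulr_natr natrX mulfK.
Qed.

(** f(e^z) is entire with period 2 pi i. Goursat's lemma for a parallelogram with one side 2 pi i
    leaves only the two sides parallel to the period, whose Riemann sums are the means; the other
    two cancel by periodicity. *)
Lemma mean_dep (f : C -> C) (x0 x1 : C) :
  (forall z, z != 0 -> exists l, cder f z l) ->
  climit (fun m => mean m f (cexp x1) - mean m f (cexp x0)) 0.
Proof.
move=> df; pose F z := f (cexp z); pose T := 2 * rc pi * imunit.
have dF : entire1 F.
  move=> z; have [l dl] := df _ (cexp_neq0 z).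
  by exists (l * cexp z); apply: cder_comp (cder_cexp z) dl.
have FT z : F (z + T) = F z by rewrite /F cexpD cexp_2pi mulr1.
have sm m z : seg m F z T = T * mean m f (cexp z).
  rewrite /seg /mean mulrAC mulrA; congr (_ * _ / _); apply: eq_bigr => k _.
  by rewrite /F cexpD w2_pow.
have T0 : T != 0.
  rewrite !mulf_neq0 ?pnatr_eq0 //.
    by rewrite -cn_eq0 cn_rc normr_eq0 gt_eqF ?pi_gt0.
  by rewrite eq_complex /= oner_eq0 andbF.
have := @goursat F x0 (x1 - x0) T dF => /(climitZ T^-1); rewrite mulr0.
apply: climit_ext => m; rewrite /rect !sm.
have -> : seg m F (x0 + T) (x1 - x0) = seg m F x0 (x1 - x0).
  by rewrite /seg; congr (_ * _); apply: eq_bigr => k _; rewrite addrAC FT.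
have -> : x0 + (x1 - x0) = x1 by ring.
by field.
Qed.

Lemma cexp_ln (r : R) : 0 < r -> cexp (rc (ln r)) = rc r :> C.
Proof.
by move=> r0; rewrite /cexp /rc /= cos0 sin0 mulr1 mulr0 lnK // posrE.
Qed.

(** By [mean_dep] the radius may be shrunk until f is close to l on the circle. Nothing is required
    at 0, so that difference quotients are covered. *)
Lemma mean_limit (f : C -> C) (l : C) (r : R) : 0 < r ->
  (forall z, z != 0 -> exists l, cder f z l) ->
  (forall e, 0 < e -> exists2 d, 0 < d & forall z, 0 < cn z -> cn z < d -> cn (f z - l) <= e) ->
  climit (fun m => mean m f (rc r)) l.
Proof.
move=> r0 df H e e0.
have [d d0 Hd] := H _ (divr_gt0 e0 (ltr0n _ 2)).
pose r1 := d / 2; have r10 : 0 < r1 by rewrite divr_gt0.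
have := @mean_dep f (rc (ln r1)) (rc (ln r)) df.
rewrite !cexp_ln // => /(_ _ (divr_gt0 e0 (ltr0n _ 2)))[N HN].
exists N => m /HN; rewrite subr0 => h1.
have h2 : cn (mean m f (rc r1) - l) <= e / 2.
  rewrite -(mean_const m l (rc r1)) -meanB; apply: mean_cn => z.
  rewrite cn_rc gtr0_norm // => cz; apply: Hd; rewrite cz // /r1; lra.
by apply: le_trans (cn_split (mean m f (rc r1)) _ _) _; lra.
Qed.

Lemma entire_bound_center (f : C -> C) (r M : R) : 0 < r -> entire1 f ->
  (forall z, cn z = r -> cn (f z) <= M) -> cn (f 0) <= M.
Proof.
move=> r0 df H; apply: (@climit_le _ (fun m => mean m f (rc r))).
  apply: mean_limit => // e e0; have [l dl] := df 0.
  have [d d0 Hd] := cder_cont dl e0; exists d => // z _ /Hd; by rewrite add0r.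
exists 0%N => m _; apply: mean_cn => z; rewrite cn_rc gtr0_norm //; exact: H.
Qed.

Lemma entire1_shift (f : C -> C) (a : C) : entire1 f -> entire1 (fun z => f (a + z)).
Proof.
move=> df z; have [l dl] := df (a + z); exists (l * 1).
apply: (@cder_comp _ f (fun w => a + w)) => //.
by apply: cder_ext (cder_aff 1 a z) => w; rewrite mul1r addrC.
Qed.

(** The derivative is the mean of the difference quotient (f(a + z) - f(a)) / z, which avoids an
    integral formula; the term f(a) accounts for the factor 2. *)
Lemma cauchy_estimate (f : C -> C) (a l : C) (r M : R) : 0 < r -> entire1 f -> cder f a l ->
  (forall z, cn (z - a) <= r -> cn (f z) <= M) -> cn l <= 2 * M / r.
Proof.
move=> r0 df dl H; pose h z := (f (a + z) - f a) / z.
apply: (@climit_le _ (fun m => mean m h (rc r))).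
  apply: mean_limit => // [z z0|e e0].
    have [l' dl'] := entire1_shift a df z; eexists; apply: cderM (cderV z0 (cder_id z)).
    exact: cderB dl' (cder_cst _ _).
  have [d d0 Hd] := dl _ e0; exists d => // z z0 /Hd.
  rewrite -(@ler_pM2r _ (cn z)^-1) ?invr_gt0 // mulfK ?gt_eqF // -cnV -cnM.
  by rewrite mulrBl mulfK // -cn_gt0.
exists 0%N => m _; apply: mean_cn => z; rewrite cn_rc gtr0_norm // /h => zr.
rewrite cnM cnV zr ler_wpM2r ?invr_ge0 ?(ltW r0) //; apply: le_trans (cnB _ _) _.
rewrite mulr_natl mulr2n lerD // H ?subrr ?cn0 ?(ltW r0) //.
by rewrite addrAC subrr add0r zr.
Qed.

End CauchyTheory.

(** * Entire functions of one variable *)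

Section Compactness.
Variables (R : realType) (n : nat).
Local Notation C := (Cplx R).
Local Notation Cn := 'rV[C]_n.

Definition pdisc (r : R) (z : Cn) := forall j, cn (z ord0 j) <= r.

(** Compactness of polydiscs by bisection: a box on which F is unbounded has an unbounded sub-box
    among the 4^n that arise from halving the real and imaginary parts of every coordinate. *)
Lemma pdisc_bound (F : Cn -> R) (r : R) :
  (forall z, exists2 d, 0 < d & exists M, forall w, pdisc d (w - z) -> F w <= M) ->
  exists M, forall z, pdisc r z -> F z <= M.
Proof.
(* A polydisc of negative radius is empty, except for n = 0, where it is the whole space. *)
move=> loc; have [r0|r0] := ltP r 0.
  have [n0|n0] := posnP n.
    have [d d0 [M HM]] := loc 0; exists M => z _; apply: HM => j.
    by have := ltn_ord j; rewrite {2}n0.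
  exists 0 => z /(_ (Ordinal n0)) h; have := cn_ge0 (z ord0 (Ordinal n0)); lra.
apply: contrapT => unb.
pose im (x : C) : R := complex.Im (x : R[i]).
pose box (w : Cn) (s : R) (z : Cn) := forall j, `|re (z ord0 j) - re (w ord0 j)| <= s /\
   `|im (z ord0 j) - im (w ord0 j)| <= s.
pose Bad k w := forall M, exists2 z, box w (r / 2 ^+ k) z & M < F z.
have imB (x y : C) : im (x - y) = im x - im y by case: x y => a b [].
have B0 : Bad 0%N 0.
  move=> M; apply: contrapT => h; apply: unb; exists M => z pz.
  rewrite leNgt; apply/negP => Fz; apply: h; exists z => // j; rewrite mxE.
  rewrite expr0 divr1 [re 0]/= [im 0]/= !subr0; split; apply: le_trans (pz j).
    exact: re_le.
  exact: im_le.
pose sg (b : bool) (x : R) : R := if b then x else - x.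
have [ws Hws] : exists ws : 'I_n -> C, forall k, exists w, Bad k w /\
    forall j, cn (w ord0 j - ws j) <= 2 * r / 2 ^+ k.
  apply: (descent_coord r0 B0) => k w Bw.
  set s := r / 2 ^+ k in Bw *; pose s' := s / 2.
  have s'E : s' = r / 2 ^+ k.+1 by rewrite /s' /s exprSr invfM mulrA.
  have s'0 : 0 <= s' by rewrite /s' /s !divr_ge0 ?exprn_ge0.
  pose ctr (f : {ffun 'I_n -> bool * bool}) : Cn :=
    \row_j (w ord0 j + ((sg (f j).1 s') +i* (sg (f j).2 s'))%C).
  have sgs b : `|sg b s'| <= s' by rewrite /sg; case: b; rewrite ?normrN ger0_norm.
  have dctr f j : cn (ctr f ord0 j - w ord0 j) <= s.
    rewrite mxE addrAC subrr add0r; apply: le_trans (cn_le _) _ => /=.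
    apply: le_trans (lerD (sgs _) (sgs _)) _; rewrite /s'; lra.
  have [f Bf] : exists f, Bad k.+1 (ctr f).
    apply: contrapT => nB.
    have /choice[M HM] : forall f, exists M, forall z, box (ctr f) s' z -> F z <= M.
      move=> f; apply: contrapT => h; apply: nB; exists f => M.
      apply: contrapT => h'; apply: h; exists M => z bz.
      by rewrite leNgt; apply/negP => Fz; apply: h'; exists z => //; rewrite -s'E.
    have [z bz] := Bw (\sum_f `|M f|); rewrite ltNge => /negP; apply.
    (* The signs of the real coordinates of z - w select the sub-box that contains z. *)
    pose f := [ffun j => (0 <= re (z ord0 j) - re (w ord0 j), 0 <= im (z ord0 j) - im (w ord0 j))].
    have half (x y : R) : `|x - y| <= s -> `|x - (y + sg (0 <= x - y) s')| <= s'.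
      rewrite /sg /s'; case: ifP => [h|/negbT]; rewrite -?ltNge ?ler_norml => h' /=.
        by move/andP: h' => [h1 h2]; apply/andP; split; lra.
      by move=> /andP[h1 h2]; apply/andP; split; lra.
    apply: le_trans (HM f z _) _.
      move=> j; have [h1 h2] := bz j; rewrite mxE ffunE /=; move: h1 h2.
      by case: (w ord0 j) => a b /= /half h1 /half h2.
    apply: le_trans (ler_norm _) _; rewrite (bigD1 f) //= lerDl.
    by apply: sumr_ge0.
  by exists (ctr f); split.
pose wv : Cn := \row_j ws j.
have [d d0 [M HM]] := loc wv.
have [N /(_ N (leqnn _)) HN] := half_pow_small (4 * r) d0.
have [w [Bw hw]] := Hws N.
have [z bz] := Bw M; rewrite ltNge => /negP; apply; apply: HM => j; rewrite !mxE.
apply: le_trans (cn_split (w ord0 j) _ _) _.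
have [h1 h2] := bz j; have h3 := hw j.
have : cn (z ord0 j - w ord0 j) <= r / 2 ^+ N + r / 2 ^+ N.
  by apply: le_trans (cn_le _) _; rewrite reD reN; apply: lerD => //; rewrite -[complex.Im _]/(im _) imB.
move: HN h3; rewrite -!mulrA; set t := r / _; lra.
Qed.

End Compactness.

Section OneVariable.
Variable R : realType.
Local Notation C := (Cplx R).
Implicit Types (f g : C -> C) (r M : R).

Lemma entire1_bounded f r : entire1 f -> exists M, forall z, cn z <= r -> cn (f z) <= M.
Proof.
move=> df; have [|M HM] := @pdisc_bound R 1 (fun z => cn (f (z ord0 ord0))) r.
  move=> z; have [l dl] := df (z ord0 ord0); have [d d0 Hd] := cder_cont dl ltr01.
  exists (d / 2); first by rewrite divr_gt0.
  exists (1 + cn (f (z ord0 ord0))) => w /(_ ord0); rewrite !mxE => h.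
  have lt1 : cn (w ord0 ord0 - z ord0 ord0) < d by apply: le_lt_trans h _; lra.
  have := Hd _ lt1; rewrite [z _ _ + _]addrC subrK.
  by have := cn_dist (f (w ord0 ord0)) (f (z ord0 ord0)); lra.
exists M => z cz; have := HM (const_mx z); rewrite mxE; apply => j; by rewrite mxE.
Qed.

Definition der f z : C := xget 0 [set l | cder f z l].

Lemma derE f z l : cder f z l -> der f z = l.
Proof.
move=> dl; apply: (cder_uniq _ dl).
exact: (@xgetPex _ 0 [set l | cder f z l] (ex_intro _ l dl)).
Qed.

Lemma derP f z : entire1 f -> cder f z (der f z).
Proof. by move=> /(_ z)[l dl]; rewrite (derE dl). Qed.

Lemma der_bound f a (r M : R) : 0 < r -> entire1 f ->
  (forall z, cn (z - a) <= r -> cn (f z) <= M) ->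
  forall z, cn (z - a) <= r / 2 -> cn (der f z) <= 4 * M / r.
Proof.
move=> r0 df H z hz; have r2 : 0 < r / 2 by rewrite divr_gt0.
apply: le_trans (cauchy_estimate r2 df (derP z df) _) _.
  move=> w hw; apply: H; apply: le_trans (cn_split z _ _) _; lra.
by apply: le_of_eq; field; rewrite gt_eqF.
Qed.

Lemma lip_bound f a (r M : R) : 0 < r -> entire1 f ->
  (forall z, cn (z - a) <= r -> cn (f z) <= M) ->
  forall z h, cn (z - a) + cn h <= r / 2 -> cn (f (z + h) - f z) <= 4 * M / r * cn h.
Proof.
move=> r0 df H z h hz; apply: mean_value_le => w hw.
exists (der f w); first exact: derP.
apply: (der_bound r0 df H); apply: le_trans (cn_split z _ _) _; lra.
Qed.

(** Cauchy's estimate of radius r / 4 for the increment z -> f(h + z) - f(z), which [lip_bound]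
    bounds by (4 M / r) |h|. *)
Lemma der_lip f a (r M : R) : 0 < r -> entire1 f ->
  (forall z, cn (z - a) <= r -> cn (f z) <= M) ->
  forall h, cn h <= r / 4 -> cn (der f (a + h) - der f a) <= 32 * M / r ^+ 2 * cn h.
Proof.
move=> r0 df H h hh; pose g z := f (h + z) - f z.
have dg : entire1 g.
  move=> z; exists (der f (h + z) - der f z); apply: cderB (derP _ df).
  have dh := entire1_shift h df z; have [l dl] := dh.
  suff -> : der f (h + z) = l by [].
  rewrite [h + z]addrC; apply: derE; apply: lilo_ext dl => k.
  by congr (f _ - f _ - _); ring.
have r4 : 0 < r / 4 by rewrite divr_gt0.
have dga : cder g a (der f (a + h) - der f a).
  apply: cderB (derP _ df); apply: lilo_ext (derP (a + h) df) => k.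
  by congr (f _ - f _ - _); ring.
apply: le_trans (cauchy_estimate r4 dg dga (M := 4 * M / r * cn h) _) _.
  move=> z hz; rewrite /g [h + z]addrC; apply: (lip_bound r0 df H); lra.
by apply: le_of_eq; field; rewrite gt_eqF.
Qed.

Lemma second_order f a (r M : R) : 0 < r -> entire1 f ->
  (forall z, cn (z - a) <= r -> cn (f z) <= M) ->
  forall h, cn h <= r / 4 ->
    cn (f (a + h) - f a - der f a * h) <= 32 * M / r ^+ 2 * cn h ^+ 2.
Proof.
move=> r0 df H h hh; rewrite expr2 mulrA.
have M0 : 0 <= M by apply: le_trans (cn_ge0 _) (H a _); rewrite subrr cn0 ltW.
pose k w := f w - (der f a * w + 0).
have -> : f (a + h) - f a - der f a * h = k (a + h) - k a by rewrite /k; ring.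
apply: mean_value_le => w hw; exists (der f w - der f a).
  exact: cderB (derP _ df) (cder_aff _ _ _).
have -> : w = a + (w - a) by ring.
apply: le_trans (der_lip r0 df H _) _; first lra.
by rewrite ler_wpM2l // divr_ge0 ?sqr_ge0 // mulr_ge0.
Qed.

(* Pointwise limits suffice: the bounds of [second_order] are uniform. *)
Lemma entire1_limit (fs : nat -> C -> C) f : (forall k, entire1 (fs k)) ->
  (forall r, exists M, forall k z, cn z <= r -> cn (fs k z) <= M) ->
  (forall z, climit (fun k => fs k z) (f z)) ->
  forall z, exists2 l, cder f z l & climit (fun k => der (fs k) z) l.
Proof.
move=> dfs bfs lim a.
have [M HM] := bfs (cn a + 4).
have M0 : 0 <= M by apply: le_trans (cn_ge0 _) (HM 0%N a _); lra.
have bd k z : cn (z - a) <= 4 -> cn (fs k z) <= M.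
  by move=> h; apply: HM; have := cn_dist z a; lra.
have so k h : cn h <= 1 -> cn (fs k (a + h) - fs k a - der (fs k) a * h) <= 2 * M * cn h ^+ 2.
  move=> h1; have := second_order (ltr0n _ 4) (dfs k) (bd k); rewrite divff ?gt_eqF //.
  move=> /(_ _ h1); have -> // : 32 * M / 4 ^+ 2 = 2 * M by field.
have [l Hl] : exists l, climit (fun k => der (fs k) a) l.
  apply: climit_cauchy => e e0.
  (* Derivatives are compared through difference quotients of step t: the two second-order errors
     together cost at most e t / 4, the four deviations from the limit e t / 2. *)
  pose t := Num.min 1 (e / (16 * (M + 1))).
  have t0 : 0 < t by rewrite lt_min ltr01 divr_gt0 // mulr_gt0 //; lra.
  have t1 : t <= 1 by rewrite ge_min lexx.
  have tM : 4 * M * t <= e / 4.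
    have : t <= e / (16 * (M + 1)) by rewrite ge_min lexx orbT.
    rewrite ler_pdivlMr; first nra.
    by rewrite mulr_gt0 //; lra.
  have ct : cn (rc t) = t by rewrite cn_rc gtr0_norm.
  have et : 0 < e * t / 8 by rewrite divr_gt0 // mulr_gt0.
  have [N1 H1] := lim (a + rc t) _ et; have [N2 H2] := lim a _ et.
  exists (maxn N1 N2) => m k; rewrite !geq_max => /andP[m1 m2] /andP[k1 k2].
  rewrite -(@ler_pM2r _ t) // -{1}ct -cnM.
  have := so m (rc t); have := so k (rc t); rewrite ct => /(_ t1) s1 /(_ t1) s2.
  have h1 := H1 _ m1; have h2 := H1 _ k1; have h3 := H2 _ m2; have h4 := H2 _ k2.
  have -> : (der (fs m) a - der (fs k) a) * rc t =
    ((fs k (a + rc t) - fs k a - der (fs k) a * rc t) -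
     (fs m (a + rc t) - fs m a - der (fs m) a * rc t)) +
    (((fs m (a + rc t) - f (a + rc t)) - (fs k (a + rc t) - f (a + rc t))) -
     ((fs m a - f a) - (fs k a - f a))) by ring.
  apply: le_trans (cnD _ _) _; apply: le_trans (lerD (cnB _ _) (cnB _ _)) _.
  apply: le_trans (lerD (lerD s1 s2) (lerD (cnB _ _) (cnB _ _))) _.
  have : 4 * M * t * t <= e / 4 * t by rewrite ler_wpM2r // ltW.
  rewrite expr2; move: h1 h2 h3 h4; nra.
exists l => //; apply: (@lilo_quad _ _ (2 * M) 1) => // h h1.
apply: (@climit_le _ (fun k => fs k (a + h) - fs k a - der (fs k) a * h)).
  apply: climitD; last first.
    have -> : - (l * h) = - h * l by ring.
    apply: climit_ext (climitZ (- h) Hl) => k; ring.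
  by apply: climitD (lim _) _; rewrite -mulN1r; apply: climit_ext (climitZ (-1) (lim a)) => k; rewrite mulN1r.
by exists 0%N => k _; apply: so; exact: ltW.
Qed.

(** The quotients with step 2^-k are entire, locally uniformly bounded by [lip_bound], and converge
    to the derivative, so [entire1_limit] applies. *)
Lemma entire1_der f : entire1 f -> entire1 (der f).
Proof.
move=> df z0; have p2 k : (2 ^+ k : C) != 0 by rewrite expf_neq0 // pnatr_eq0.
pose h k : C := (2 ^+ k)^-1.
have ch k : cn (h k) = 1 / 2 ^+ k by rewrite /h cnV cnX cn_nat mul1r.
have ch1 k : cn (h k) <= 1.
  by rewrite ch ler_pdivrMr ?exp2_gt0 // mul1r exprn_ege1 // ler1n.
pose fs k z := (f (h k + z) - f z) * 2 ^+ k.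
have [] := @entire1_limit fs (der f) _ _ _ z0.
- move=> k z; have [l dl] := entire1_shift (h k) df z.
  eexists; apply: cderM (cder_cst _ _); exact: cderB dl (derP z df).
- move=> r; have [M HM] := entire1_bounded (`|r| * 2 + 2) df.
  have R0 : 0 < `|r| * 2 + 2 by have := normr_ge0 r; lra.
  exists (4 * M / (`|r| * 2 + 2)) => k z hz.
  have := @lip_bound f 0 _ M R0 df _ z (h k); rewrite subr0 /fs [h k + z]addrC.
  move=> H; rewrite cnM -ler_pdivlMr ?cn_gt0 // -cnV; apply: H.
    by move=> w; rewrite subr0; apply: HM.
  have := ch1 k; have := ler_norm r; lra.
- move=> z e e0; have [d d0 Hd] := derP z df e0.
  have [N HN] := half_pow_small 1 (divr_gt0 d0 (ltr0n _ 2)).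
  exists N => k /HN; rewrite -ch => hk.
  have hk' : cn (h k) < d by lra.
  have := Hd _ hk'.
  rewrite /fs [h k + z]addrC -(@ler_pM2r _ (cn (2 ^+ k))) ?cn_gt0 // -cnM.
  rewrite -mulrA -cnM /h mulVf // cn1 mulr1; apply: le_trans; apply: le_of_eq; congr cn.
  by rewrite /h; field.
by move=> l dl _; exists l.
Qed.

Definition dquot f z : C := if z == 0 then der f 0 else (f z - f 0) / z.

Lemma dquotE f z : f z = f 0 + z * dquot f z.
Proof.
rewrite /dquot; case: eqP => [->|/eqP z0]; first by rewrite mul0r addr0.
by rewrite mulrC divfK //; ring.
Qed.

Lemma dquot_bound f (r M : R) : 0 < r -> entire1 f ->
  (forall z, cn z <= r -> cn (f z) <= M) -> forall z, cn z <= r -> cn (dquot f z) <= 4 * M / r.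
Proof.
move=> r0 df H z hz.
have H' z' : cn (z' - 0) <= r -> cn (f z') <= M by rewrite subr0; apply: H.
have M0 : 0 <= M by apply: le_trans (cn_ge0 _) (H 0 _); rewrite cn0 ltW.
rewrite /dquot; case: eqP => [_|/eqP z0].
  by apply: (der_bound r0 df H'); rewrite subrr cn0; lra.
have cz : 0 < cn z by rewrite cn_gt0.
rewrite cnM cnV ler_pdivrMr //.
have [h|h] := leP (cn z) (r / 2).
  have := @lip_bound f 0 _ M r0 df H' 0 z; rewrite subrr cn0 !add0r; exact.
apply: le_trans (cnB _ _) _.
have h1 := H z hz; have h2 : cn (f 0) <= M by apply: H; rewrite cn0 ltW.
apply: le_trans (lerD h1 h2) _; rewrite mulrAC ler_pdivlMr //; nra.
Qed.

(** Only the point 0 is critical. There the mean value inequality turns the second-order bound for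
    f' into f(h) = f(0) + f'(0) h + f''(0) h^2 / 2 + O(h^3), whence the derivative f''(0) / 2. *)
Lemma dquot_entire1 f : entire1 f -> entire1 (dquot f).
Proof.
move=> df z; have [->|z0] := eqVneq z 0; last first.
  have cz : 0 < cn z by rewrite cn_gt0.
  have : cder (fun w => (f w - f 0) * w^-1) z
      ((der f z - 0) * z^-1 + (f z - f 0) * (- 1 / z ^+ 2)).
    exact: cderM (cderB (derP z df) (cder_cst _ _)) (cderV z0 (cder_id z)).
  set l := (_ + _); move=> dl; exists l => e e0; have [d d0 Hd] := dl _ e0.
  exists (Num.min d (cn z)); first by rewrite lt_min d0.
  move=> h; rewrite lt_min => /andP[/Hd hd hz]; move: hd; rewrite /dquot (negPf z0).
  case: eqP => [zh|_]; last by [].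
  move: hz; have -> : z = - h by apply/eqP; rewrite -addr_eq0 zh.
  by rewrite cnN ltxx.
have df' := entire1_der df.
pose c := der (der f) 0.
have [M HM] := entire1_bounded 4 df'.
have so h : cn h <= 1 -> cn (der f h - der f 0 - c * h) <= 2 * M * cn h ^+ 2.
  move=> h1; have := @second_order (der f) 0 4 M (ltr0n _ 4) df' _ h; rewrite divff ?gt_eqF //.
  rewrite add0r; have -> : 32 * M / 4 ^+ 2 = 2 * M by field.
  by apply => // w; rewrite subr0; apply: HM.
have M0 : 0 <= M by apply: le_trans (cn_ge0 _) (HM 0 _); rewrite cn0.
have to h : cn h <= 1 -> cn (f h - f 0 - der f 0 * h - c / 2 * h ^+ 2) <= 2 * M * cn h ^+ 2 * cn h.
  move=> h1; pose k w := f w - (der f 0 * w + c / 2 * (w * w)).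
  have -> : f h - f 0 - der f 0 * h - c / 2 * h ^+ 2 = k (0 + h) - k 0 by rewrite /k add0r; field.
  apply: mean_value_le => w; rewrite subr0 => hw.
  exists (der f w - (der f 0 * 1 + c / 2 * (1 * w + w * 1))).
    apply: cderB (derP w df) _; apply: cderD; first exact: cderZ (cder_id w).
    exact: cderZ (cderM (cder_id w) (cder_id w)).
  have -> : der f w - (der f 0 * 1 + c / 2 * (1 * w + w * 1)) = der f w - der f 0 - c * w by field.
  apply: le_trans (so w _) _; first lra.
  by rewrite ler_wpM2l ?mulr_ge0 // lerXn2r ?nnegrE ?cn_ge0.
exists (c / 2); apply: (@lilo_quad _ _ (2 * M) 1) => // h h1; rewrite add0r /dquot eqxx.
case: eqP => [->|/eqP h0].
  by rewrite mulr0 subr0 subrr cn0 mulr_ge0 ?sqr_ge0 // mulr_ge0.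
have ch : 0 < cn h by rewrite cn_gt0.
rewrite -(@ler_pM2r _ (cn h)) // -cnM; apply: le_trans (to h (ltW h1)).
by apply: le_of_eq; congr cn; field.
Qed.

(** The Taylor coefficient of index i at 0, obtained by repeatedly removing the constant term and
    dividing by z; no higher derivatives or factorials are involved. *)
Definition tcoef f i : C := iter i dquot f 0.

Lemma iter_dquot_entire1 f i : entire1 f -> entire1 (iter i dquot f).
Proof. by move=> df; elim: i => //= i; apply: dquot_entire1. Qed.

Lemma taylor_expand f K z : f z = \sum_(i < K) tcoef f i * z ^+ i + z ^+ K * iter K dquot f z.
Proof.
elim: K => [|K IH]; first by rewrite big_ord0 add0r expr0 mul1r.
by rewrite big_ord_recr /= {1}IH (dquotE (iter K dquot f)) exprS /tcoef; ring.
Qed.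

(** Each division by z costs 4 / r rather than the optimal order 1 / r. Expansions are therefore
    used for |z| <= r / 8 only, which is no loss for entire functions; this is the origin of the
    factors 8 below. *)
Lemma iter_dquot_bound f (r M : R) : 0 < r -> entire1 f ->
  (forall z, cn z <= r -> cn (f z) <= M) ->
  forall K z, cn z <= r -> cn (iter K dquot f z) <= M * (4 / r) ^+ K.
Proof.
move=> r0 df H K; elim: K => [z hz|K IH z hz]; first by rewrite expr0 mulr1 H.
apply: le_trans (dquot_bound r0 (iter_dquot_entire1 K df) IH hz) _.
by rewrite exprSr; apply: le_of_eq; ring.
Qed.

Lemma tcoef_bound f (r M : R) i : 0 < r -> entire1 f ->
  (forall z, cn z <= r -> cn (f z) <= M) -> cn (tcoef f i) <= M * (4 / r) ^+ i.
Proof. by move=> r0 df H; apply: (iter_dquot_bound r0 df H); rewrite cn0 ltW. Qed.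

Lemma taylor_rem f (r M : R) K z : 0 < r -> entire1 f ->
  (forall z, cn z <= r -> cn (f z) <= M) -> cn z <= r ->
  cn (f z - \sum_(i < K) tcoef f i * z ^+ i) <= M * (4 * cn z / r) ^+ K.
Proof.
move=> r0 df H hz; rewrite {1}(taylor_expand f K z) addrAC subrr add0r cnM cnX.
apply: le_trans (ler_wpM2l _ (iter_dquot_bound r0 df H K hz)) _; first by rewrite exprn_ge0 ?cn_ge0.
have -> : 4 * cn z / r = cn z * (4 / r) by rewrite mulrA (mulrC 4).
by rewrite [(cn z * _) ^+ _]exprMn; apply: le_of_eq; rewrite mulrCA.
Qed.

Lemma taylor_approx f r e : entire1 f -> 0 < e ->
  exists N, forall K z, (N <= K)%N -> cn z <= r ->
    cn (f z - \sum_(i < K) tcoef f i * z ^+ i) <= e.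
Proof.
move=> df e0; pose r8 := 8 * (`|r| + 1).
have r80 : 0 < r8 by rewrite /r8; have := normr_ge0 r; lra.
have [M HM] := entire1_bounded r8 df.
have M0 : 0 <= M by apply: le_trans (cn_ge0 _) (HM 0 _); rewrite cn0 ltW.
have [N HN] := half_pow_small M e0; exists N => K z /HN NK hz.
have hr := ler_norm r; have nr := normr_ge0 r; have cz := cn_ge0 z.
apply: le_trans (taylor_rem K r80 df HM _) _; first by rewrite /r8; lra.
apply: le_trans NK; rewrite ler_wpM2l // -exprVn.
have h1 : 0 <= 4 * cn z / r8 by rewrite divr_ge0 ?mulr_ge0 // ltW.
rewrite lerXn2r ?nnegrE ?invr_ge0 // ler_pdivrMr // /r8; lra.
Qed.

Lemma taylor_limit f z : entire1 f -> climit (fun K => \sum_(i < K) tcoef f i * z ^+ i) (f z).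
Proof.
move=> df e e0; have [N HN] := taylor_approx (cn z) df e0.
by exists N => K NK; rewrite cnBC HN.
Qed.

Lemma entire1_identity f (a : C) d : entire1 f -> 0 < d ->
  (forall z, cn (z - a) < d -> f z = 0) -> forall z, f z = 0.
Proof.
move=> df d0 H z0.
pose g z := f (a + z); have dg : entire1 g := entire1_shift a df.
have gz i : forall z, cn z < d -> iter i dquot g z = 0.
  elim: i => [z hz /=|i IH z hz /=]; first by apply: H; rewrite addrAC subrr add0r.
  rewrite /dquot; case: eqP => [_|_]; last by rewrite !IH ?cn0 // subrr mul0r.
  apply: derE => e e0; exists d => // h hd; rewrite add0r !IH ?cn0 //.
  by rewrite subrr mul0r subr0 cn0 mulr_ge0 ?cn_ge0 // ltW.
have -> : f z0 = g (z0 - a) by rewrite /g; congr f; ring.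
apply: climit_uniq (taylor_limit (z0 - a) dg) _.
apply: climit_ext (climit_cst 0) => K; rewrite big1 // => i _.
by rewrite /tcoef gz ?cn0 // mul0r.
Qed.

Lemma entire1_sum (I : Type) (s : seq I) (F : I -> C -> C) :
  (forall i, entire1 (F i)) -> entire1 (fun z => \sum_(i <- s) F i z).
Proof.
move=> dF z; elim: s => [|i s [l dl]]; first by exists 0; apply: cder_ext (cder_cst 0 z) => w; rewrite big_nil.
have [l' dl'] := dF i z; exists (l' + l).
by apply: cder_ext (cderD dl' dl) => w; rewrite big_cons.
Qed.

Lemma cder_exp m (z : C) : cder (fun w : C => w ^+ m) z (m%:R * z ^+ m.-1).
Proof.
elim: m => [|m IH]; first by rewrite mul0r; apply: cder_ext (cder_cst 1 z) => w.
have := cderM (cder_id z) IH; rewrite mul1r.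
have -> : z ^+ m + z * (m%:R * z ^+ m.-1) = m.+1%:R * z ^+ m.+1.-1.
  by case: m {IH} => [|m] /=; rewrite ?mul0r ?mulr0 ?addr0 ?mul1r // -[m.+2%:R]natr1 exprS; ring.
by apply: cder_ext => w; rewrite exprS.
Qed.

(** The Taylor series integrated term by term and cut off at K. The finite sums are kept because
    they inherit holomorphy in a parameter from the coefficients, which [hol_log] uses. *)
Definition primitive f : nat -> C -> C := fun K z =>
  \sum_(i < K) tcoef f i / i.+1%:R * z ^+ i.+1.

Lemma primitive_der f K z : cder (primitive f K) z (\sum_(i < K) tcoef f i * z ^+ i).
Proof.
elim: K => [|K IH].
  by rewrite big_ord0; apply: cder_ext (cder_cst 0 z) => w; rewrite /primitive big_ord0.
rewrite big_ord_recr /=; have := cderD IH (cderZ (tcoef f K / K.+1%:R) (cder_exp K.+1 z)).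
rewrite mulrA divfK ?pnatr_eq0 //.
by apply: cder_ext => w; rewrite /primitive big_ord_recr.
Qed.

Lemma primitive_bound f (r M : R) K z : 0 < r -> entire1 f ->
  (forall z, cn z <= 8 * r -> cn (f z) <= M) -> cn z <= r ->
  cn (primitive f K z) <= 2 * M * r.
Proof.
move=> r0 df H hz.
have M0 : 0 <= M by apply: le_trans (cn_ge0 _) (H 0 _); rewrite cn0 mulr_ge0 // ltW.
suff : cn (primitive f K z) <= 2 * M * r - 2 * M * r / 2 ^+ K.
  by move=> h; apply: le_trans h _; rewrite gerBl divr_ge0 ?mulr_ge0 // ltW // exp2_gt0.
elim: K => [|K IH]; first by rewrite /primitive big_ord0 cn0 divr1 subrr.
rewrite /primitive big_ord_recr /=; apply: le_trans (cnD _ _) _.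
apply: le_trans (lerD IH (lexx _)) _.
have r8 : 0 < 8 * r by rewrite mulr_gt0.
have h1 := tcoef_bound K r8 df H.
have -> : 2 * M * r - 2 * M * r / 2 ^+ K.+1 = 2 * M * r - 2 * M * r / 2 ^+ K + M * r / 2 ^+ K.
  by rewrite exprS; field; rewrite gt_eqF ?exp2_gt0.
rewrite lerD2l !cnM cnV cn_nat cnX exprS.
apply: (@le_trans _ _ (M * (4 / (8 * r)) ^+ K / 1 * (r * r ^+ K))).
  apply: ler_pM; rewrite ?divr_ge0 ?mulr_ge0 ?exprn_ge0 ?cn_ge0 //.
    apply: ler_pM => //; rewrite ?cn_ge0 ?invr_ge0 //.
    by rewrite lef_pV2 ?posrE // ler1n.
  by apply: ler_pM; rewrite ?cn_ge0 ?exprn_ge0 ?cn_ge0 // lerXn2r ?nnegrE ?cn_ge0 // ltW.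
rewrite divr1; have -> : 4 / (8 * r) = (2 * r)^-1 by field; rewrite gt_eqF.
rewrite exprVn exprMn; apply: le_of_eq; field; rewrite !expf_neq0 ?gt_eqF //.
Qed.

Lemma primitive_exists f : entire1 f -> exists2 F, forall z, climit (fun K => primitive f K z) (F z) &
   F 0 = 0 /\ forall z, cder F z (f z).
Proof.
move=> df.
have lim z : exists l, climit (fun K => primitive f K z) l.
  apply: climit_cauchy => e e0; have e1 : 0 < e / (cn z + 1) / 2 by rewrite !divr_gt0 //; have := cn_ge0 z; lra.
  have [N HN] := taylor_approx (cn z) df e1; exists N => m n Nm Nn.
  have := @mean_value_le _ (fun w => primitive f m w - primitive f n w) 0 z (e / (cn z + 1)).
  rewrite add0r; have p0 k : primitive f k 0 = 0.
    by rewrite /primitive big1 // => i _; rewrite exprS mul0r mulr0.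
  rewrite !p0 !subr0 => h; apply: le_trans (h _) _.
    move=> w; rewrite subr0 => hw; eexists; first by apply: cderB; apply: primitive_der.
    apply: le_trans (cn_split (f w) _ _) _; rewrite cnBC.
    by have h1 := HN _ _ Nm hw; have h2 := HN _ _ Nn hw; lra.
  by rewrite mulrAC ler_pdivrMr; have := cn_ge0 z; nra.
have [F HF] := choice lim; exists F => //; split.
  apply: climit_uniq (HF 0) _; apply: climit_ext (climit_cst 0) => K.
  by rewrite /primitive big1 // => i _; rewrite exprS mul0r mulr0.
move=> z; have [] := @entire1_limit (primitive f) F _ _ HF z.
- by move=> K w; eexists; apply: primitive_der.
- move=> r; pose r1 := `|r| + 1; have r10 : 0 < r1 by rewrite /r1; have := normr_ge0 r; lra.
  have [M HM] := entire1_bounded (8 * r1) df; exists (2 * M * r1) => K w hw.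
  by apply: primitive_bound => //; rewrite /r1; have := ler_norm r; lra.
move=> l dl Hl; suff -> : f z = l by [].
apply: climit_uniq (taylor_limit z df) _; apply: climit_ext Hl => K.
exact: derE (primitive_der f K z).
Qed.

End OneVariable.

(** * Jensen's and Schwarz's formulas *)

Section JensenSchwarz.
Variable R : realType.
Local Notation C := (Cplx R).
Implicit Types (f : C -> C).

Definition cj (z : C) : C := conjc (z : R[i]).
Lemma cjM (x y : C) : cj (x * y) = cj x * cj y. Proof. exact: (rmorphM (@conjc R)). Qed.
Lemma cjX (x : C) n : cj (x ^+ n) = cj x ^+ n. Proof. exact: (rmorphXn (@conjc R)). Qed.
Lemma cj0 : cj 0 = 0. Proof. exact: (rmorph0 (@conjc R)). Qed.
Lemma cj_sum (I : Type) (s : seq I) (P : pred I) (F : I -> C) :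
  cj (\sum_(i <- s | P i) F i) = \sum_(i <- s | P i) cj (F i).
Proof. exact: (rmorph_sum (@conjc R)). Qed.
Lemma addcj (x : C) : x + cj x = rc (2 * re x).
Proof.
case: x => a b; apply/eqP; rewrite /rc /re eq_complex /=; apply/andP; split; apply/eqP; ring.
Qed.
Lemma mulcj (x : C) : x * cj x = rc (cn x ^+ 2).
Proof.
case: x => a b; rewrite /cn /rc /= sqr_sqrtr ?addr_ge0 ?sqr_ge0 //.
by apply/eqP; rewrite eq_complex /=; apply/andP; split; apply/eqP; ring.
Qed.
Lemma cn_cj (x : C) : cn (cj x) = cn x.
Proof. by case: x => a b; rewrite /cn /= sqrrN. Qed.

Lemma cj_w2 m j k : (j <= 2 ^ m)%N ->
  cj (w2 R m ^+ (j * k)) = w2 R m ^+ ((2 ^ m - j) * k).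
Proof.
move=> jm; set w := w2 R m; have wN : w ^+ (2 ^ m) = 1 := prim_expr_order (w2_prim R m).
have w0 : w ^+ (j * k) != 0 by rewrite expf_neq0 // -cn_eq0 cn_w2 oner_eq0.
apply: (mulfI w0); rewrite mulcj cnX cn_w2 !expr1n rc1 -exprD -mulnDl subnKC //.
by rewrite exprM wN expr1n.
Qed.

(* Orthogonality of the characters [k |-> w ^+ (i * k)] of Z/2^m. *)
Lemma sample_coef m (c : nat -> C) (z : C) K j : (0 < j)%N -> (j < K)%N -> (K + j <= 2 ^ m)%N ->
  \sum_(k < 2 ^ m) rc (2 * re (\sum_(i < K) c i * (z * w2 R m ^+ k) ^+ i)) * cj (w2 R m ^+ (j * k))
  = 2 ^+ m * (c j * z ^+ j).
Proof.
move=> j0 jK KN; set w := w2 R m; have wN : w ^+ (2 ^ m) = 1 := prim_expr_order (w2_prim R m).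
have jN : (j <= 2 ^ m)%N by apply: leq_trans KN; rewrite leq_addl.
have w1 k : w ^+ (j * k) * cj (w ^+ (j * k)) = 1 by rewrite mulcj cnX cn_w2 !expr1n rc1.
(* 2 Re P = P + conj P. In the part from P only i = j survives; in the conjugate part the exponents
   i + j lie strictly between 0 and 2^m, so everything cancels. The hypothesis [K + j <= 2 ^ m]
   excludes aliasing. *)
transitivity (\sum_(k < 2 ^ m) \sum_(i < K) (c i * z ^+ i * (w ^+ (i + (2 ^ m - j))) ^+ k)
   + cj (\sum_(k < 2 ^ m) \sum_(i < K) c i * z ^+ i * (w ^+ (i + j)) ^+ k)).
  rewrite cj_sum -big_split; apply: eq_bigr => k _; rewrite -addcj mulrDl; congr (_ + _).
    rewrite mulr_suml; apply: eq_bigr => i _.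
    by rewrite exprMn -!exprM (mulnC k) cj_w2 // mulnDl exprD; ring.
  rewrite cj_sum mulr_suml cj_sum; apply: eq_bigr => i _.
  rewrite -cjM; congr cj; rewrite exprMn -!exprM mulnDl exprD (mulnC k); ring.
rewrite [X in cj X](_ : _ = 0) ?cj0 ?addr0.
  rewrite exchange_big (bigD1 (Ordinal jK)) //= [X in _ + X]big1 ?addr0 => [|i].
        rewrite -mulr_sumr subnKC // wN (eq_bigr (fun=> 1)) => [|k _]; last by rewrite expr1n.
    by rewrite sumr_const card_ord natrX mulrC.
  rewrite -val_eqE /= => ij; rewrite -mulr_sumr sum_w2 ?mulr0 //.
  apply/negP => /dvdnP[q qE]; have : (0 < q * 2 ^ m < 2 * 2 ^ m)%N.
    rewrite -qE; have := ltn_ord i; lia.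
  have p2 : (0 < 2 ^ m)%N by rewrite expn_gt0.
  rewrite ltn_mul2r p2 muln_gt0 p2 andbT /= => /andP[q0 q2].
  have q1 : q = 1%N by lia.
  by move: ij qE; rewrite q1 mul1n; lia.
rewrite exchange_big big1 //= => i _; rewrite -mulr_sumr sum_w2 ?mulr0 //.
apply/negP => /dvdn_leq; rewrite addn_gt0 j0 orbT => /(_ isT).
by have := ltn_ord i; lia.
Qed.

Lemma sample_coef0 m (c : nat -> C) (z : C) K : (0 < K)%N -> (K <= 2 ^ m)%N ->
  \sum_(k < 2 ^ m) \sum_(i < K) c i * (z * w2 R m ^+ k) ^+ i = 2 ^+ m * c 0%N.
Proof.
move=> K0 KN; rewrite exchange_big (bigD1 (Ordinal K0)) //= [X in _ + X]big1 ?addr0 => [|i].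
  rewrite (eq_bigr (fun=> c 0%N)) => [|k _]; last by rewrite expr0 mulr1.
  by rewrite sumr_const card_ord -[LHS]mulr_natl natrX.
rewrite -val_eqE /= => i0; rewrite (eq_bigr (fun k : 'I_(2 ^ m) => c i * z ^+ i * (w2 R m ^+ i) ^+ k)).
  rewrite -mulr_sumr sum_w2 ?mulr0 //; apply/negP => /dvdn_leq.
  by rewrite lt0n => /(_ i0); have := ltn_ord i; lia.
by move=> k _; rewrite exprMn -!exprM (mulnC k); ring.
Qed.

Lemma re_sum (I : Type) (s : seq I) (F : I -> C) : re (\sum_(i <- s) F i) = \sum_(i <- s) re (F i).
Proof. by elim: s => [|i s IH]; rewrite ?big_nil // !big_cons reD IH. Qed.

(* The sample points may be rotated by an angle depending on [m]. *)
Lemma schwarz_coef f (r T : R) j : entire1 f -> 0 < r -> (0 < j)%N ->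
  (forall m, exists2 z : C, cn z = r &
     \sum_(k < 2 ^ m) Num.max (re (f (z * w2 R m ^+ k))) 0 <= 2 ^+ m * T) ->
  cn (tcoef f j) * r ^+ j <= 4 * T + 2 * cn (f 0).
Proof.
move=> df r0 j0 H; apply: le_of_lee => e e0.
have e4 : 0 < e / 4 by rewrite divr_gt0.
have [N HN] := taylor_approx r df e4.
pose K := (N + j).+1; have KN : (N <= K)%N by rewrite /K; lia.
pose m := (K + j)%N; have Km : (K + j <= 2 ^ m)%N by rewrite /m ltnW // ltn_expl.
have [z zr Hz] := H m.
pose w := w2 R m; pose P y := \sum_(i < K) tcoef f i * y ^+ i.
have cz k : cn (z * w ^+ k) = r by rewrite cnM cnX cn_w2 expr1n mulr1.
have fP k : cn (f (z * w ^+ k) - P (z * w ^+ k)) <= e / 4.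
  by apply: HN => //; rewrite cz.
have f0E : tcoef f 0 = f 0 by [].
have p2 := exp2_gt0 R m.
rewrite -(@ler_pM2l _ (2 ^+ m)) //.
have -> : 2 ^+ m * (cn (tcoef f j) * r ^+ j) = cn (2 ^+ m * (tcoef f j * z ^+ j)).
  by rewrite !cnM !cnX cn_nat zr.
rewrite -(@sample_coef m (tcoef f) z K j) //; last by rewrite /K; lia.
apply: le_trans (cn_sum _ _ _) _.
(* Here |Re f| = 2 max(Re f, 0) - Re f is used. The mean of the first term is controlled by T, and
   that of Re f is nearly Re f(0). *)
apply: (@le_trans _ _ (\sum_(k < 2 ^ m) (4 * Num.max (re (f (z * w ^+ k))) 0
    - 2 * re (f (z * w ^+ k)) + e / 2))).
  apply: ler_sum => k _; rewrite cnM cn_cj cnX cn_w2 expr1n mulr1 cn_rc normrM ger0_norm //.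
  rewrite -/(P _); have := fP k; set a := f _; set b := P _ => h.
  have h1 : `|re a - re b| <= e / 4 by rewrite -reN -reD; apply: le_trans (re_le _) h.
  have : `|re b| <= `|re a| + e / 4.
    rewrite -[re b](subrK (re a)) addrC; apply: le_trans (ler_normD _ _) _.
    by rewrite lerD2l distrC.
  have : `|re a| = 2 * Num.max (re a) 0 - re a.
    case: (leP (re a) 0) => h2; first by rewrite ler0_norm //; lra.
    by rewrite gtr0_norm //; lra.
  move: `|re b| `|re a| => x y; lra.
rewrite big_split /= sumr_const card_ord sumrB -!mulr_sumr -[(e / 2) *+ _]mulr_natl natrX.
have s0 : \sum_(k < 2 ^ m) P (z * w ^+ k) = 2 ^+ m * f 0.
  by rewrite -f0E; apply: (@sample_coef0 m (tcoef f) z K); rewrite /K; lia.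
have h3 : - \sum_(k < 2 ^ m) re (f (z * w ^+ k)) <= 2 ^+ m * (cn (f 0) + e / 4).
  have -> : \sum_(k < 2 ^ m) re (f (z * w ^+ k)) = re (2 ^+ m * f 0 +
      \sum_(k < 2 ^ m) (f (z * w ^+ k) - P (z * w ^+ k))).
    by rewrite sumrB s0 addrC subrK re_sum.
  rewrite -reN; apply: le_trans (ler_norm _) _; apply: le_trans (re_le _) _; rewrite cnN.
  apply: le_trans (cnD _ _) _; rewrite mulrDr; apply: lerD; first by rewrite cnM cnX cn_nat.
  apply: le_trans (cn_sum _ _ _) _.
  apply: (@le_trans _ _ (\sum_(k < 2 ^ m) (e / 4))); first by apply: ler_sum.
  by rewrite sumr_const card_ord -[(e / 4) *+ _]mulr_natl natrX.
move: h3 Hz; rewrite -/w; set A := \sum_(k < _) re _; set B := \sum_(k < _) Num.max _ _.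
move: (2 ^+ m) p2 => N2 p2; nra.
Qed.

Lemma entire1M f g : entire1 f -> entire1 g -> entire1 (fun z => f z * g z).
Proof. by move=> df dg z; eexists; apply: cderM (derP z df) (derP z dg). Qed.

Lemma entire1_prod (I : Type) (s : seq I) (F : I -> C -> C) :
  (forall i, entire1 (F i)) -> entire1 (fun z => \prod_(i <- s) F i z).
Proof.
move=> dF z; elim: s => [|i s [l dl]].
  by exists 0; apply: cder_ext (cder_cst 1 z) => w; rewrite big_nil.
have [l' dl'] := dF i z; eexists.
by apply: cder_ext (cderM dl' dl) => w; rewrite big_cons.
Qed.

(* The product of the 2^m rotates of [f] is entire with value [f 0 ^+ (2 ^ m)] at 0, so the maximum
   principle replaces Jensen's formula. *)
Lemma jensen_prod f (r : R) m : entire1 f -> 0 < r -> f 0 != 0 ->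
  exists2 z : C, cn z = r &
    (cn (f 0) / 2) ^+ (2 ^ m) <= \prod_(k < 2 ^ m) cn (f (z * w2 R m ^+ k)).
Proof.
move=> df r0 f0; pose G z := \prod_(k < 2 ^ m) f (z * w2 R m ^+ k).
have dG : entire1 G.
  apply: entire1_prod => k z; have [l dl] := df (z * w2 R m ^+ k).
  exists (l * w2 R m ^+ k); apply: (@cder_comp _ f (fun w => w * w2 R m ^+ k)) => //.
  by apply: cder_ext (cder_aff (w2 R m ^+ k) 0 z) => w; rewrite addr0 mulrC.
have G0 : cn (G 0) = cn (f 0) ^+ (2 ^ m).
  rewrite /G cn_prod (eq_bigr (fun=> cn (f 0))) => [|k _]; last by rewrite mul0r.
  by rewrite prodr_const card_ord.
have c0 : 0 < cn (f 0) by rewrite cn_gt0.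
(* The maximum principle yields a weak inequality only; the factor 1/2 in the claim makes it
   contradictory. *)
apply: contrapT => nex.
have : cn (G 0) <= (cn (f 0) / 2) ^+ (2 ^ m).
  apply: (entire_bound_center r0 dG) => z zr; rewrite leNgt; apply/negP => h.
  by apply: nex; exists z => //; rewrite -cn_prod ltW.
have hh : cn (f 0) / 2 < cn (f 0) by lra.
by rewrite G0 leNgt => /negP; apply; rewrite ltr_pXn2r ?expn_gt0 ?nnegrE ?divr_ge0 ?cn_ge0.
Qed.

(** Taking logarithms, the mean of (Re f)^+ is at most S minus the mean of ln |B|, and the latter
    mean is at least ln(|B(0)| / 2) for a suitable rotation of the sample points. The same rotated
    points then serve in Schwarz's formula, and zeros of B on the circle need no separate
    treatment. *)
Lemma jensen_schwarz f B (r S : R) j : entire1 f -> entire1 B -> 0 < r -> (0 < j)%N -> B 0 != 0 ->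
  (forall z, cn z = r -> cn (B z) * expR (Num.max (re (f z)) 0) <= expR S) ->
  cn (tcoef f j) * r ^+ j <= 4 * (S - ln (cn (B 0) / 2)) + 2 * cn (f 0).
Proof.
move=> df dB r0 j0 B0 H; apply: schwarz_coef => // m.
have [z zr Hz] := jensen_prod m dB r0 B0; exists z => //.
have b0 : 0 < cn (B 0) / 2 by rewrite divr_gt0 // cn_gt0.
have cz k : cn (z * w2 R m ^+ k) = r by rewrite cnM cnX cn_w2 expr1n mulr1.
have : (cn (B 0) / 2) ^+ (2 ^ m) *
    expR (\sum_(k < 2 ^ m) Num.max (re (f (z * w2 R m ^+ k))) 0) <= expR S ^+ (2 ^ m).
  apply: le_trans (ler_wpM2r (expR_ge0 _) Hz) _; rewrite expR_sum -big_split /=.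
  rewrite -[X in _ ^+ X](card_ord (2 ^ m)) -prodr_const; apply: ler_prod => k _.
  by rewrite mulr_ge0 ?cn_ge0 ?expR_ge0 // H.
rewrite -{1}(lnK (_ : cn (B 0) / 2 \is Num.pos)) ?posrE // -!expRM_natl -expRD ler_expR.
rewrite -mulr_natl natrX; lra.
Qed.

(** The coefficient bounds are summed over j >= 1; the geometric series in |z| / r gives |z| / (r -
    |z|). *)
Lemma jensen_schwarz_bound f B (r S : R) (z : C) : entire1 f -> entire1 B -> 0 < r -> B 0 != 0 ->
  (forall z, cn z = r -> cn (B z) * expR (Num.max (re (f z)) 0) <= expR S) ->
  cn z < r ->
  cn (f z - f 0) <= (4 * (S - ln (cn (B 0) / 2)) + 2 * cn (f 0)) * (cn z / (r - cn z)).
Proof.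
move=> df dB r0 B0 H zr; set Q := 4 * _ + _.
have cQ j : (0 < j)%N -> cn (tcoef f j) <= Q / r ^+ j.
  by move=> j0; rewrite ler_pdivlMr ?exprn_gt0 //; apply: (jensen_schwarz df dB).
have Q0 : 0 <= Q.
  have := cQ 1%N isT; rewrite expr1 ler_pdivlMr //; apply: le_trans.
  by rewrite mulr_ge0 ?cn_ge0 // ltW.
have cz := cn_ge0 z.
pose t := cn z / r; have t0 : 0 <= t by rewrite divr_ge0 // ltW.
have t1 : t < 1 by rewrite ltr_pdivrMr // mul1r.
have st K : \sum_(i < K) t ^+ i <= (1 - t)^-1.
  rewrite -[leRHS]mul1r ler_pdivlMr ?subr_gt0 // mulrC -opprB mulNr -subrX1 opprB.
  by rewrite gerBl exprn_ge0.
have tE : cn z / (r - cn z) = t / (1 - t).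
  by rewrite /t; field; rewrite !gt_eqF //; rewrite subr_gt0.
rewrite tE; apply: (@climit_le _ (fun K => \sum_(i < K.+1) tcoef f i * z ^+ i - f 0)).
  move=> e e0; have [N HN] := taylor_limit z df e0; exists N => K NK.
  have -> : \sum_(i < K.+1) tcoef f i * z ^+ i - f 0 - (f z - f 0) =
     \sum_(i < K.+1) tcoef f i * z ^+ i - f z by ring.
  by apply: HN; rewrite ltnW.
exists 0%N => K _; rewrite big_ord_recl expr0 mulr1 addrAC subrr add0r.
apply: le_trans (cn_sum _ _ _) _.
apply: (@le_trans _ _ (\sum_(i < K) Q * (t * t ^+ i))).
  apply: ler_sum => i _ /=; rewrite cnM cnX -exprS /t expr_div_n mulrCA.
  have := cQ (lift ord0 i) isT; rewrite /= => h.
  rewrite mulrC ler_wpM2l ?exprn_ge0 //.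
by rewrite -mulr_sumr -mulr_sumr ler_wpM2l // ler_wpM2l.
Qed.

End JensenSchwarz.

(** * Entire functions of several variables *)

(** Polar form: the argument of w = x + iy is acos(x / |w|), with the sign of y. *)
Lemma cexp_surj (R : realType) (w : Cplx R) : w != 0 -> exists a : Cplx R, cexp a = w.
Proof.
move=> w0; pose r := cn w; have r0 : 0 < r by rewrite cn_gt0.
case wE : (w : R[i]) => [x y].
have rE : r ^+ 2 = x ^+ 2 + y ^+ 2.
  by rewrite /r /cn wE /= sqr_sqrtr // addr_ge0 ?sqr_ge0.
have xr : x / r \in `[-1, 1].
  have h : `|x| <= r by have := re_le w; rewrite /re {1}wE.
  by rewrite in_itv /= -ler_norml normrM normfV (gtr0_norm r0) ler_pdivrMr // mul1r.
have sq : Num.sqrt (1 - (x / r) ^+ 2) = `|y| / r.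
  have -> : 1 - (x / r) ^+ 2 = (y / r) ^+ 2.
    rewrite !expr_div_n -[1](divff (_ : r ^+ 2 != 0)) ?expf_neq0 ?gt_eqF //.
    by rewrite -mulrBl rE addrC addKr.
  by rewrite sqrtr_sqr normrM normfV (gtr0_norm r0).
pose s : R := if 0 <= y then 1 else -1.
exists ((ln r +i* (s * acos (x / r)))%C : R[i]).
rewrite /cexp lnK ?posrE //= /s; case: ifP => [y0|/negbT]; rewrite -?ltNge => *.
  by rewrite mul1r acosK // sin_acos ?(itvP xr) // sq ger0_norm // !mulrA ![r * _]mulrC !mulfK ?gt_eqF.
rewrite mulN1r cosN sinN acosK // sin_acos ?(itvP xr) // sq ltr0_norm //.
by rewrite mulrN mulNr mulrN opprK !mulrA ![r * _]mulrC !mulfK ?gt_eqF.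
Qed.

Section SeveralVariables.
Variables (R : realType) (n : nat).
Local Notation C := (Cplx R).
Local Notation Cn := 'rV[C]_n.
Implicit Types (f g : Cn -> C) (z w b : Cn) (r M : R).

(* Gateaux holomorphic and locally bounded. *)
Definition hol f := (forall z b, entire1 (fun x : C => f (z + x *: b))) /\
  (forall r, exists M, forall z, pdisc r z -> cn (f z) <= M).

Definition dd b f : Cn -> C := fun z => der (fun x : C => f (z + x *: b)) 0.

Lemma pdiscD r s z w : pdisc r z -> pdisc s w -> pdisc (r + s) (z + w).
Proof. by move=> h k j; rewrite mxE; apply: le_trans (cnD _ _) _; apply: lerD. Qed.
Lemma pdiscZ r s z (x : C) : pdisc r z -> cn x <= s -> pdisc (s * r) (x *: z).
Proof. by move=> h k j; rewrite mxE cnM ler_pM ?cn_ge0. Qed.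
Lemma pdisc_le r s z : r <= s -> pdisc r z -> pdisc s z.
Proof. by move=> h k j; apply: le_trans (k j) h. Qed.
Lemma pdisc_ex z : exists2 r, 0 < r & pdisc r z.
Proof.
exists (1 + \sum_j cn (z ord0 j)); first by rewrite ltr_wpDr // sumr_ge0 // => j _; apply: cn_ge0.
move=> j; rewrite (bigD1 j) //= addrCA lerDl addr_ge0 // sumr_ge0 // => i _; exact: cn_ge0.
Qed.
Lemma pdisc0 r : 0 <= r -> pdisc r (0 : Cn).
Proof. by move=> h j; rewrite mxE cn0. Qed.

Lemma line_shift f z b (x : C) : (fun y : C => f (z + x *: b + y *: b)) =
  (fun y : C => (fun y => f (z + y *: b)) (x + y)).
Proof. by apply/funext => y /=; rewrite -addrA -scalerDl. Qed.

Lemma ddE f z b l : cder (fun x : C => f (z + x *: b)) 0 l -> dd b f z = l.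
Proof. exact: derE. Qed.

Lemma cder_line f z b (x l : C) :
  cder (fun y : C => f (z + x *: b + y *: b)) 0 l <-> cder (fun y : C => f (z + y *: b)) x l.
Proof.
rewrite line_shift; split; apply: lilo_ext => h; by rewrite add0r addr0.
Qed.

Lemma ddP f z b (x : C) : hol f -> cder (fun y : C => f (z + y *: b)) x (dd b f (z + x *: b)).
Proof. by move=> [df _]; apply/cder_line; exact: derP. Qed.

Lemma ddP0 f z b : hol f -> cder (fun y : C => f (z + y *: b)) 0 (dd b f z).
Proof. by move=> /(@ddP f z b 0); rewrite scale0r addr0. Qed.

Lemma hol_ext f g : (forall z, f z = g z) -> hol f -> hol g.
Proof. by move=> /funext ->. Qed.

Lemma hol_cst (a : C) : hol (fun=> a).
Proof.
split=> [z b x|r]; first by exists 0; apply: cder_cst.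
by exists (cn a).
Qed.

Lemma holD f g : hol f -> hol g -> hol (fun z => f z + g z).
Proof.
move=> hf hg; split=> [z b x|r].
  by eexists; apply: cderD; apply: ddP.
have [M HM] := hf.2 r; have [M' HM'] := hg.2 r; exists (M + M') => z hz.
by apply: le_trans (cnD _ _) _; rewrite lerD ?HM ?HM'.
Qed.

Lemma holM f g : hol f -> hol g -> hol (fun z => f z * g z).
Proof.
move=> hf hg; split=> [z b x|r].
  by eexists; apply: cderM; apply: ddP.
have [M HM] := hf.2 r; have [M' HM'] := hg.2 r; exists (M * M') => z hz.
by rewrite cnM ler_pM ?cn_ge0 ?HM ?HM'.
Qed.

Lemma holZ a f : hol f -> hol (fun z => a * f z).
Proof. by apply: holM; apply: hol_cst. Qed.

Lemma holN f : hol f -> hol (fun z => - f z).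
Proof. by move=> /(holZ (-1)); apply: hol_ext => z; rewrite mulN1r. Qed.

Lemma holB f g : hol f -> hol g -> hol (fun z => f z - g z).
Proof. by move=> hf /holN; apply: holD. Qed.

Lemma holX f k : hol f -> hol (fun z => f z ^+ k).
Proof.
move=> hf; elim: k => [|k IH]; first exact: (hol_cst 1).
by apply: hol_ext (holM hf IH) => z; rewrite exprS.
Qed.

Lemma hol_sum (I : Type) (s : seq I) (P : pred I) (F : I -> Cn -> C) :
  (forall i, P i -> hol (F i)) -> hol (fun z => \sum_(i <- s | P i) F i z).
Proof.
move=> hF; elim: s => [|i s IH]; first by apply: hol_ext (hol_cst 0) => z; rewrite big_nil.
case Pi : (P i); last by apply: hol_ext IH => z; rewrite big_cons Pi.
by apply: hol_ext (holD (hF i Pi) IH) => z; rewrite big_cons Pi.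
Qed.

Lemma hol_prod (I : Type) (s : seq I) (P : pred I) (F : I -> Cn -> C) :
  (forall i, P i -> hol (F i)) -> hol (fun z => \prod_(i <- s | P i) F i z).
Proof.
move=> hF; elim: s => [|i s IH]; first by apply: hol_ext (hol_cst 1) => z; rewrite big_nil.
case Pi : (P i); last by apply: hol_ext IH => z; rewrite big_cons Pi.
by apply: hol_ext (holM (hF i Pi) IH) => z; rewrite big_cons Pi.
Qed.

Lemma hol_coord j : hol (fun z => z ord0 j).
Proof.
split=> [z b x|r]; last by exists r => z; apply.
exists (b ord0 j); apply: cder_ext (cder_aff (b ord0 j) (z ord0 j) x) => w.
by rewrite !mxE addrC mulrC.
Qed.

Lemma hol_shift c f : hol f -> hol (fun z => f (z + c)).
Proof.
move=> hf; split=> [z b x|r].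
  by exists (dd b f (z + c + x *: b)); apply: cder_ext (ddP (z + c) b x hf) => w; rewrite addrAC.
have [s s0 hs] := pdisc_ex c; have [M HM] := hf.2 (r + s); exists M => z hz.
by apply: HM; apply: pdiscD.
Qed.

Lemma hol_cexp f : hol f -> hol (fun z => cexp (f z)).
Proof.
move=> hf; split=> [z b x|r].
  by eexists; apply: (@cder_comp _ _ (fun x => f (z + x *: b))); [exact: ddP|exact: cder_cexp].
have [M HM] := hf.2 r; exists (expR M) => z hz; rewrite cn_cexp ler_expR.
by apply: le_trans (HM z hz); apply: le_trans (re_le _); exact: ler_norm.
Qed.

Lemma line_bound f r M z b : (forall w, pdisc r w -> cn (f w) <= M) ->
  forall s t, 0 <= t -> pdisc s z -> pdisc t b ->
  forall x : C, s + cn x * t <= r -> cn (f (z + x *: b)) <= M.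
Proof.
move=> H s t t0 hz hb x hx; apply: H; apply: pdisc_le hx _.
by apply: pdiscD => //; apply: pdiscZ hb _.
Qed.

Lemma dd_bound f r s M z b : 0 < s -> hol f -> (forall w, pdisc (r + s) w -> cn (f w) <= M) ->
  pdisc r z -> pdisc 1 b -> cn (dd b f z) <= 2 * M / s.
Proof.
move=> s0 hf H hz hb; apply: (cauchy_estimate s0 (hf.1 z b) (ddP0 z b hf)) => x; rewrite subr0 => xs.
by apply: (line_bound H ler01 hz hb); rewrite mulr1 lerD2l.
Qed.

Lemma hol_second_order f r M : hol f -> (forall w, pdisc (r + 4) w -> cn (f w) <= M) ->
  forall z b (x : C), pdisc r z -> pdisc 1 b -> cn x <= 1 ->
  cn (f (z + x *: b) - f z - dd b f z * x) <= 2 * M * cn x ^+ 2.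
Proof.
move=> hf H z b x hz hb hx.
have := @second_order _ (fun x : C => f (z + x *: b)) 0 4 M (ltr0n _ 4) (hf.1 z b) _ x.
rewrite add0r scale0r addr0 divff ?gt_eqF // (derE (ddP0 z b hf)).
have -> : 32 * M / 4 ^+ 2 = 2 * M by field.
apply => // y; rewrite subr0 => hy; apply: (line_bound H ler01 hz hb).
by rewrite mulr1 lerD2l.
Qed.

Lemma hol_lip f r M : hol f -> (forall w, pdisc (r + 4) w -> cn (f w) <= M) ->
  forall z b (x : C), pdisc r z -> pdisc 1 b -> cn x <= 2 ->
  cn (f (z + x *: b) - f z) <= M * cn x.
Proof.
move=> hf H z b x hz hb hx.
have := @lip_bound _ (fun x : C => f (z + x *: b)) 0 4 M (ltr0n _ 4) (hf.1 z b) _ 0 x.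
rewrite subrr cn0 !add0r scale0r addr0 (_ : 4 * M / 4 = M); last by field.
apply; last lra.
move=> y; rewrite subr0 => hy; apply: (line_bound H ler01 hz hb).
by rewrite mulr1 lerD2l.
Qed.

Lemma hol_limit (fs : nat -> Cn -> C) f : (forall k, hol (fs k)) ->
  (forall r, exists M, forall k z, pdisc r z -> cn (fs k z) <= M) ->
  (forall z, climit (fun k => fs k z) (f z)) -> hol f.
Proof.
move=> hfs bfs lim; split=> [z b x|r]; last first.
  have [M HM] := bfs r; exists M => z hz; apply: climit_le (lim z) _.
  by exists 0%N => k _; apply: HM.
have [] := @entire1_limit _ (fun k y => fs k (z + y *: b)) (fun y => f (z + y *: b)) _ _ _ x.
- by move=> k; exact: (hfs k).1.
- move=> r; have [s s0 hs] := pdisc_ex z; have [t t0 ht] := pdisc_ex b.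
  have [M HM] := bfs (s + r * t); exists M => k y hy.
  by apply: HM; apply: pdiscD => //; apply: pdiscZ ht hy.
- by move=> y; apply: lim.
by move=> l dl _; exists l.
Qed.

Lemma pdisc_scale b : exists2 t : R, 0 < t & exists2 b', pdisc 1 b' & b = rc t *: b'.
Proof.
have [t t0 ht] := pdisc_ex b; exists t => //; have tn0 : rc t != 0 by rewrite -cn_eq0 cn_rc normr_eq0 gt_eqF.
exists ((rc t)^-1 *: b); last by rewrite scalerA divff // scale1r.
rewrite -(mulVf (lt0r_neq0 t0)); apply: pdiscZ ht _.
by rewrite cnV cn_rc gtr0_norm.
Qed.

Lemma ddZ a b f z : hol f -> dd (a *: b) f z = a * dd b f z.
Proof.
move=> hf; rewrite mulrC; apply: ddE.
have := @cder_comp _ (fun y : C => f (z + y *: b)) (fun x => a * x + 0) 0 (dd b f z) a (cder_aff _ _ _).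
rewrite mulr0 addr0 => /(_ (ddP0 _ _ hf)); apply: cder_ext => x.
by rewrite addr0 scalerA mulrC.
Qed.

Lemma hol_dd b f : hol f -> hol (dd b f).
Proof.
move=> hf; have [t t0 [b' hb' ->]] := pdisc_scale b.
suff h : hol (dd b' f) by apply: hol_ext (holZ (rc t) h) => z; rewrite ddZ.
have p2 k : (2 ^+ k : C) != 0 by rewrite expf_neq0 // pnatr_eq0.
pose x k : C := (2 ^+ k)^-1.
have cx k : cn (x k) = 1 / 2 ^+ k by rewrite /x cnV cnX cn_nat mul1r.
have x0 k : 0 < cn (x k) by rewrite cx divr_gt0 ?exp2_gt0.
have x1 k : cn (x k) <= 1.
  by rewrite cx ler_pdivrMr ?exp2_gt0 // mul1r exprn_ege1 // ler1n.
pose fs k z := (x k)^-1 * (f (z + x k *: b') - f z).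
apply: (@hol_limit fs).
- by move=> k; apply: holZ; apply: holB => //; apply: hol_shift.
- move=> r; have [M HM] := hf.2 (r + 4); exists M => k z hz.
  rewrite /fs cnM cnV mulrC ler_pdivrMr //; apply: hol_lip HM _ _ _ hz hb' _ => //.
  by apply: le_trans (x1 k) _; rewrite ler1n.
move=> z; have [r r0 hr] := pdisc_ex z; have [M HM] := hf.2 (r + 4).
move=> e e0; have [N HN] := half_pow_small (2 * M) e0; exists N => k /HN hk.
apply: le_trans hk.
have -> : fs k z - dd b' f z = (f (z + x k *: b') - f z - dd b' f z * x k) / x k.
  by rewrite /fs; field; rewrite -cn_gt0.
rewrite cnM cnV ler_pdivrMr //; apply: le_trans (hol_second_order hf HM hr hb' (x1 k)) _.
by apply: le_of_eq; rewrite cx; field; rewrite gt_eqF ?exp2_gt0.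
Qed.

(** Holomorphy on lines alone says nothing about sums of directions; local boundedness does. The
    increment is split at the intermediate point z + u c: both parts have quadratic remainders, and
    [dd c' f] changes by O(u) between z and that point. *)
Lemma ddD b b' f z : hol f -> dd (b + b') f z = dd b f z + dd b' f z.
Proof.
move=> hf; apply: ddE.
have [t t0 ht] := pdisc_ex b; have [t' t'0 ht'] := pdisc_ex b'.
pose s := t + t'; have s0 : 0 < s by rewrite addr_gt0.
have scl (v : Cn) : exists c, pdisc s v -> pdisc 1 c /\ v = rc s *: c.
  have sn0 : rc s != 0 by rewrite -cn_eq0 cn_rc normr_eq0 gt_eqF.
  exists ((rc s)^-1 *: v) => hv; split; last by rewrite scalerA divff // scale1r.
  rewrite -(mulVf (lt0r_neq0 s0)); apply: pdiscZ hv _.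
  by rewrite cnV cn_rc gtr0_norm.
have [c] := scl b; case=> [|hc bE]; first by apply: pdisc_le ht; rewrite /s lerDl ltW.
have [c'] := scl b'; case=> [|hc' b'E]; first by apply: pdisc_le ht'; rewrite /s lerDr ltW.
have [r r0 hr] := pdisc_ex z.
have [M HM] := hf.2 (r + 1 + 4).
have hf' := hol_dd c' hf; have [M' HM'] := hf'.2 (r + 4).
have M0 : 0 <= M by apply: le_trans (cn_ge0 _) (HM 0 _); apply: pdisc0; lra.
have sV : cn (rc s) = s by rewrite cn_rc gtr0_norm.
apply: (@lilo_quad _ _ ((2 * M + 2 * M + M') * s ^+ 2) s^-1); first by rewrite invr_gt0.
move=> h hh; have hs : cn (h * rc s) < 1 by rewrite cnM sV -ltr_pdivlMr // div1r.
have hs1 := ltW hs.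
have HM2 w : pdisc (r + 4) w -> cn (f w) <= M by move=> hw; apply: HM; apply: pdisc_le hw; lra.
have hz' : pdisc (r + 1) (z + (h * rc s) *: c).
  apply: pdiscD => //; rewrite -[X in pdisc X]mulr1; exact: pdiscZ.
have h1 := hol_second_order hf HM2 hr hc hs1.
have h2 := hol_second_order hf HM hz' hc' hs1.
have h3 := hol_lip hf' HM' hr hc (le_trans hs1 _); have {}h3 := h3 (ltac:(lra)).
rewrite add0r scale0r addr0 bE b'E !ddZ // scalerDr !scalerA addrA.
set u := h * rc s in h1 h2 h3 hs1 *.
have -> : f (z + u *: c + u *: c') - f z - (rc s * dd c f z + rc s * dd c' f z) * h =
  (f (z + u *: c + u *: c') - f (z + u *: c) - dd c' f (z + u *: c) * u) +
  (f (z + u *: c) - f z - dd c f z * u) + (dd c' f (z + u *: c) - dd c' f z) * u.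
  by rewrite /u; ring.
have uE : cn u ^+ 2 = s ^+ 2 * cn h ^+ 2 by rewrite /u cnM sV exprMn mulrC.
rewrite -mulrA -uE; apply: le_trans (cnD _ _) _.
have -> : (2 * M + 2 * M + M') * cn u ^+ 2 = 2 * M * cn u ^+ 2 + 2 * M * cn u ^+ 2 + M' * cn u ^+ 2 by ring.
apply: lerD; first by apply: le_trans (cnD _ _) _; apply: lerD.
by rewrite cnM expr2 mulrA ler_wpM2r ?cn_ge0.
Qed.

Lemma dd_sum_dir (I : Type) (s : seq I) (F : I -> Cn) f z : hol f ->
  dd (\sum_(i <- s) F i) f z = \sum_(i <- s) dd (F i) f z.
Proof.
move=> hf; elim: s => [|i s IH].
  by have := ddZ 0 0 z hf; rewrite !big_nil scale0r mul0r.
by rewrite !big_cons ddD // IH.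
Qed.

Definition ej (j : 'I_n) : Cn := delta_mx ord0 j.

Lemma dd_coord b f z : hol f -> dd b f z = \sum_j b ord0 j * dd (ej j) f z.
Proof.
move=> hf; rewrite [b in LHS]row_sum_delta dd_sum_dir //.
by apply: eq_bigr => j _; rewrite ddZ.
Qed.

Lemma ddDf b f g z : hol f -> hol g -> dd b (fun z => f z + g z) z = dd b f z + dd b g z.
Proof. by move=> hf hg; apply: ddE; apply: cderD; apply: ddP0. Qed.
Lemma ddMf b f g z : hol f -> hol g ->
  dd b (fun z => f z * g z) z = dd b f z * g z + f z * dd b g z.
Proof.
move=> hf hg; apply: ddE; have := cderM (ddP0 z b hf) (ddP0 z b hg).
by rewrite scale0r addr0.
Qed.
Lemma dd_cst b (a : C) z : dd b (fun=> a) z = 0.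
Proof. by apply: ddE; apply: cder_cst. Qed.
Lemma ddZf b (a : C) f z : hol f -> dd b (fun z => a * f z) z = a * dd b f z.
Proof. by move=> hf; apply: ddE; apply: cderZ; apply: ddP0. Qed.
Lemma ddBf b f g z : hol f -> hol g -> dd b (fun z => f z - g z) z = dd b f z - dd b g z.
Proof. by move=> hf hg; apply: ddE; apply: cderB; apply: ddP0. Qed.
Lemma dd_cexp b f z : hol f -> dd b (fun z => cexp (f z)) z = cexp (f z) * dd b f z.
Proof.
move=> hf; apply: ddE; have := @cder_comp _ (@cexp R) (fun x : C => f (z + x *: b)) 0 (cexp (f z)).
rewrite scale0r addr0 => h; apply: (h _ (ddP0 z b hf)); exact: cder_cexp.
Qed.
Lemma dd_shift b c f z : dd b (fun z => f (z + c)) z = dd b f (z + c).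
Proof. by rewrite /dd; congr der; apply/funext => x; exact: congr1 (addrAC _ _ _). Qed.
Lemma dd_ext b f g z : (forall z, f z = g z) -> dd b f z = dd b g z.
Proof. by move=> /funext ->. Qed.

Lemma dd0_cst f : hol f -> (forall j z, dd (ej j) f z = 0) -> forall z, f z = f 0.
Proof.
move=> hf H z.
have := @der0_cst _ (fun x : C => f (0 + x *: z)) _ 1; rewrite scale1r scale0r addr0 add0r; apply => x.
have -> : 0 = dd z f (0 + x *: z) by rewrite dd_coord // big1 // => j _; rewrite H mulr0.
exact: ddP.
Qed.

Lemma hol_cont f z : hol f -> forall e, 0 < e -> exists2 d, 0 < d &
  forall w, pdisc d (w - z) -> cn (f w - f z) <= e.
Proof.
move=> hf e e0; have [r r0 hr] := pdisc_ex z; have [M HM] := hf.2 (r + 4).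
have M0 : 0 <= M by apply: le_trans (cn_ge0 _) (HM 0 _); apply: pdisc0; lra.
have M1 : 0 < M + 1 by lra.
pose d := Num.min 1 (e / (M + 1)); have d0 : 0 < d by rewrite lt_min ltr01 divr_gt0.
exists d => // w hw.
have dn0 : rc d != 0 by rewrite -cn_eq0 cn_rc normr_eq0 gt_eqF.
pose b := (rc d)^-1 *: (w - z).
have hb : pdisc 1 b.
  rewrite -(mulVf (lt0r_neq0 d0)); apply: pdiscZ hw _.
  by rewrite cnV cn_rc gtr0_norm.
have -> : w = z + rc d *: b by rewrite scalerA divff // scale1r addrC subrK.
have cd : cn (rc d) = d by rewrite cn_rc gtr0_norm.
have d1 : d <= 1 by rewrite ge_min lexx.
have de : d <= e / (M + 1) by rewrite ge_min lexx orbT.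
apply: le_trans (hol_lip hf HM hr hb _) _; rewrite cd; first lra.
by move: de; rewrite ler_pdivlMr // => de; nra.
Qed.

Lemma hol_identity f a d : hol f -> 0 < d -> (forall z, pdisc d (z - a) -> f z = 0) ->
  forall z, f z = 0.
Proof.
move=> hf d0 H z.
have [t t0 ht] := pdisc_ex (z - a).
have := @entire1_identity _ (fun x : C => f (a + x *: (z - a))) 0 (d / t) (hf.1 _ _) _ _ 1.
rewrite scale1r [a + _]addrC subrK; apply; first exact: divr_gt0.
move=> x; rewrite subr0 => hx; apply: H; rewrite addrAC subrr add0r.
by rewrite -(divfK (lt0r_neq0 t0) d); apply: pdiscZ => //; apply: ltW.
Qed.

Lemma hol_domain f g : hol f -> hol g -> (forall z, f z * g z = 0) ->
  (forall z, f z = 0) \/ (forall z, g z = 0).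
Proof.
move=> hf hg H; case: (pselect (forall z, f z = 0)) => [|/existsNP[a fa]]; first by left.
right; have c0 : 0 < cn (f a) by rewrite cn_gt0; apply/eqP.
have [d d0 Hd] := hol_cont a hf (divr_gt0 c0 (ltr0n _ 2)).
apply: (hol_identity hg d0) => z /Hd hz; have := H z; move/eqP; rewrite mulf_eq0 => /orP[/eqP fz|/eqP//].
by exfalso; move: hz; rewrite fz sub0r cnN; lra.
Qed.

Lemma hol_inv f : hol f -> (forall z, f z != 0) -> hol (fun z => (f z)^-1).
Proof.
move=> hf f0; split=> [z b x|r].
  by eexists; apply: (@cderV _ (fun x : C => f (z + x *: b))) => //; apply: ddP.
apply: pdisc_bound => z; have c0 : 0 < cn (f z) by rewrite cn_gt0.
have [d d0 Hd] := hol_cont z hf (divr_gt0 c0 (ltr0n _ 2)).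
exists d => //; exists (cn (f z) / 2)^-1 => w /Hd hw; rewrite cnV lef_pV2 ?posrE ?cn_gt0 ?divr_gt0 //.
by have := cn_dist (f z) (f w); rewrite cnBC; lra.
Qed.

(** The induction replaces F by its difference quotient in the first variable, which satisfies the
    same hypotheses; its value at x = 0 is a bounded pointwise limit of functions holomorphic in
    z. *)
Lemma hol_tcoef (F : C -> Cn -> C) i : (forall x, hol (F x)) -> (forall z, entire1 (F ^~ z)) ->
  (forall r s, exists M, forall x z, cn x <= s -> pdisc r z -> cn (F x z) <= M) ->
  hol (fun z => tcoef (F ^~ z) i).
Proof.
elim: i F => [|i IH] F hF eF bF; first exact: (hF 0).
have tS z : tcoef (F ^~ z) i.+1 = tcoef ((fun x w => dquot (F ^~ w) x) ^~ z) i.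
  by rewrite /tcoef iterSr.
apply: hol_ext (IH _ _ _ _) => [z|x|z|r s].
- by rewrite tS.
- rewrite /dquot; case: eqP => [_|/eqP x0]; last first.
    by apply: hol_ext (holZ x^-1 (holB (hF x) (hF 0))) => z; rewrite mulrC.
  have p2 k : (2 ^+ k : C) != 0 by rewrite expf_neq0 // pnatr_eq0.
  pose y k : C := (2 ^+ k)^-1.
  have y1 k : cn (y k) <= 1.
    by rewrite /y cnV cnX cn_nat invf_le1 ?exp2_gt0 // exprn_ege1 // ler1n.
  apply: (@hol_limit (fun k z => (y k)^-1 * (F (y k) z - F 0 z))).
  + by move=> k; apply: holZ; apply: holB.
  + move=> r; have [M HM] := bF r 4; exists M => k z hz.
    have y0 : 0 < cn (y k) by rewrite cn_gt0 invr_eq0.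
    have := @lip_bound _ (F ^~ z) 0 4 M (ltr0n _ 4) (eF z) _ 0 (y k).
    rewrite subrr cn0 !add0r (_ : 4 * M / 4 = M) => [h|]; last by field.
    rewrite cnM cnV mulrC ler_pdivrMr //; apply: h; last by have := y1 k; lra.
    by move=> x'; rewrite subr0 => hx; apply: HM.
  move=> z e e0; have [d d0 Hd] := derP 0 (eF z) e0.
  have [N HN] := half_pow_small 1 (divr_gt0 d0 (ltr0n _ 2)).
  exists N => k /HN; rewrite div1r => hk.
  have cy : cn (y k) = (2 ^+ k)^-1 by rewrite /y cnV cnX cn_nat.
  have y0 : 0 < cn (y k) by rewrite cn_gt0 invr_eq0.
  have hk' : cn (y k) < d by rewrite cy; lra.
  have := Hd _ hk'; rewrite add0r -ler_pdivrMr // -cnV -cnM.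
  rewrite (_ : _ / _ = (y k)^-1 * (F (y k) z - F 0 z) - der (F ^~ z) 0) //.
  by rewrite /y; field.
- exact: dquot_entire1.
pose s' := `|s| + 1; have s'0 : 0 < s' by rewrite /s'; have := normr_ge0 s; lra.
have [M HM] := bF r s'; exists (4 * M / s') => x z hx hz.
apply: dquot_bound => //; last by have := ler_norm s; rewrite /s'; lra.
by move=> w hw; apply: HM.
Qed.

(** The logarithmic derivative of u is integrated along the segment from 0 to z: with P z the
    primitive of x -> F x z, the logarithm is a + P z 1. It is holomorphic in z as a limit of
    partial sums, whose coefficients are holomorphic by [hol_tcoef]. *)
Lemma hol_log u : hol u -> (forall z, u z != 0) ->
  exists2 phi, hol phi & forall z, u z = cexp (phi z).
Proof.
move=> hu u0.
pose F (x : C) z := dd z u (x *: z) / u (x *: z).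
have hscal (x : C) f : hol f -> hol (fun z => f (x *: z)).
  move=> hf; split=> [z b y|r].
    exists (dd (x *: b) f (x *: z + y *: (x *: b))).
    apply: cder_ext (ddP (x *: z) (x *: b) y hf) => w.
    by rewrite scalerDr !scalerA mulrC.
  have [M HM] := hf.2 (cn x * r); exists M => z hz; apply: HM; exact: pdiscZ.
have hF x : hol (F x).
  apply: holM; last by apply: (hscal x (fun z => (u z)^-1)); apply: hol_inv.
  apply: (@hol_ext (fun z => \sum_j z ord0 j * dd (ej j) u (x *: z))) => [z|].
    by rewrite -dd_coord.
  apply: hol_sum => j _; apply: holM; first exact: hol_coord.
  by apply: (hscal x); apply: hol_dd.
have eF z : entire1 (F ^~ z).
  move=> x; have h := (holM (hol_dd z hu) (hol_inv hu u0)).1 0 z x.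
  by have [l dl] := h; exists l; apply: cder_ext dl => y; rewrite add0r.
have bF r s : exists M, forall x z, cn x <= s -> pdisc r z -> cn (F x z) <= M.
  pose G z := \sum_j cn (dd (ej j) u z).
  have [K HK] : exists K, forall j z, pdisc (s * r) z -> cn (dd (ej j) u z) <= K.
    have /choice[K HK] : forall j, exists K, forall z, pdisc (s * r) z -> cn (dd (ej j) u z) <= K.
      by move=> j; exact: (hol_dd (ej j) hu).2.
    exists (\sum_j `|K j|) => j z hz; apply: le_trans (HK j z hz) _.
    by apply: le_trans (ler_norm _) _; rewrite (bigD1 j) //= lerDl sumr_ge0.
  have [K' HK'] := (hol_inv hu u0).2 (s * r).
  exists ((\sum_(j < n) r * K) * K') => x z hx hz.
  have hxz : pdisc (s * r) (x *: z) by apply: pdiscZ.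
  rewrite /F cnM ler_pM ?cn_ge0 ?HK' // dd_coord //.
  apply: le_trans (cn_sum _ _ _) _; apply: ler_sum => j _.
  by rewrite cnM ler_pM ?cn_ge0 ?HK.
have hc i : hol (fun z => tcoef (F ^~ z) i) := hol_tcoef i hF eF bF.
have /choice[P HP] : forall z, exists P, [/\ forall x, climit (fun K => primitive (F ^~ z) K x) (P x),
     P 0 = 0 & forall x, cder P x (F x z)].
  by move=> z; have [P H1 [H2 H3]] := primitive_exists (eF z); exists P.
have hP : hol (fun z => P z 1).
  apply: (@hol_limit (fun K z => primitive (F ^~ z) K 1)) => [K|r|z].
  - apply: hol_sum => i _; apply: holM; last exact: hol_cst.
    by apply: holM; [exact: hc|exact: hol_cst].
  - have [M HM] := bF r 8; exists (2 * M * 1) => K z hz.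
    apply: primitive_bound => // [x|]; last by rewrite cn1.
    by rewrite mulr1 => hx; apply: HM.
  by have [H _ _] := HP z; exact: H.
have [a ha] : exists a : C, cexp a = u 0.
  exact: cexp_surj (u0 0).
exists (fun z => a + P z 1); first exact: holD (hol_cst a) hP.
move=> z; have [_ P0 dP] := HP z.
(* u e^(-P) has derivative 0 along the line through 0 and z, so its values at x = 0 and x = 1
   agree. *)
have := @der0_cst _ (fun x : C => u (0 + x *: z) * cexp (- P z x)) _ 1.
rewrite scale1r scale0r !add0r P0 oppr0 cexp0 mulr1 cexpNV cexpD ha => <-.
  by rewrite divfK ?cexp_neq0.
move=> x; have H := cderM (ddP 0 z x hu) (@cder_comp _ (@cexp R) (fun x => - P z x) _ _ _ (cderN (dP x)) (cder_cexp _)).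
have -> // : 0 = dd z u (0 + x *: z) * cexp (- P z x) + u (0 + x *: z) * (cexp (- P z x) * - F x z).
by rewrite /F add0r; field; exact: u0.
Qed.

End SeveralVariables.

(** * Comparison with Fréchet differentiability over C *)

Lemma differentiable_intro (K : numFieldType) (V W : normedModType K) (f : V -> W)
    (df : {linear V -> W}) (x : V) : continuous df ->
  (forall e : K, 0 < e -> exists2 d : K, 0 < d & forall h : V, `|h| < d ->
     `|f (h + x) - f x - df h| <= e * `|h|) ->
  differentiable f x.
Proof.
move=> dfc H.
have E : f \o shift x = cst (f x) + df +o_ 0 id.
  apply/eqaddoP => _/posnumP[e]; have [d d0 Hd] := H e%:num [gt0 of e%:num].
  apply/nbhs_normP; exists d => // h /=; rewrite sub0r normrN => /Hd.
  by rewrite -![(_ + _ : _ -> _) _]/(_ + _) -![(- _ : _ -> _) _]/(- _) /cst /= opprD addrA.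
have dE := diff_unique dfc E.
by apply/diff_locallyP; rewrite dE; split.
Qed.

Section Bridge.
Variables (R : realType) (n : nat).
Local Notation C := (Cplx R).
Local Notation Cn := 'rV[C]_n.
Implicit Types (f g : Cn -> C) (z w b : Cn) (r M : R).

Lemma rc_gt0 (d : C) : 0 < d -> exists2 d' : R, 0 < d' & d = rc d'.
Proof.
move=> d0; exists (cn d); first by rewrite cn_gt0 gt_eqF.
by rewrite -normE gtr0_norm.
Qed.

Lemma derivable_cder f z b : derivable f z b -> cder (fun x : C => f (z + x *: b)) 0 ('D_b f z).
Proof.
move=> dv e e0; have := dv; rewrite /derivable => /cvg_ex[l Hl].
have lE : l = 'D_b f z by rewrite /derive; apply/esym/cvg_lim.
have e0' : 0 < rc e by rewrite -rc0 lt_rc.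
move: Hl; rewrite lE => /cvgrPdist_le/(_ _ e0').
rewrite near_withinE => /nbhs_ballP[d' /= /rc_gt0[d d0 ->] Hd].
exists d => // h hd; have [->|h0] := eqVneq h 0.
  by rewrite addr0 subrr mulr0 subr0 cn0 mulr0.
have := Hd h; rewrite /ball /= sub0r normrN normE lt_rc => /(_ hd h0).
rewrite normE le_rc add0r scale0r addr0.
rewrite [X in cn X <= _ -> _](_ : _ = - (f (z + h *: b) - f z - 'D_b f z * h) * h^-1).
  by rewrite cnM cnV cnN ler_pdivrMr ?cn_gt0.
by rewrite /GRing.scale /= [h *: b + z]addrC; field.
Qed.

Lemma entire_hol f : entire f -> hol f.
Proof.
move=> ef.
have df z b : cder (fun x : C => f (z + x *: b)) 0 ('D_b f z).
  by apply: derivable_cder; apply: diff_derivable; exact: ef.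
split=> [z b x|r].
  by exists ('D_b f (z + x *: b)); apply/cder_line; exact: df.
apply: pdisc_bound => z.
have /differentiable_continuous := ef z.
move=> /cvgrPdist_le/(_ _ (@ltr01 C)) /nbhs_ballP[d' /= /rc_gt0[d d0 ->] Hd].
exists (d / 2); first by rewrite divr_gt0.
exists (cn (f z) + 1) => w hw.
have := Hd w; rewrite -rc1 normE le_rc => /(_ _).
have : ball z (rc d) w.
  split; first by rewrite -rc0 lt_rc.
  move=> i j; rewrite ord1 /ball /= normE lt_rc; apply: le_lt_trans (_ : d / 2 < d); last lra.
  by have := hw j; rewrite !mxE cnBC.
move=> hb /(_ hb); have := cn_dist (f w) (f z); rewrite (cnBC (f w)); lra.
Qed.

Lemma partialE f j z : entire f -> partial j f z = dd (ej R j) f z.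
Proof.
move=> ef; rewrite /partial; apply/esym/ddE/derivable_cder/diff_derivable; exact: ef.
Qed.

End Bridge.

Section LinearForm.
Variables (R : realType) (n : nat).
Local Notation C := (Cplx R).
Local Notation Cn := 'rV[C]_n.

(** The candidate for the differential, written in coordinates so that it can be declared linear and
    shown to be continuous. *)
Definition lform (c : 'I_n -> C) (h : Cn) : C := \sum_j h ord0 j * c j.

Lemma lform_is_linear (c : 'I_n -> C) : linear (lform c : Cn -> C^o).
Proof.
move=> a u v; rewrite /lform scaler_sumr -big_split; apply: eq_bigr => j _.
by rewrite !mxE mulrDl -[_ *: _]/(_ * _) mulrA.
Qed.
HB.instance Definition _ c := GRing.isLinear.Build C Cn C^o *:%R (lform c) (lform_is_linear c).
End LinearForm.

Section Bridge2.
Variables (R : realType) (n : nat).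
Local Notation C := (Cplx R).
Local Notation Cn := 'rV[C]_n.
Implicit Types (f g : Cn -> C) (z w b : Cn) (r M : R).

Lemma mx_norm_pdisc (z : Cn) : exists2 s : R, `|z| = rc s & pdisc s z.
Proof.
have z0 := normr_ge0 z; exists (re `|z|).
  by move: z0; case: `|z| => x y; rewrite lecE /= => /andP[/eqP -> _].
move=> j; rewrite -le_rc -normE.
have -> : rc (re `|z|) = `|z|.
  by move: z0; case: `|z| => x y; rewrite lecE /= => /andP[/eqP -> _].
by rewrite [leRHS]/Num.norm /= mx_normE -[leLHS]nngE num_le; exact: (le_bigmax _ _ (ord0, j)).
Qed.

Lemma lform_continuous (c : 'I_n -> C) : continuous (lform c : Cn -> C).
Proof.
move=> h.
apply/(@cvgrPdist_le _ _ _ (nbhs h) (nbhs_filter h) (lform c) (lform c h)) => e' /rc_gt0[e e0 ->].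
pose K := \sum_j cn (c j) + 1.
have K0 : 0 < K by rewrite ltr_wpDl // sumr_ge0 // => j _; apply: cn_ge0.
apply/nbhs_ballP; exists (rc (e / K)) => /=; first by rewrite -rc0 lt_rc divr_gt0.
move=> w [_ /(_ ord0)] hw; rewrite normE le_rc /lform -sumrB.
apply: le_trans (cn_sum _ _ _) _; apply: (@le_trans _ _ (\sum_j e / K * cn (c j))).
  apply: ler_sum => j _; rewrite -mulrBl cnM ler_wpM2r ?cn_ge0 //.
  by have := hw j; rewrite /ball /= normE lt_rc => /ltW.
by rewrite -mulr_sumr mulrAC ler_pdivrMr // ler_wpM2l ?(ltW e0) // /K lerDl.
Qed.

Lemma hol_entire f : hol f -> entire f.
Proof.
move=> hf z; pose c j := dd (ej R j) f z.
have dfE h : lform c h = dd h f z by rewrite dd_coord.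
apply: (@differentiable_intro _ _ _ f (lform c)); first exact: lform_continuous.
move=> e' /rc_gt0[e e0 ->].
have [r r0 hr] := pdisc_ex z; have [M HM] := hf.2 (r + 4).
have M0 : 0 <= M by apply: le_trans (cn_ge0 _) (HM 0 _); apply: pdisc0; lra.
have M1 : 0 < 2 * M + 1 by lra.
pose d := Num.min 1 (e / (2 * M + 1)); have d0 : 0 < d by rewrite lt_min ltr01 divr_gt0.
exists (rc d) => [|h /=]; first by rewrite -rc0 lt_rc.
have [s sE hs] := mx_norm_pdisc h; rewrite sE lt_rc => sd.
rewrite normE -rcM le_rc dfE.
have [h0|h0] := eqVneq h 0.
  have s0 : s = 0 by apply: complexI; rewrite -[LHS]/(rc s) -sE h0 normr0.
  by rewrite h0 add0r subrr -(scale0r (0 : Cn)) ddZ // mul0r subrr cn0 s0 mulr0.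
have s0 : 0 < s by rewrite -lt_rc rc0 -sE normr_gt0.
have sn0 : rc s != 0 by rewrite -cn_eq0 cn_rc normr_eq0 gt_eqF.
pose b := (rc s)^-1 *: h.
have hb : pdisc 1 b.
  rewrite -(mulVf (lt0r_neq0 s0)); apply: pdiscZ hs _.
  by rewrite cnV cn_rc gtr0_norm.
have -> : h = rc s *: b by rewrite scalerA divff // scale1r.
move: sd; rewrite /d lt_min => /andP[s1 s2].
have cs : cn (rc s) = s by rewrite cn_rc gtr0_norm.
rewrite ddZ // [rc s *: b + z]addrC [rc s * _]mulrC.
apply: le_trans (hol_second_order hf HM hr hb _) _; rewrite cs; first exact: ltW.
by move: s2; rewrite ltr_pdivlMr // => s2; nra.
Qed.

Lemma peval_hol (p : mpoly n C) : hol (peval p) /\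
  forall j z, dd (ej R j) (peval p) z = peval (mderiv j p) z.
Proof.
elim/mpolyind: p => [|c m p _ _ [hp dp]].
  split.
    apply: (@hol_ext _ _ (fun=> 0)); last exact: hol_cst.
    by move=> z; rewrite /peval meval0.
  move=> j z; rewrite mderiv0 /peval meval0 -[RHS](dd_cst (ej R j) 0 z); apply: dd_ext => w.
  by rewrite meval0.
have hX (m' : multinom n) : hol (fun z : Cn => meval (z ord0) (mpolyX C m')).
  apply: (@hol_ext _ _ (fun z => \prod_j z ord0 j ^+ m' j)) => [z|]; first by rewrite mevalX.
  by apply: hol_prod => j _; apply: holX; apply: hol_coord.
have hcX : hol (fun z : Cn => c * meval (z ord0) (mpolyX C m)) by apply: holZ.
have E z : peval (c *: (mpolyX C m) + p) z = c * meval (z ord0) (mpolyX C m) + peval p z.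
  by rewrite /peval mevalD mevalZ.
split; first by apply: hol_ext (holD hcX hp) => z; rewrite E.
move=> j z; rewrite (@dd_ext _ _ _ _ _ z E) ddDf // dp mderivD /peval mevalD; congr (_ + _).
rewrite mderivZ mevalZ ddZf //; congr (_ * _).
rewrite mderivX mevalZ; apply: ddE.
have := @cder_exp R (m j) (z ord0 j).
pose Q := \prod_(i | i != j) z ord0 i ^+ m i.
have ej0 i (x : C) : (z + x *: ej R j) ord0 i = if i == j then z ord0 j + x else z ord0 i.
  rewrite !mxE eqxx /=; case: (eqVneq i j) => [->|ij] /=; first by rewrite mulr1.
  by rewrite mulr0 addr0.
move=> dX; have dX' : cder (fun x : C => (z ord0 j + x) ^+ m j) 0 ((m j)%:R * z ord0 j ^+ (m j).-1).
  by apply: lilo_ext dX => h; rewrite add0r addr0.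
have := cderM dX' (cder_cst Q 0); rewrite mulr0 addr0.
have -> : (m j)%:R * z ord0 j ^+ (m j).-1 * Q = (m j)%:R * meval (z ord0) (mpolyX C (mnm_sub m (mnm1 j))).
  rewrite mevalX (bigD1 j) //= mulrA; congr (_ * _ * _).
    by rewrite mnmBE mnm1E eqxx subn1.
  by apply: eq_bigr => i ij; rewrite mnmBE mnm1E eq_sym (negPf ij) subn0.
apply: cder_ext => x; rewrite mevalX (bigD1 j) //= ej0 eqxx; congr (_ * _).
by apply: eq_bigr => i ij; rewrite ej0 (negPf ij).
Qed.

End Bridge2.

(** * Polynomials and polynomial growth *)

Section Polynomials.
Variables (R : realType) (n : nat).
Local Notation C := (Cplx R).
Local Notation Cn := 'rV[C]_n.
Local Notation mp := (mpoly n C).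
Implicit Types (f g : Cn -> C) (z w b : Cn) (r M : R).

Lemma peval_is_hol (p : mp) : hol (peval p). Proof. exact: (peval_hol p).1. Qed.
Lemma dd_peval j (p : mp) z : dd (ej R j) (peval p) z = peval (mderiv j p) z.
Proof. exact: (peval_hol p).2. Qed.
Lemma pevalD (p q : mp) z : peval (p + q) z = peval p z + peval q z. Proof. exact: mevalD. Qed.
Lemma pevalB (p q : mp) z : peval (p - q) z = peval p z - peval q z. Proof. exact: mevalB. Qed.
Lemma pevalN (p : mp) z : peval (- p) z = - peval p z. Proof. exact: mevalN. Qed.
Lemma pevalM (p q : mp) z : peval (p * q) z = peval p z * peval q z. Proof. exact: mevalM. Qed.
Lemma pevalZ c (p : mp) z : peval (c *: p) z = c * peval p z. Proof. exact: mevalZ. Qed.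
Lemma pevalC c z : peval (mpolyC n c : mp) z = c. Proof. exact: mevalC. Qed.
Lemma peval0 z : peval (0 : mp) z = 0. Proof. exact: meval0. Qed.
Lemma pevalX (j : 'I_n) z : peval (mpolyX C (mnm1 j)) z = z ord0 j. Proof. exact: mevalXU. Qed.
Lemma peval_sum (I : Type) (s : seq I) (P : pred I) (F : I -> mp) z :
  peval (\sum_(i <- s | P i) F i) z = \sum_(i <- s | P i) peval (F i) z.
Proof. by rewrite /peval raddf_sum. Qed.

(** Induction on the degree of the monomial: the constant coefficient is the value at 0, and any
    other one is, up to a nonzero integer, a coefficient of lower degree of a partial derivative,
    which vanishes everywhere as well. *)
Lemma peval_eq0 (p : mp) : (forall z, peval p z = 0) -> p = 0.
Proof.
move=> H; apply/mpolyP => m; rewrite mcoeff0.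
move: {2}(mdeg m) (erefl (mdeg m)) => k; elim: k p H m => [|k IH] p H m km.
  have m0 : m = @mnm0 n by apply/eqP; rewrite -mdeg_eq0 km.
  have := H 0; rewrite /peval mevalE.
  have E (m' : multinom n) : \prod_i (0 : Cn) ord0 i ^+ m' i = (m' == @mnm0 n)%:R :> C.
    case: (eqVneq m' (@mnm0 n)) => [->|mn0].
      by rewrite big1 // => i _; rewrite mnm0E expr0.
    have [i mi] : exists i, m' i != 0%N.
      apply/existsP; apply: contraNT mn0 => /existsPn h; apply/eqP/mnmP => i.
      by rewrite mnm0E; apply/eqP; have := h i; rewrite negbK.
    by rewrite (bigD1 i) //= mxE expr0n (negPf mi) mul0r.
  rewrite (eq_bigr (fun m' => mcoeff m' p * (m' == @mnm0 n)%:R)) => [|m' _]; last by rewrite E.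
  case: (boolP (@mnm0 n \in msupp p)) => [h|].
    rewrite (bigD1_seq (@mnm0 n)) ?msupp_uniq //= eqxx mulr1 big1 ?addr0 ?m0 // => m' /negPf ->.
    by rewrite mulr0.
  by rewrite mcoeff_msupp negbK m0 => /eqP.
have [i mi] : exists i, m i != 0%N.
  apply/existsP; apply: contraT => /existsPn h.
  have : mdeg m = 0%N by rewrite mdegE big1 // => i _; apply/eqP; have := h i; rewrite negbK.
  by rewrite km.
pose m' := mnm_sub m (mnm1 i).
have mE : m = mnm_add m' (mnm1 i).
  apply/mnmP => j; rewrite mnmDE mnmBE mnm1E; case: (eqVneq i j) => [<-|_] /=; last by rewrite subn0 addn0.
  by rewrite subnK // lt0n.
have km' : mdeg m' = k by move: km; rewrite mE mdegD mdeg1 addn1 => -[].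
have := IH (mderiv i p) _ m' km'; rewrite mcoeff_deriv -mE => h.
have {}h : mcoeff m p *+ (m' i).+1 = 0.
  apply: h => z; rewrite -dd_peval -[RHS](dd_cst (ej R i) 0 z); exact: dd_ext.
by move/eqP: h; rewrite mulrn_eq0 /= => /eqP.
Qed.

Lemma peval_inj (p q : mp) : (forall z, peval p z = peval q z) -> p = q.
Proof.
move=> H; apply/eqP; rewrite -subr_eq0; apply/eqP/peval_eq0 => z.
by rewrite pevalB H subrr.
Qed.

Lemma peval_neq0 (p : mp) : p != 0 -> exists z, peval p z != 0.
Proof.
move=> p0; apply: contrapT => h; move/eqP: p0; apply; apply: peval_eq0 => z.
by apply/eqP; apply: contrapT => hz; apply: h; exists z; apply/negP.
Qed.

(** p(z + x b) as a polynomial P in x over the polynomials in z. The degree k is formal and tau may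
    be 0, so that representations can be added; what matters is that the coefficient of x^k does not
    depend on z. *)
Definition line_rep b k (p : mp) (tau : C) (P : {poly mp}) :=
  [/\ (size P <= k.+1)%N, P`_k = mpolyC n tau &
   forall z (x : C), peval p (z + x *: b) = (map_poly (meval (z ord0)) P).[x]].

Lemma line_repM b k l p q tau sig P Q : line_rep b k p tau P -> line_rep b l q sig Q ->
  line_rep b (k + l) (p * q) (tau * sig) (P * Q).
Proof.
move=> [sP cP eP] [sQ cQ eQ]; split.
- apply: leq_trans (size_polyMleq _ _) _; lia.
- have kl : (k < (k + l).+1)%N by lia.
  rewrite coefM (bigD1 (Ordinal kl)) //= cP addKn cQ -mpolyCM big1 ?addr0 // => i.
  rewrite -val_eqE /= => ik; case: (ltngtP i k) ik => // [ik|ki] _.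
    by rewrite [Q`_ _]nth_default ?mulr0 //; apply: leq_trans sQ _; lia.
  by rewrite [P`_ _]nth_default ?mul0r //; apply: leq_trans sP _; lia.
by move=> z x; rewrite pevalM eP eQ rmorphM hornerM.
Qed.

Lemma line_repD b k p q tau sig P Q : line_rep b k p tau P -> line_rep b k q sig Q ->
  line_rep b k (p + q) (tau + sig) (P + Q).
Proof.
move=> [sP cP eP] [sQ cQ eQ]; split.
- by apply: leq_trans (size_polyD _ _) _; rewrite geq_max sP.
- by rewrite coefD cP cQ -mpolyCD.
by move=> z x; rewrite pevalD eP eQ rmorphD hornerD.
Qed.

Lemma line_rep_raise b k l p tau P : (l < k)%N -> line_rep b l p tau P -> line_rep b k p 0 P.
Proof.
move=> lk [sP cP eP]; split=> //; first by apply: leq_trans sP _; lia.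
by rewrite nth_default ?mpolyC0 //; apply: leq_trans sP lk.
Qed.

Lemma line_rep_cst b c : line_rep b 0 (mpolyC n c) c (polyC (mpolyC n c)).
Proof.
split; first exact: size_polyC_leq1.
  by rewrite coefC.
by move=> z x; rewrite pevalC map_polyC hornerC /= mevalC.
Qed.

Lemma line_rep_coord b j : line_rep b 1 (mpolyX C (mnm1 j)) (b ord0 j)
  ((mpolyC n (b ord0 j))%:P * 'X + (mpolyX C (mnm1 j))%:P).
Proof.
split.
- apply: leq_trans (size_polyD _ _) _; rewrite geq_max; apply/andP; split.
    by apply: leq_trans (size_polyMleq _ _) _; rewrite size_polyX addn2 /= ltnS size_polyC_leq1.
  by apply: leq_trans (size_polyC_leq1 _) _.
- rewrite coefD coefCM coefX eqxx mulr1 coefC addr0; reflexivity.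
move=> z x; rewrite pevalX rmorphD rmorphM /= !map_polyC map_polyX /= !hornerE mevalC.
by rewrite -[meval _ (mpolyX _ _)]/(peval _ z) pevalX !mxE; ring.
Qed.

Lemma line_rep_monom b (m : multinom n) :
  exists P, line_rep b (mdeg m) (mpolyX C m) (\prod_j b ord0 j ^+ m j) P.
Proof.
rewrite mpolyXE_id mdegE.
elim: (index_enum _) => [|j s [P HP]].
  by exists 1; rewrite !big_nil; exact: (line_rep_cst b 1).
have [Q HQ] : exists Q, line_rep b (m j) (mpolyX C (mnm1 j) ^+ m j) (b ord0 j ^+ m j) Q.
  elim: (m j) => [|i [Q HQ]]; first by exists 1; exact: (line_rep_cst b 1).
  eexists; rewrite !exprS -add1n; exact: line_repM (line_rep_coord b j) HQ.
by exists (Q * P); rewrite !big_cons; apply: line_repM.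
Qed.

Lemma line_rep_exists b k (p : mp) : (msize p <= k.+1)%N ->
  exists P, line_rep b k p (\sum_(m <- msupp p | mdeg m == k) mcoeff m p * \prod_j b ord0 j ^+ m j) P.
Proof.
move=> sp; rewrite [X in line_rep _ _ X](mpolyE p).
have : {subset msupp p <= msupp p} by [].
elim: {1 3 4}(msupp p) => [_|m s IH sub].
  exists 0; rewrite !big_nil; split; rewrite ?size_poly0 ?coef0 ?mpolyC0 // => z x.
  by rewrite peval0 rmorph0 horner0.
have [|P HP] := IH; first by move=> i si; apply: sub; rewrite inE si orbT.
have [Q HQ] := line_rep_monom b m.
have {}HQ : line_rep b (mdeg m) (mcoeff m p *: mpolyX C m)
    (mcoeff m p * \prod_j b ord0 j ^+ m j) ((mpolyC n (mcoeff m p))%:P * Q).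
  by rewrite -mul_mpolyC -[mdeg m]add0n; apply: line_repM HQ; apply: line_rep_cst.
have mk : (mdeg m <= k)%N.
  by rewrite -ltnS; apply: leq_trans sp; apply: msize_mdeg_lt; apply: sub; rewrite mem_head.
rewrite !big_cons; case: eqP => [mE|/eqP mn].
  by rewrite mE in HQ; eexists; apply: line_repD HQ HP.
rewrite -[X in line_rep _ _ _ X]add0r; eexists; apply: line_repD HP.
by apply: line_rep_raise HQ; rewrite ltn_neqAle mn.
Qed.

(** b is a point where the homogeneous part of top degree does not vanish, and tau is its value
    there. *)
Lemma monic_direction (p : mp) : p != 0 ->
  exists b tau P, tau != 0 /\ line_rep b (msize p).-1 p tau P.
Proof.
move=> p0; have sE := mlead_deg p0; set k := (msize p).-1.
pose h : mp := \sum_(m <- msupp p | mdeg m == k) mcoeff m p *: mpolyX C m.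
have kE : mdeg (mlead p) = k by rewrite /k -sE.
have h0 : h != 0.
  apply/eqP => h0; have : mcoeff (mlead p) h = mcoeff (mlead p) p.
    rewrite /h raddf_sum /= big_mkcond (bigD1_seq (mlead p)) ?msupp_uniq ?mlead_supp //= kE eqxx.
    rewrite mcoeffZ mcoeffX eqxx mulr1 big1 ?addr0 // => m /negPf mn.
    by case: ifP => // _; rewrite mcoeffZ mcoeffX mn mulr0.
  by rewrite h0 mcoeff0 => /esym/eqP; rewrite mleadc_eq0 (negPf p0).
have [b hb] := peval_neq0 h0.
have [|P HP] := @line_rep_exists b k p; first by rewrite /k -sE.
exists b; eexists; exists P; split; last exact: HP.
move: hb; rewrite /h peval_sum (eq_bigr (fun m => mcoeff m p * \prod_j b ord0 j ^+ m j)) // => m _.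
by rewrite pevalZ /peval mevalX.
Qed.

Lemma is_poly_ext f g : (forall z, f z = g z) -> is_poly f -> is_poly g.
Proof. by move=> /funext ->. Qed.
Lemma is_poly_peval (p : mp) : is_poly (peval p). Proof. by exists p. Qed.
Lemma is_poly_cst (c : C) : is_poly (fun _ : Cn => c).
Proof. by exists (mpolyC n c) => z; rewrite pevalC. Qed.
Lemma is_polyD f g : is_poly f -> is_poly g -> is_poly (fun z => f z + g z).
Proof. by move=> [p hp] [q hq]; exists (p + q) => z; rewrite pevalD hp hq. Qed.
Lemma is_polyM f g : is_poly f -> is_poly g -> is_poly (fun z => f z * g z).
Proof. by move=> [p hp] [q hq]; exists (p * q) => z; rewrite pevalM hp hq. Qed.
Lemma is_polyN f : is_poly f -> is_poly (fun z => - f z).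
Proof. by move=> [p hp]; exists (- p) => z; rewrite pevalN hp. Qed.
Lemma is_polyB f g : is_poly f -> is_poly g -> is_poly (fun z => f z - g z).
Proof. by move=> hf /is_polyN; apply: is_polyD. Qed.
Lemma is_poly_sum (I : Type) (s : seq I) (P : pred I) (F : I -> Cn -> C) :
  (forall i, P i -> is_poly (F i)) -> is_poly (fun z => \sum_(i <- s | P i) F i z).
Proof.
move=> hF; elim: s => [|i s IH]; first by apply: is_poly_ext (is_poly_cst 0) => z; rewrite big_nil.
case Pi : (P i); last by apply: is_poly_ext IH => z; rewrite big_cons Pi.
by apply: is_poly_ext (is_polyD (hF i Pi) IH) => z; rewrite big_cons Pi.
Qed.
Lemma is_poly_hol f : is_poly f -> hol f.
Proof. by move=> [p hp]; apply: hol_ext (peval_is_hol p) => z; rewrite hp. Qed.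

(* Integration of Euler's formula along rays. *)
Lemma is_poly_of_dd f : hol f -> (forall j, is_poly (dd (ej R j) f)) -> is_poly f.
Proof.
move=> hf /choice[P HP].
pose Q : mp := \sum_j \sum_(m <- msupp (P j))
   (mcoeff m (P j) / (mdeg m).+1%:R) *: (mpolyX C (mnm1 j) * mpolyX C m).
pose mon (m : multinom n) z := \prod_i z ord0 i ^+ m i.
have monZ (m : multinom n) (x : C) z : mon m (x *: z) = x ^+ mdeg m * mon m z.
  rewrite /mon mdegE -prodrXr -big_split; apply: eq_bigr => i _.
  by rewrite mxE exprMn.
exists (mpolyC n (f 0) + Q) => z; rewrite pevalD pevalC.
pose q j (m : multinom n) : C := mcoeff m (P j) * (z ord0 j * mon m z).
pose S (x : C) := \sum_j \sum_(m <- msupp (P j)) q j m / (mdeg m).+1%:R * x ^+ (mdeg m).+1.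
have QE (x : C) : peval Q (x *: z) = S x.
  rewrite peval_sum; apply: eq_bigr => j _; rewrite peval_sum; apply: eq_bigr => m _.
  rewrite pevalZ pevalM pevalX [peval (mpolyX C m) _]/peval mevalX -/(mon m _) monZ mxE exprS.
  by rewrite /q; ring.
have H := @der0_cst _ (fun x : C => f (0 + x *: z) - S x) _ 1.
rewrite -!QE scale1r scale0r !add0r in H.
have Q0 : peval Q 0 = 0.
  by rewrite -(scale0r z) QE /S big1 // => j _; rewrite big1 // => m _; rewrite exprS mul0r mulr0.
suff H' : f z - peval Q z = f 0 - peval Q 0 by rewrite -[f z](subrK (peval Q z)) H' Q0 subr0.
apply: H => x.
have csum (I : Type) (s : seq I) (F : I -> C -> C) (F' : I -> C) : (forall i, cder (F i) x (F' i)) ->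
    cder (fun y => \sum_(i <- s) F i y) x (\sum_(i <- s) F' i).
  move=> dF; elim: s => [|i s IH].
    by rewrite big_nil; apply: cder_ext (cder_cst 0 x) => y; rewrite big_nil.
  by rewrite big_cons; apply: cder_ext (cderD (dF i) IH) => y; rewrite big_cons.
rewrite [X in cder _ _ X](_ : _ = dd z f (0 + x *: z) -
    \sum_j \sum_(m <- msupp (P j)) q j m / (mdeg m).+1%:R * ((mdeg m).+1%:R * x ^+ mdeg m)); last first.
  rewrite add0r dd_coord // -sumrB big1 // => j _; rewrite HP /peval mevalE mulr_sumr -sumrB big1 // => m _.
  by rewrite -/(mon m _) monZ /q mulrA divfK ?pnatr_eq0 //; ring.
apply: cderB; first exact: ddP.
by apply: (csum _ _ _ _) => j; apply: (csum _ _ _ _) => m; apply: cderZ; exact: cder_exp.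
Qed.

Definition pgrow f := exists K d, forall r, 1 <= r -> forall z, pdisc r z -> cn (f z) <= K * r ^+ d.

Lemma pgrow_pos f : pgrow f -> exists2 K, 0 <= K &
  exists d, forall r, 1 <= r -> forall z, pdisc r z -> cn (f z) <= K * r ^+ d.
Proof.
move=> [K [d H]]; exists K; last by exists d.
have := H 1 (lexx _) 0 (@pdisc0 R n 1 ler01); rewrite expr1n mulr1; apply: le_trans; exact: cn_ge0.
Qed.

Lemma ej_pdisc j : pdisc 1 (ej R j : Cn).
Proof. by move=> i; rewrite mxE eqxx /=; case: (i == j); rewrite ?cn1 ?cn0. Qed.

Lemma hol_bounded_cst f K : hol f -> (forall z, cn (f z) <= K) -> forall z, f z = f 0.
Proof.
move=> hf H; apply: dd0_cst => // j z.
have K0 : 0 <= K by apply: le_trans (cn_ge0 _) (H 0).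
apply/eqP; rewrite -cn_eq0 eq_le cn_ge0 andbT; apply: le_of_lee => e e0; rewrite add0r.
have [r r0 hr] := pdisc_ex z; pose s := 1 + 2 * K / e.
have s0 : 0 < s by rewrite ltr_pwDl // divr_ge0 ?mulr_ge0 // ltW.
apply: le_trans (dd_bound s0 hf (M := K) _ hr (ej_pdisc j)) _ => //.
rewrite ler_pdivrMr // /s mulrDr mulr1 mulrCA divff ?mulr1 ?gt_eqF // lerDr; exact: ltW.
Qed.

(** Cauchy's estimate with radius r lowers the order of growth by 1 for each partial derivative,
    down to Liouville's theorem; [is_poly_of_dd] leads back up. *)
Lemma pgrow_poly f : hol f -> pgrow f -> is_poly f.
Proof.
move=> hf /pgrow_pos[K K0 [d H]].
elim: d f hf K K0 H => [|d IH] f hf K K0 H.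
  apply: is_poly_ext (is_poly_cst (f 0)) => z; apply/esym; apply: (hol_bounded_cst (K := K) hf) => w.
  have [r r0 hr] := pdisc_ex w; have := H (r + 1); rewrite mulr1; apply; first lra.
  by apply: pdisc_le hr; rewrite lerDl.
apply: is_poly_of_dd => // j.
apply: (IH _ (hol_dd _ hf) (2 * K * 2 ^+ d.+1)); first by rewrite !mulr_ge0 ?exprn_ge0.
move=> r r1 z hz.
have r0 : 0 < r by lra.
apply: le_trans (dd_bound r0 hf (M := K * (r + r) ^+ d.+1) _ hz (ej_pdisc j)) _.
  by move=> w hw; apply: H => //; lra.
rewrite ler_pdivrMr //; have -> : r + r = 2 * r by ring.
by rewrite exprMn (exprS r); apply: le_of_eq; ring.
Qed.

Lemma pgrow_coord j : pgrow (fun z => z ord0 j).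
Proof. by exists 1, 1%N => r r1 z hz; rewrite mul1r. Qed.
Lemma pgrow_cst c : pgrow (fun=> c).
Proof. by exists (cn c), 0%N => r r1 z hz; rewrite mulr1. Qed.
Lemma pgrowD f g : pgrow f -> pgrow g -> pgrow (fun z => f z + g z).
Proof.
move=> /pgrow_pos[K K0 [d H]] /pgrow_pos[K' K'0 [d' H']]; exists (K + K'), (d + d')%N => r r1 z hz.
apply: le_trans (cnD _ _) _; rewrite mulrDl; apply: lerD.
  apply: le_trans (H r r1 z hz) _; rewrite ler_wpM2l // ler_weXn2l //; lia.
apply: le_trans (H' r r1 z hz) _; rewrite ler_wpM2l // ler_weXn2l //; lia.
Qed.
Lemma pgrowM f g : pgrow f -> pgrow g -> pgrow (fun z => f z * g z).
Proof.
move=> /pgrow_pos[K K0 [d H]] /pgrow_pos[K' K'0 [d' H']]; exists (K * K'), (d + d')%N => r r1 z hz.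
by rewrite cnM exprD mulrACA ler_pM ?cn_ge0 ?H ?H'.
Qed.
Lemma pgrow_dom f g : pgrow g -> (forall z, cn (f z) <= cn (g z)) -> pgrow f.
Proof. by move=> [K [d H]] fg; exists K, d => r r1 z hz; apply: le_trans (fg z) (H r r1 z hz). Qed.
Lemma pgrow_rc f : pgrow f -> pgrow (fun z => rc (cn (f z))).
Proof. by move=> hf; apply: pgrow_dom hf _ => z; rewrite cn_rc ger0_norm ?cn_ge0. Qed.
Lemma pgrowX f k : pgrow f -> pgrow (fun z => f z ^+ k).
Proof.
move=> hf; elim: k => [|k IH]; first exact: pgrow_cst.
by apply: pgrow_dom (pgrowM hf IH) _ => z; rewrite exprS.
Qed.
Lemma pgrow_sum (I : Type) (s : seq I) (P : pred I) (F : I -> Cn -> C) :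
  (forall i, P i -> pgrow (F i)) -> pgrow (fun z => \sum_(i <- s | P i) F i z).
Proof.
move=> hF; elim: s => [|i s IH]; first by apply: pgrow_dom (pgrow_cst 0) _ => z; rewrite big_nil.
case Pi : (P i); last by apply: pgrow_dom IH _ => z; rewrite big_cons Pi.
by apply: pgrow_dom (pgrowD (hF i Pi) IH) _ => z; rewrite big_cons Pi.
Qed.
Lemma pgrow_peval (p : mp) : pgrow (peval p).
Proof.
apply: (@pgrow_dom _ (fun z => \sum_(m <- msupp p) mcoeff m p * \prod_i z ord0 i ^+ m i)); last first.
  by move=> z; rewrite /peval mevalE.
apply: pgrow_sum => m _; apply: pgrowM; first exact: pgrow_cst.
elim: (index_enum _) => [|i s IH]; first by apply: pgrow_dom (pgrow_cst 1) _ => z; rewrite big_nil.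
apply: pgrow_dom (pgrowM (pgrowX (m i) (pgrow_coord i)) IH) _ => z; by rewrite big_cons.
Qed.
Lemma pgrow_is_poly f : is_poly f -> pgrow f.
Proof. by move=> [p hp]; apply: pgrow_dom (pgrow_peval p) _ => z; rewrite hp. Qed.

(** The growth criterion spares a substitution in multivariate polynomials. *)
Lemma is_poly_shift c f : is_poly f -> is_poly (fun z => f (z + c)).
Proof.
move=> hf; apply: pgrow_poly; first exact: hol_shift (is_poly_hol hf).
have /pgrow_pos[K K0 [d H]] := pgrow_is_poly hf; have [s s0 hs] := pdisc_ex c.
exists (K * (1 + s) ^+ d), d => r r1 z hz.
apply: le_trans (H (r + s) _ _ (pdiscD hz hs)) _; first lra.
by rewrite -mulrA -exprMn ler_wpM2l //; apply: lerXn2r; rewrite ?nnegrE; nra.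
Qed.

(* The reciprocal polynomial turns the leading coefficient into a value at 0. *)
Lemma lead_bound (P : {poly C}) (k : nat) (h : C -> C) M : (size P <= k.+1)%N -> entire1 h ->
  (forall x, cn x = 1 -> cn (P.[x] * h x) <= M) -> cn (P`_k) * cn (h 0) <= M.
Proof.
move=> sP dh H; pose Q : {poly C} := \poly_(i < k.+1) cj P`_(k - i).
have Q0 : Q.[0] = cj P`_k by rewrite horner_coef0 coef_poly subn0.
have QE x : cn x = 1 -> cn Q.[x] = cn P.[x].
  move=> x1; have xc : x * cj x = 1 by rewrite mulcj x1 expr1n rc1.
  have -> : Q.[x] = x ^+ k * cj P.[x].
    have E i j (a : C) : x ^+ (i + j) * cj (a * x ^+ j) = cj a * x ^+ i.
      have e : x ^+ j * cj x ^+ j = 1 by rewrite -exprMn xc expr1n.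
      by rewrite exprD cjM cjX -mulrA [x ^+ j * _]mulrCA e mulr1 mulrC.
    rewrite horner_poly (horner_coef_wide _ sP) cj_sum mulr_sumr [RHS](reindex_inj rev_ord_inj).
    apply: eq_bigr => i _; have ik : (i <= k)%N by rewrite -ltnS.
    by rewrite -(E i (k - i)%N) subnKC.
  by rewrite cnM cnX x1 expr1n mul1r cn_cj.
have dQ : entire1 (fun x => Q.[x]).
  move=> x; rewrite /Q; have [l dl] := @entire1_sum R _ (index_enum 'I_k.+1)
    (fun i y => cj P`_(k - i) * y ^+ i) (fun i y => ex_intro _ _ (cderZ (cj P`_(k - i)) (cder_exp i y))) x.
  by exists l; apply: cder_ext dl => y; rewrite horner_poly.
have := @entire_bound_center R (fun x => Q.[x] * h x) 1 M ltr01 (entire1M dQ dh).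
by rewrite Q0 cnM cn_cj; apply => x x1; rewrite cnM QE // -cnM; exact: H.
Qed.

(** On the line z + Cb the polynomial a has the constant leading coefficient tau, so by [lead_bound]
    |tau f(z)| is at most the maximum of |a f| over the unit circle of that line. The zeros of a do
    no harm. *)
Lemma pgrow_div (a : mp) f : a != 0 -> hol f -> pgrow (fun z => peval a z * f z) -> pgrow f.
Proof.
move=> a0 hf /pgrow_pos[K K0 [d H]].
have [b [tau [P [t0 [sP cP eP]]]]] := monic_direction a0.
have [s s0 hs] := pdisc_ex b; have ct : 0 < cn tau by rewrite cn_gt0.
exists (K * (1 + s) ^+ d / cn tau), d => r r1 z hz.
rewrite mulrAC ler_pdivlMr // mulrC.
have := @lead_bound (map_poly (meval (z ord0)) P) (msize a).-1 (fun x => f (z + x *: b)) (K * (1 + s) ^+ d * r ^+ d).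
rewrite scale0r addr0 coef_map_id0 ?meval0 // cP mevalC; apply.
- by apply: leq_trans (size_poly _ _) _.
- exact: hf.1.
move=> x x1; rewrite -eP; apply: le_trans (H (r + 1 * s) _ _ _) _.
- lra.
- by apply: pdiscD => //; apply: pdiscZ => //; rewrite x1.
by rewrite -mulrA -exprMn ler_wpM2l //; apply: lerXn2r; rewrite ?nnegrE; nra.
Qed.

(** y = a f is a root of the monic equation y^2 + b y + a c = 0, hence |y| <= 1 + |b| + |a c|; then
    a is divided off by [pgrow_div]. *)
Lemma quadratic_pgrow (a : mp) (b c : Cn -> C) f : a != 0 -> hol f -> pgrow b -> pgrow c ->
  (forall z, peval a z * f z ^+ 2 + b z * f z + c z = 0) -> is_poly f.
Proof.
move=> a0 hf hb hc H; apply: pgrow_poly => //; apply: (pgrow_div a0 hf).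
have h1 := pgrowD (pgrowD (pgrow_cst 1) (pgrow_rc hb)) (pgrow_rc (pgrowM (pgrow_peval a) hc)).
apply: pgrow_dom h1 _ => z; rewrite -rc1 -!rcD cn_rc ger0_norm; last by rewrite !addr_ge0 ?cn_ge0.
set y := peval a z * f z.
have yE : y ^+ 2 = - (b z * y + peval a z * c z).
  by rewrite /y; apply/eqP; rewrite -addr_eq0; apply/eqP;
    transitivity (peval a z * (peval a z * f z ^+ 2 + b z * f z + c z)); [ring|rewrite H mulr0].
have : cn y ^+ 2 <= cn (b z) * cn y + cn (peval a z * c z).
  by rewrite -cnX yE cnN -cnM; apply: cnD.
have := cn_ge0 y; have := cn_ge0 (b z); have := cn_ge0 (peval a z * c z).
move: (cn y) (cn (b z)) (cn (_ * c z)) => Y B A A0 B0 Y0 h.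
rewrite leNgt; apply/negP => h'; have : Y * Y > (1 + B + A) * Y by nra.
nra.
Qed.

End Polynomials.

(** * Factorizations of irreducible polynomials into entire functions *)

Section RootSums.
Variable R : realType.
Local Notation C := (Cplx R).
Implicit Types (f h : C -> C) (r : nat -> C) (q : {poly C}).

Lemma entire1_ext f h : (forall x, f x = h x) -> entire1 f -> entire1 h.
Proof. by move=> /funext ->. Qed.
Lemma entire1Z (a : C) f : entire1 f -> entire1 (fun x => a * f x).
Proof. by move=> df x; eexists; apply: cderZ (derP x df). Qed.
Lemma entire1D f h : entire1 f -> entire1 h -> entire1 (fun x => f x + h x).
Proof. by move=> df dh x; eexists; apply: cderD (derP x df) (derP x dh). Qed.
Lemma entire1_mulX h : entire1 h -> entire1 (fun x => x * h x).
Proof. by apply: entire1M => x; exists 1; exact: cder_id. Qed.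
Lemma entire1_horner q : entire1 (fun x => q.[x]).
Proof.
elim/poly_ind: q => [|q c IH]; first by move=> x; exists 0; apply: cder_ext (cder_cst 0 x) => y; rewrite horner0.
apply: (@entire1_ext (fun x => x * q.[x] + c)) => [x|]; first by rewrite !hornerE mulrC.
by apply: entire1D (entire1_mulX IH) _ => x; exists 0; apply: cder_cst.
Qed.

Lemma dquotD f h : entire1 f -> entire1 h ->
  dquot (fun x => f x + h x) = fun x => dquot f x + dquot h x.
Proof.
move=> df dh; apply/funext => x; rewrite /dquot; case: eqP => [_|_].
  by apply: derE; apply: cderD; apply: derP.
by rewrite -mulrDl; congr (_ / _); ring.
Qed.
Lemma dquotZ (a : C) f : entire1 f -> dquot (fun x => a * f x) = fun x => a * dquot f x.
Proof.
move=> df; apply/funext => x; rewrite /dquot; case: eqP => [_|_].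
  by apply: derE; apply: cderZ; apply: derP.
by rewrite mulrA mulrBr.
Qed.
Lemma tcoefD f h l : entire1 f -> entire1 h ->
  tcoef (fun x => f x + h x) l = tcoef f l + tcoef h l.
Proof.
elim: l f h => [//|l IH] f h df dh; rewrite /tcoef !iterSr dquotD //.
by apply: IH; apply: dquot_entire1.
Qed.
Lemma tcoefZ (a : C) f l : entire1 f -> tcoef (fun x => a * f x) l = a * tcoef f l.
Proof.
elim: l f => [//|l IH] f df; rewrite /tcoef !iterSr dquotZ //.
by apply: IH; apply: dquot_entire1.
Qed.
Lemma tcoef_mulX h l : entire1 h -> tcoef (fun x => x * h x) l.+1 = tcoef h l.
Proof.
move=> dh; rewrite /tcoef iterSr; congr (iter l _ _ _); apply/funext => x; rewrite /dquot.
case: eqP => [->|/eqP x0].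
  by apply: derE; have := cderM (cder_id 0) (derP 0 dh); rewrite mul1r mul0r addr0.
by rewrite mul0r subr0 mulrC mulKf.
Qed.
Lemma tcoef_mulX0 h : tcoef (fun x => x * h x) 0 = 0.
Proof. by rewrite /tcoef /= mul0r. Qed.
Lemma tcoef_cst (c : C) l : tcoef (fun=> c) l = if l == 0%N then c else 0.
Proof.
case: l => // l; rewrite /tcoef iterSr.
have -> : dquot (fun=> c) = fun=> 0.
  apply/funext => x; rewrite /dquot; case: eqP => _; first by apply: derE; apply: cder_cst.
  by rewrite subrr mul0r.
elim: l => //= l IH; rewrite -iterS iterSr.
suff -> : dquot (fun=> 0) = (fun=> 0) :> (C -> C) by [].
apply/funext => x; rewrite /dquot; case: eqP => _; first by apply: derE; apply: cder_cst.
by rewrite subrr mul0r.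
Qed.
Lemma tcoef_horner q l : tcoef (fun x => q.[x]) l = q`_l.
Proof.
elim/poly_ind: q l => [|q c IH] l.
  rewrite (_ : (fun x => _) = fun=> 0); last by apply/funext => x; rewrite horner0.
  by rewrite tcoef_cst coef0 if_same.
rewrite (_ : (fun x => _) = fun x => x * q.[x] + (fun=> c) x); last first.
  by apply/funext => x; rewrite !hornerE mulrC.
have dq := entire1_horner q; have dc : entire1 (fun=> c : C) by move=> x; exists 0; apply: cder_cst.
rewrite tcoefD //; last exact: entire1_mulX.
rewrite tcoef_cst coefD coefMX coefC; case: l => [|l]; first by rewrite tcoef_mulX0.
by rewrite tcoef_mulX // IH.
Qed.

Definition geom_bounded r := exists K G : R, [/\ 0 <= K, 1 <= G & forall l, cn (r l) <= K * G ^+ l].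

(** The linear functional x^l -> r l, extended from polynomials to entire functions; the geometric
    growth of r makes the series converge. For r = [rmodc q] with q monic it plays the part of the
    contour integral of h / q around all roots of q, divided by 2 pi i. *)
Definition lam r h : C :=
  xget 0 [set L | climit (fun K => \sum_(l < K) tcoef h l * r l) L].

Lemma lam_partial r h (M G K0 : R) : 1 <= G -> 0 <= K0 -> (forall l, cn (r l) <= K0 * G ^+ l) ->
  entire1 h -> (forall x, cn x <= 8 * G -> cn (h x) <= M) ->
  forall l, cn (tcoef h l * r l) <= M * K0 / 2 ^+ l.
Proof.
move=> G1 K00 hr dh H l.
have G0 : 0 < 8 * G by rewrite mulr_gt0 //; lra.
rewrite cnM; apply: le_trans (ler_pM (cn_ge0 _) (cn_ge0 _) (tcoef_bound l G0 dh H) (hr l)) _.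
have Gn : G != 0 by rewrite gt_eqF //; lra.
have -> : 4 / (8 * G) = 2^-1 / G by field.
rewrite exprMn !exprVn; apply: le_of_eq; field.
by rewrite !expf_neq0.
Qed.

Lemma lamP r h : geom_bounded r -> entire1 h ->
  climit (fun K => \sum_(l < K) tcoef h l * r l) (lam r h).
Proof.
move=> [K0 [G [K00 G1 hr]]] dh.
have [M HM] := entire1_bounded (8 * G) dh.
have M0 : 0 <= M by apply: le_trans (cn_ge0 _) (HM 0 _); rewrite cn0; lra.
have tb := lam_partial G1 K00 hr dh HM.
suff [L HL] : exists L, climit (fun K => \sum_(l < K) tcoef h l * r l) L.
  exact: (@xgetPex _ 0 [set L | climit (fun K => \sum_(l < K) tcoef h l * r l) L] (ex_intro _ L HL)).
apply: climit_cauchy => e e0.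
have [N HN] := half_pow_small (4 * (M * K0)) e0; exists N.
have key j : cn (\sum_(l < N + j) tcoef h l * r l - \sum_(l < N) tcoef h l * r l) <=
    2 * (M * K0) / 2 ^+ N - 2 * (M * K0) / 2 ^+ (N + j).
  elim: j => [|j IH]; first by rewrite addn0 !subrr cn0.
  rewrite addnS big_ord_recr /= addrAC; apply: le_trans (cnD _ _) _.
  apply: le_trans (lerD IH (tb _)) _; rewrite [2 ^+ (N + j).+1]exprS.
  have n1 : (2 ^+ (N + j) : R) != 0 by rewrite gt_eqF ?exp2_gt0.
  have n2 : (2 ^+ N : R) != 0 by rewrite gt_eqF ?exp2_gt0.
  by apply: le_of_eq; field; rewrite n1.
have key' m : (N <= m)%N -> cn (\sum_(l < m) tcoef h l * r l - \sum_(l < N) tcoef h l * r l) <= e / 2.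
  move=> /subnKC <-; apply: le_trans (key _) _.
  apply: (@le_trans _ _ (2 * (M * K0) / 2 ^+ N)).
    by rewrite gerBl divr_ge0 ?mulr_ge0 // ltW // exp2_gt0.
  by have := HN N (leqnn _); lra.
move=> m k /key' hm /key' hk.
apply: le_trans (cn_split (\sum_(l < N) tcoef h l * r l) _ _) _.
by rewrite [X in _ + X]cnBC; lra.
Qed.

Lemma lam_eq r h L : geom_bounded r -> entire1 h ->
  climit (fun K => \sum_(l < K) tcoef h l * r l) L -> lam r h = L.
Proof. by move=> hr dh; apply: climit_uniq; apply: lamP. Qed.

Lemma lamD r f h : geom_bounded r -> entire1 f -> entire1 h ->
  lam r (fun x => f x + h x) = lam r f + lam r h.
Proof.
move=> hr df dh; apply: lam_eq => //; first exact: entire1D.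
apply: climit_ext (climitD (lamP hr df) (lamP hr dh)) => K.
by rewrite -big_split; apply: eq_bigr => l _; rewrite tcoefD // mulrDl.
Qed.
Lemma lamZ r (a : C) f : geom_bounded r -> entire1 f -> lam r (fun x => a * f x) = a * lam r f.
Proof.
move=> hr df; apply: lam_eq => //; first exact: entire1Z.
apply: climit_ext (climitZ a (lamP hr df)) => K.
by rewrite mulr_sumr; apply: eq_bigr => l _; rewrite tcoefZ // mulrA.
Qed.
Lemma lam_sum r (I : Type) (s : seq I) (F : I -> C -> C) : geom_bounded r -> (forall i, entire1 (F i)) ->
  lam r (fun x => \sum_(i <- s) F i x) = \sum_(i <- s) lam r (F i).
Proof.
move=> hr dF; elim: s => [|i s IH].
  rewrite big_nil (_ : (fun x => _) = fun=> 0); last by apply/funext => x; rewrite big_nil.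
  apply: lam_eq => //; first by move=> x; exists 0; apply: cder_cst.
  by apply: climit_ext (climit_cst 0) => K; rewrite big1 // => l _; rewrite tcoef_cst if_same mul0r.
rewrite big_cons -IH -lamD //; last exact: entire1_sum.
by congr lam; apply/funext => x; rewrite big_cons.
Qed.

Definition shr r j : nat -> C := fun l => r (l + j)%N.
Lemma geom_shr r j : geom_bounded r -> geom_bounded (shr r j).
Proof.
move=> [K [G [K0 G1 H]]]; exists (K * G ^+ j), G; split=> // [|l]; last first.
  by apply: le_trans (H _) _; rewrite exprD; apply: le_of_eq; ring.
by rewrite mulr_ge0 ?exprn_ge0 //; lra.
Qed.

Lemma lam_mulX r h : geom_bounded r -> entire1 h -> lam r (fun x => x * h x) = lam (shr r 1) h.
Proof.
move=> hr dh; apply: lam_eq => //; first exact: entire1_mulX.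
have H := lamP (geom_shr 1 hr) dh.
move=> e /H[N HN]; exists N.+1 => -[//|K]; rewrite ltnS => /HN hK.
rewrite big_ord_recl tcoef_mulX0 mul0r add0r; move: hK; congr (cn (_ - _) <= _).
by apply: eq_bigr => l _; rewrite /= tcoef_mulX // /shr addn1.
Qed.

Lemma lam_mulXn r h j : geom_bounded r -> entire1 h -> lam r (fun x => x ^+ j * h x) = lam (shr r j) h.
Proof.
move=> hr dh; elim: j r hr => [|j IH] r hr.
  congr lam; last by apply/funext => x; rewrite mul1r.
  by apply/funext => l; rewrite /shr addn0.
have dj : entire1 (fun x => x ^+ j * h x).
  by apply: entire1M => // x; eexists; exact: cder_exp.
rewrite (_ : (fun x => _) = fun x => x * (x ^+ j * h x)); last by apply/funext => x; rewrite exprS mulrA.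
rewrite lam_mulX // IH; last exact: geom_shr.
by congr lam; apply/funext => l; rewrite /shr -addnA addn1.
Qed.

(** The sequence r satisfies the linear recurrence with characteristic polynomial q. *)
Definition annihilates q r := forall l, \sum_(j < size q) q`_j * r (l + j)%N = 0.

(** The functional vanishes on multiples of q by entire functions, not only by polynomials: this is
    what extends reduction modulo q to entire functions. *)
Lemma lam_annihilate q r h : geom_bounded r -> entire1 h -> annihilates q r ->
  lam r (fun x => q.[x] * h x) = 0.
Proof.
move=> hr dh an.
have dX j : entire1 (fun x => x ^+ j * h x).
  by apply: entire1M => // x; eexists; exact: cder_exp.
rewrite (_ : (fun x => _) = fun x => \sum_(j < size q) q`_j * (x ^+ j * h x)); last first.
  by apply/funext => x; rewrite horner_coef mulr_suml; apply: eq_bigr => j _; rewrite mulrA.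
rewrite (@lam_sum r _ _ (fun (j : 'I_(size q)) x => q`_j * (x ^+ j * h x)) hr) => [|j]; last exact: entire1Z.
have lim : climit (fun K => \sum_(j < size q) q`_j * \sum_(l < K) tcoef h l * shr r j l)
    (\sum_(j < size q) lam r (fun x => q`_j * (x ^+ j * h x))).
  elim: (index_enum _) => [|j s IH].
    by rewrite big_nil; apply: climit_ext (climit_cst 0) => K; rewrite big_nil.
  rewrite big_cons lamZ // lam_mulXn //.
  apply: climit_ext (climitD (climitZ q`_j (lamP (geom_shr j hr) dh)) IH) => K.
  by rewrite big_cons.
apply: climit_uniq lim _; apply: climit_ext (climit_cst 0) => K; apply/esym.
rewrite (eq_bigr (fun j : 'I_(size q) => \sum_(l < K) tcoef h l * (q`_j * r (l + j)%N))); last first.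
  by move=> j _; rewrite mulr_sumr; apply: eq_bigr => l _; rewrite /shr; ring.
by rewrite exchange_big big1 //= => l _; rewrite -mulr_sumr an mulr0.
Qed.

(* [rmodc q l] is the coefficient of X^(deg q - 1) in X^l mod q, so that
   [lam (rmodc q) h] is the coefficient of X^(deg q - 1) in h mod q. *)
Definition rmodc q l : C := ('X^l %% q)`_(size q).-2.

Lemma modp_sum (I : Type) (s : seq I) (F : I -> {poly C}) q :
  (\sum_(i <- s) F i) %% q = \sum_(i <- s) (F i %% q).
Proof. by elim: s => [|i s IH]; rewrite ?big_nil ?mod0p // !big_cons modpD IH. Qed.

Lemma rmodc_annihilates q : annihilates q (rmodc q).
Proof.
move=> l; have h : 'X^l * q = \sum_(j < size q) q`_j *: 'X^(l + j).
  by rewrite -{1}(coefK q) poly_def mulr_sumr; apply: eq_bigr => j _; rewrite -scalerAr exprD.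
have := modp_mull 'X^l q; rewrite h modp_sum => /(congr1 (fun p : {poly C} => p`_(size q).-2)).
rewrite coef_sum coef0 => e; apply: etrans e.
by apply: eq_bigr => j _; rewrite modpZl coefZ.
Qed.

Lemma rmodc_small q l : (l < (size q).-1)%N -> rmodc q l = (l == (size q).-2)%:R.
Proof.
move=> lq; rewrite /rmodc modp_small ?coefXn ?size_polyXn 1?eq_sym //.
by move: lq; case: (size q).
Qed.

(** A bound of Cauchy's type for the roots of a monic q, which also bounds the growth rate of the
    recurrent sequence [rmodc q]. Unlike the roots, it depends on q in an explicit way. *)
Definition polysum q : R := 1 + \sum_(j < (size q).-1) cn q`_j.
Lemma polysum_ge1 q : 1 <= polysum q.
Proof. by rewrite lerDl sumr_ge0 // => j _; exact: cn_ge0. Qed.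

Lemma rmodc_rec q l : q \is monic -> rmodc q (l + (size q).-1) =
  - \sum_(j < (size q).-1) q`_j * rmodc q (l + j).
Proof.
move=> mq; have s0 : size q = (size q).-1.+1 by rewrite prednK // lt0n size_poly_eq0 monic_neq0.
have := rmodc_annihilates q l; rewrite s0 big_ord_recr /=.
have -> : q`_(size q).-1 = 1 by apply/eqP; exact: mq.
by rewrite mul1r => /eqP; rewrite addrC addr_eq0 => /eqP.
Qed.

Lemma rmodc_bound q : q \is monic -> forall l, cn (rmodc q l) <= 1 * polysum q ^+ l.
Proof.
move=> mq l; rewrite mul1r; have G1 := polysum_ge1 q.
elim/ltn_ind: l => l IH; have [lq|ql] := ltnP l (size q).-1.
  by rewrite rmodc_small // cn_nat; apply: le_trans (exprn_ege1 _ G1); case: (_ == _).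
rewrite -(subnK ql) rmodc_rec // cnN; apply: le_trans (cn_sum _ _ _) _.
have [k0|k0] := posnP (size q).-1.
  rewrite k0 big_ord0 exprn_ge0 //; lra.
set k := (size q).-1 in k0 ql *; set l' := (l - k)%N.
apply: (@le_trans _ _ (\sum_(j < k) cn q`_j * polysum q ^+ (l' + k.-1))).
  apply: ler_sum => j _; rewrite cnM ler_wpM2l ?cn_ge0 //.
  apply: le_trans (IH _ _) _; first by rewrite -(subnK ql) -/l' ltn_add2l.
  by rewrite ler_weXn2l // leq_add2l -ltnS prednK.
rewrite -mulr_suml; have -> : (l' + k = (l' + k.-1).+1)%N by rewrite -addnS prednK.
have G0 : 0 <= polysum q by lra.
by rewrite exprS ler_wpM2r ?exprn_ge0 // /polysum -/k lerDr.
Qed.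

Lemma rmodc_geom q : q \is monic -> geom_bounded (rmodc q).
Proof.
move=> mq; exists 1, (polysum q); split=> //; [exact: polysum_ge1|exact: rmodc_bound].
Qed.

Lemma root_polysum q (a : C) : q \is monic -> root q a -> cn a <= polysum q.
Proof.
move=> mq /eqP; have q0 := monic_neq0 mq.
have s0 : size q = (size q).-1.+1 by rewrite prednK // lt0n size_poly_eq0.
rewrite horner_coef s0 big_ord_recr /=.
have -> : q`_(size q).-1 = 1 by apply/eqP; exact: mq.
rewrite mul1r; set k := (size q).-1 => /eqP; rewrite addrC addr_eq0 => /eqP ra.
have G1 := polysum_ge1 q; have [a1|a1] := leP (cn a) 1; first exact: le_trans a1 G1.
have [k0|k0] := posnP k.
  by move: ra; rewrite k0 big_ord0 oppr0 expr0 => /eqP; rewrite oner_eq0.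
have ap : 0 < cn a ^+ k.-1 by rewrite exprn_gt0 //; lra.
rewrite -(@ler_pM2r _ (cn a ^+ k.-1)) //.
have -> : cn a * cn a ^+ k.-1 = cn (a ^+ k) by rewrite -exprS prednK // cnX.
rewrite ra cnN.
apply: le_trans (cn_sum _ _ _) _.
apply: (@le_trans _ _ (\sum_(j < k) cn q`_j * cn a ^+ k.-1)).
  apply: ler_sum => j _; rewrite cnM cnX ler_wpM2l ?cn_ge0 //.
  by rewrite ler_weXn2l ?ltW // -ltnS prednK.
by rewrite -mulr_suml ler_wpM2r ?(ltW ap) // /polysum -/k lerDr.
Qed.

(** Modulo q one has x s = a s, so x^i s reduces to a^i s, and the coefficient of X^(deg q - 1) in s
    is 1. *)
Lemma lam_root q (a : C) s i : q \is monic -> q = ('X - a%:P) * s ->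
  lam (shr (rmodc q) i) (fun x => s.[x]) = a ^+ i.
Proof.
move=> mq qE.
have ms : s \is monic by rewrite -(monicMl _ (monicXsubC a)) -qE.
have sq : size q = (size s).+1.
  by rewrite qE size_monicM ?monicXsubC ?monic_neq0 // size_XsubC.
have s0 : (0 < size s)%N by rewrite lt0n size_poly_eq0 monic_neq0.
have hg j := geom_shr j (rmodc_geom mq).
have ds := entire1_horner s.
elim: i => [|i IH].
  apply: lam_eq => // e e0; exists (size s) => K sK; rewrite expr0.
  suff -> : \sum_(l < K) tcoef (fun x => s.[x]) l * shr (rmodc q) 0 l = 1 by rewrite subrr cn0 ltW.
  have kK : ((size s).-1 < K)%N by apply: leq_trans sK; rewrite prednK.
  rewrite (bigD1 (Ordinal kK)) //= tcoef_horner /shr addn0 rmodc_small sq /= ?prednK // eqxx mulr1.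
  have -> : s`_(size s).-1 = 1 by apply/eqP; exact: ms.
  rewrite big1 ?addr0 // => l; rewrite -val_eqE /= => lk; rewrite tcoef_horner /shr addn0.
  have [ls|sl] := ltnP l (size s); last by rewrite nth_default ?mul0r.
  by rewrite rmodc_small sq //= (negPf lk) mulr0.
have an : annihilates q (shr (rmodc q) i).
  move=> l; rewrite -[RHS](rmodc_annihilates q (l + i)); apply: eq_bigr => j _.
  by rewrite /shr addnAC.
have := lam_annihilate (hg i) (fun x => ex_intro _ _ (cder_cst (1 : C) x)) an.
rewrite (_ : (fun x => _) = fun x => x * s.[x] + - a * s.[x]); last first.
  by apply/funext => x; rewrite qE !hornerE; ring.
rewrite lamD ?lamZ ?IH //; [|exact: entire1_mulX|exact: entire1Z].
rewrite lam_mulX // => /eqP; rewrite mulNr subr_eq0 exprS => /eqP <-.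
by congr lam; apply/funext => l; rewrite /shr -addnA add1n.
Qed.

End RootSums.

(** * Newton's identities and power sums of zeros *)

Section Newton.
Variable R : realType.
Local Notation C := (Cplx R).
Implicit Types (A B s q : {poly C}) (rs : seq C).

Definition pol_of_roots rs : {poly C} := \prod_(a <- rs) ('X - a%:P).
Definition psum rs i : C := \sum_(a <- rs) a ^+ i.

Lemma psum0 rs : psum rs 0 = (size rs)%:R.
Proof. by rewrite /psum; elim: rs => [|a rs IH]; rewrite ?big_nil // big_cons IH expr0 -natr1 addrC. Qed.

Lemma pol_of_roots_monic rs : pol_of_roots rs \is monic.
Proof. by apply: monic_prod => a _; exact: monicXsubC. Qed.
Lemma size_pol_of_roots rs : size (pol_of_roots rs) = (size rs).+1.
Proof. exact: size_prod_XsubC. Qed.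

(** Horner's scheme: the tails of A evaluated at a root a are the coefficients of A / (X - a). For J
    = 0 the tail is A(a) = 0. *)
Lemma tail_horner A s (a : C) J N : A = ('X - a%:P) * s -> (size A <= N)%N ->
  \sum_(i < N) A`_(i + J) * a ^+ i = if J == 0%N then 0 else s`_J.-1.
Proof.
move=> AE AN.
have AJ j : A`_j.+1 = s`_j - a * s`_j.+1.
  by rewrite AE mulrBl coefB coefXM coefCM.
have A0 : A`_0 = - (a * s`_0) by rewrite AE mulrBl coefB coefXM coefCM sub0r.
have sz j : (N <= j)%N -> s`_j = 0.
  move=> Nj; have [->|s0] := eqVneq s 0; first by rewrite coef0.
  apply: nth_default; apply: leq_trans Nj; apply: leq_trans AN.
  by rewrite AE size_monicM ?monicXsubC // size_XsubC.
have rec J' : \sum_(i < N) A`_(i + J') * a ^+ i = A`_J' + a * \sum_(i < N) A`_(i + J'.+1) * a ^+ i.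
  case: N AN sz => [|N] AN sz.
    by rewrite !big_ord0 mulr0 addr0 nth_default //; apply: leq_trans AN _.
  have AN' : A`_(N + J'.+1) = 0 by apply: nth_default; apply: leq_trans AN _; lia.
  rewrite big_ord_recl mulr1 [X in _ = _ + _ * X]big_ord_recr /= AN' mul0r addr0.
  congr (_ + _); rewrite mulr_sumr; apply: eq_bigr => i _.
  by rewrite /= exprS addSnnS; ring.
have T J' : \sum_(i < N) A`_(i + J'.+1) * a ^+ i = s`_J'.
  have [j jE] : exists j, (N <= J' + j)%N by exists N; rewrite leq_addl.
  elim: j J' jE => [|j IH] J' jE.
    rewrite sz ?big1 //; last by rewrite addn0 in jE.
    move=> i _; rewrite nth_default ?mul0r //; apply: leq_trans AN _.
    by move: jE; rewrite addn0 => jE; apply: leq_trans jE _; lia.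
  by rewrite rec IH ?addSnnS // AJ; ring.
case: J => [|J] /=; last exact: T.
by rewrite rec T A0; ring.
Qed.

(** Both sides are the coefficient of X^(J-1) in A', the right one by A' = sum of the A / (X - a)
    and [tail_horner]. All of Newton's identities have this one shape; any N beyond the degree will
    do. *)
Lemma newton rs J N : (size rs < N)%N ->
  J%:R * (pol_of_roots rs)`_J = \sum_(i < N) (pol_of_roots rs)`_(i + J) * psum rs i.
Proof.
move=> sN; set A := pol_of_roots rs.
have AN : (size A <= N)%N by rewrite size_pol_of_roots.
have key rs' B : A = pol_of_roots rs' * B ->
    \sum_(a <- rs') \sum_(i < N) A`_(i + J) * a ^+ i =
    if J == 0%N then 0 else (((pol_of_roots rs')^`() * B)%R)`_J.-1.
  elim: rs' B => [|a rs' IH] B AE.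
    by rewrite big_nil /pol_of_roots big_nil derivC mul0r coef0 if_same.
  rewrite big_cons; move: AE; rewrite /pol_of_roots big_cons -/(pol_of_roots rs').
  set A' := pol_of_roots rs' => AE.
  rewrite (@tail_horner A (A' * B) a) ?mulrA // (IH (('X - a%:P) * B)); last by rewrite -/A' AE; ring.
  case: eqP => _; first by rewrite addr0.
  by rewrite derivM derivXsubC mul1r -coefD -/A'; congr (nth _ (polyseq _) _); ring.
have := key rs 1; rewrite mulr1 => /(_ (erefl _)).
rewrite exchange_big /= => E.
transitivity (\sum_(i < N) \sum_(a <- rs) A`_(i + J) * a ^+ i); last first.
  by apply: eq_bigr => i _; rewrite /psum mulr_sumr.
rewrite E; case: J {key E} => [|J] /=; first by rewrite mul0r.
by rewrite mulr1 coef_deriv mulr_natl.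
Qed.

Lemma lam_psum q rs B i : q \is monic -> q = pol_of_roots rs * B ->
  lam (shr (rmodc q) i) (fun x => ((pol_of_roots rs)^`() * B).[x]) = psum rs i.
Proof.
move=> mq; have hg := geom_shr i (rmodc_geom mq).
elim: rs B => [|a rs IH] B qE.
  rewrite /psum big_nil /pol_of_roots big_nil derivC mul0r.
  apply: lam_eq => //; first exact: entire1_horner.
  by apply: climit_ext (climit_cst 0) => K; rewrite big1 // => l _; rewrite tcoef_horner coef0 mul0r.
move: qE; rewrite /psum big_cons -/(psum rs i) /pol_of_roots big_cons -/(pol_of_roots rs).
set A := pol_of_roots rs => qE.
rewrite -(IH (('X - a%:P) * B)); last by rewrite qE -/A; ring.
rewrite -(@lam_root _ q a (A * B) i mq); last by rewrite mulrA.
rewrite -lamD //; try exact: entire1_horner.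
by congr lam; apply/funext => x; rewrite derivM derivXsubC mul1r -/A !(hornerM, hornerD, hornerXsubC); ring.
Qed.

Lemma entire1_cancel f (a : C) : entire1 f -> (forall x, (x - a) * f x = 0) -> forall x, f x = 0.
Proof.
move=> df H; apply: (@entire1_identity R f (a + 1) 1) => // x xa.
have := H x => /eqP; rewrite mulf_eq0 => /orP[/eqP h|/eqP //].
move: xa; have -> : x - (a + 1) = - 1 by rewrite opprD addrA h sub0r.
by rewrite cnN cn1 ltxx.
Qed.

Lemma entire1B (f h : C -> C) : entire1 f -> entire1 h -> entire1 (fun x => f x - h x).
Proof. by move=> df dh x; eexists; apply: cderB (derP x df) (derP x dh). Qed.

Lemma entire1_factor_root (f : C -> C) (a : C) : entire1 f -> f a = 0 ->
  exists2 g, entire1 g & forall x, f x = (x - a) * g x.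
Proof.
move=> df fa; have dg := dquot_entire1 (entire1_shift a df).
exists (fun x => dquot (fun y => f (a + y)) (x - a)).
  by apply: entire1_ext (entire1_shift (- a) dg) => x; rewrite addrC.
move=> x; have := dquotE (fun y => f (a + y)) (x - a).
by rewrite addr0 fa add0r [a + _]addrC subrK.
Qed.

(** Each root of q is a zero of U or of V, and is divided off from one that it annihilates. The
    remaining cofactors E and E' have the constant product tau. *)
Lemma poly_factorization q (tau : C) (U V : C -> C) : q \is monic -> entire1 U -> entire1 V ->
  (forall x, U x * V x = tau * q.[x]) ->
  exists ra rb E E', [/\ entire1 E, entire1 E', q = pol_of_roots ra * pol_of_roots rb &
    [/\ forall x, U x = (pol_of_roots ra).[x] * E x, forall x, V x = (pol_of_roots rb).[x] * E' x &
     forall x, E x * E' x = tau]].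
Proof.
move: {2}(size q) (erefl (size q)) => N; elim: N q U V => [|N IH] q U V sN mq dU dV H.
  by move/eqP: sN; rewrite size_poly_eq0 => /eqP q0; rewrite q0 monicE lead_coef0 eq_sym oner_eq0 in mq.
have [s1|s1] := eqVneq (size q) 1%N.
  have q1 : q = 1.
    have /size1_polyC qE : (size q <= 1)%N by rewrite s1.
    by move: mq; rewrite qE monicE lead_coefC => /eqP ->.
  exists [::], [::], U, V; rewrite /pol_of_roots big_nil mul1r; split=> //; split=> x.
  - by rewrite hornerC mul1r.
  - by rewrite hornerC mul1r.
  by rewrite H q1 hornerC mulr1.
have /closed_rootP[a ra] := s1.
have /factor_theorem[s qE] := ra; rewrite mulrC in qE.
have ms : s \is monic by rewrite -(monicMl _ (monicXsubC a)) -qE.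
have sN' : size s = N.
  by move: sN; rewrite qE size_monicM ?monicXsubC ?monic_neq0 // size_XsubC => -[].
have : U a * V a = 0 by rewrite H (rootP ra) mulr0.
have cut (f g : C -> C) : entire1 f -> entire1 g -> (forall x, (x - a) * f x * g x = tau * q.[x]) ->
    forall x, f x * g x = tau * s.[x].
  move=> df dg h x; apply/eqP; rewrite -subr_eq0; apply/eqP.
  apply: (@entire1_cancel (fun x => f x * g x - tau * s.[x]) a) => [|y].
    by apply: entire1B; [exact: entire1M|apply: entire1Z; exact: entire1_horner].
  by rewrite mulrBr mulrA h qE hornerM hornerXsubC; ring.
move/eqP; rewrite mulf_eq0 => /orP[/eqP Ua|/eqP Va].
  have [U1 dU1 UE] := entire1_factor_root dU Ua.
  have [|ra' [rb [E [E' [dE dE' sE [hU hV hE]]]]]] := IH s U1 V sN' ms dU1 dV.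
    by apply: cut => // x; rewrite -UE H.
  exists (a :: ra'), rb, E, E'; split=> //.
    by rewrite qE sE /pol_of_roots big_cons mulrA.
  by split=> // x; rewrite UE hU /pol_of_roots big_cons hornerM hornerXsubC mulrA.
have [V1 dV1 VE] := entire1_factor_root dV Va.
have [|ra' [rb [E [E' [dE dE' sE [hU hV hE]]]]]] := IH s U V1 sN' ms dU dV1.
  by move=> x; rewrite mulrC; apply: cut => // y; rewrite -VE mulrC H.
exists ra', (a :: rb), E, E'; split=> //.
  by rewrite qE sE /pol_of_roots big_cons mulrCA.
by split=> // x; rewrite VE hV /pol_of_roots big_cons hornerM hornerXsubC mulrA.
Qed.

(** The argument principle: U' / U = V U' / (tau q), so the sum of a^i over the zeros counted for U
    is the residue functional of q applied to x^i V U' / tau. This expression does not mention the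
    zeros. *)
Lemma poly_factorization_psum q (tau : C) (U V E E' : C -> C) ra rb i : q \is monic ->
  entire1 E -> entire1 E' -> q = pol_of_roots ra * pol_of_roots rb ->
  (forall x, U x = (pol_of_roots ra).[x] * E x) -> (forall x, V x = (pol_of_roots rb).[x] * E' x) ->
  (forall x, E x * E' x = tau) ->
  lam (shr (rmodc q) i) (fun x => V x * der U x) = tau * psum ra i.
Proof.
move=> mq dE dE' qE hU hV hE; set A := pol_of_roots ra in qE hU *; set B := pol_of_roots rb in qE hV *.
have hg := geom_shr i (rmodc_geom mq).
have dA : forall x, cder (fun x => A.[x]) x (A^`()).[x].
  move=> x; elim/poly_ind: (A) => [|s c IH].
    by rewrite deriv0 horner0; apply: cder_ext (cder_cst 0 x) => y; rewrite horner0.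
  have := cderD (cderM IH (cder_id x)) (cder_cst c x); rewrite mulr1 addr0.
  rewrite derivD derivM derivX derivC addr0 mulr1 hornerD hornerM hornerX => h.
  by apply: cder_ext h => y; rewrite hornerD hornerM hornerX hornerC.
have dU x : der U x = (A^`()).[x] * E x + A.[x] * der E x.
  by apply: derE; apply: cder_ext (cderM (dA x) (derP x dE)) => y; rewrite hU.
rewrite (_ : (fun x => V x * der U x) = fun x => tau * (A^`() * B).[x] + q.[x] * (E' x * der E x)); last first.
  by apply/funext => x; rewrite dU hV qE !hornerM -(hE x); ring.
have dEE : entire1 (fun x => E' x * der E x) by apply: entire1M => //; exact: entire1_der.
rewrite lamD //; [|apply: entire1Z; exact: entire1_horner|apply: entire1M => //; exact: entire1_horner].
rewrite lamZ //; last exact: entire1_horner.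
rewrite lam_psum // lam_annihilate ?addr0 // => l.
rewrite -[RHS](rmodc_annihilates q (l + i)); apply: eq_bigr => j _.
by rewrite /shr addnAC.
Qed.

End Newton.

(** * Entire factors of an irreducible polynomial *)

Section Factor.
Variables (R : realType) (n : nat).
Local Notation C := (Cplx R).
Local Notation Cn := 'rV[C]_n.
Local Notation mp := (mpoly n C).

(** The list [ra z] may depend on z in an arbitrary way; [Hlam] makes its power sums holomorphic, as
    limits of finite sums of holomorphic terms. The explicit bound [polysum] for the roots gives
    polynomial growth. *)
Lemma zero_free_factor_aux (p : mp) (b : Cn) (tau : C) (P : {poly mp}) (u v : Cn -> C) :
  tau != 0 -> line_rep b (msize p).-1 p tau P -> hol u -> hol v ->
  (forall z, u z * v z = peval p z) ->
  forall ra : Cn -> seq C,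
  (forall (z : Cn) i, lam (shr (rmodc (tau^-1 *: map_poly (meval (z ord0)) P)) i)
     (fun x : C => v (z + x *: b) * dd b u (z + x *: b)) = tau * psum (ra z) i) ->
  (forall (z : Cn) a, a \in ra z -> root (tau^-1 *: map_poly (meval (z ord0)) P) a) ->
  (forall z, (size (ra z) <= (msize p).-1)%N) ->
  forall j, is_poly (fun z => (pol_of_roots (ra z))`_j).
Proof.
move=> t0 [sP cP eP] hu hv huv ra Hlam Hroot Hsize.
set k := (msize p).-1 in sP cP Hsize.
pose q (z : Cn) : {poly C} := tau^-1 *: map_poly (meval (z ord0)) P.
have qc z j : (q z)`_j = tau^-1 * peval P`_j z.
  by rewrite /q coefZ coef_map_id0 ?meval0.
have sq z : size (q z) = k.+1.
  apply/eqP; rewrite eqn_leq; apply/andP; split.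
    by apply: leq_trans (size_scale_leq _ _) _; apply: leq_trans (size_poly _ _) _.
  rewrite ltnNge; apply/negP => h; have : (q z)`_k = 0 by apply: nth_default.
  by rewrite qc cP pevalC mulVf // => /eqP; rewrite oner_eq0.
have mq z : q z \is monic.
  by rewrite monicE /lead_coef sq /= qc cP pevalC mulVf.
have hq j : hol (fun z => (q z)`_j).
  by apply: (@hol_ext _ _ (fun z => tau^-1 * peval P`_j z)) => [z|]; [rewrite qc|apply: holZ; apply: peval_is_hol].
have pq j : pgrow (fun z => (q z)`_j).
  apply: (@pgrow_dom _ _ _ (fun z => tau^-1 * peval P`_j z)) => [|z]; last by rewrite qc.
  by apply: pgrowM; [exact: pgrow_cst|exact: pgrow_peval].
have hr l : hol (fun z => rmodc (q z) l).
  elim/ltn_ind: l => l IH; have [lk|kl] := ltnP l k.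
    apply: (@hol_ext _ _ (fun=> (l == k.-1)%:R)) => [z|]; last exact: hol_cst.
    by rewrite rmodc_small sq.
  apply: (@hol_ext _ _ (fun z => - \sum_(j < k) (q z)`_j * rmodc (q z) (l - k + j))) => [z|].
    by have := rmodc_rec (l - k) (mq z); rewrite sq /= subnK.
  apply: holN; apply: hol_sum => j _; apply: holM => //; apply: IH.
  by rewrite -{2}(subnK kl) ltn_add2l.
have psE z : polysum (q z) = 1 + \sum_(j < k) cn (q z)`_j by rewrite /polysum sq.
have psb r : exists2 G : R, 1 <= G & forall z, pdisc r z -> polysum (q z) <= G.
  have /choice[M HM] : forall j, exists M, forall z, pdisc r z -> cn (q z)`_j <= M.
    by move=> j; exact: (hq j).2.
  exists (1 + \sum_(j < k) `|M j|); first by rewrite lerDl sumr_ge0.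
  move=> z hz; rewrite psE lerD2l; apply: ler_sum => j _.
  by apply: le_trans (HM j z hz) (ler_norm _).
pose W z := v z * dd b u z.
have hW : hol W by apply: holM => //; exact: hol_dd.
have hS i : hol (fun z => psum (ra z) i).
  suff h : hol (fun z => lam (shr (rmodc (q z)) i) (fun x : C => W (z + x *: b))).
    by apply: hol_ext (holZ tau^-1 h) => z; rewrite Hlam mulrA mulVf // mul1r.
  have dW z : entire1 (fun x : C => W (z + x *: b)) := hW.1 z b.
  have [t tpos ht] := pdisc_ex b.
  apply: (@hol_limit _ _ (fun K z => \sum_(l < K) tcoef (fun x : C => W (z + x *: b)) l * shr (rmodc (q z)) i l)).
  - move=> K; apply: hol_sum => l _; apply: holM; last exact: hr.
    apply: (@hol_tcoef _ _ (fun x z => W (z + x *: b))) => [x|//|r s]; first exact: hol_shift.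
    have [M HM] := hW.2 (r + s * t); exists M => x z hx hz; apply: HM.
    by apply: pdiscD => //; apply: pdiscZ.
  - move=> r; have [G G1 HG] := psb r; have [M HM] := hW.2 (r + 8 * G * t).
    have bd z : pdisc r z -> forall l, cn (tcoef (fun x : C => W (z + x *: b)) l * shr (rmodc (q z)) i l)
        <= M * G ^+ i / 2 ^+ l.
      move=> hz; apply: (lam_partial G1 _ _ (dW z)).
      + by rewrite exprn_ge0 //; lra.
      + move=> l; apply: le_trans (rmodc_bound (mq z) _) _; rewrite mul1r -exprD addnC.
        have := polysum_ge1 (q z) => h1; apply: lerXn2r; rewrite ?nnegrE; [lra|lra|exact: HG].
      by move=> x hx; apply: HM; apply: pdiscD => //; apply: pdiscZ.
    exists (2 * (M * G ^+ i)) => K z hz.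
    have MG : 0 <= M * G ^+ i.
      by have := le_trans (cn_ge0 _) (bd z hz 0%N); rewrite divr1.
    suff h : cn (\sum_(l < K) tcoef (fun x : C => W (z + x *: b)) l * shr (rmodc (q z)) i l) <=
        2 * (M * G ^+ i) - 2 * (M * G ^+ i) / 2 ^+ K.
      by apply: le_trans h _; rewrite gerBl; apply: divr_ge0; [apply: mulr_ge0|apply: exprn_ge0].
    elim: K => [|K IH]; first by rewrite big_ord0 cn0 divr1 subrr.
    rewrite big_ord_recr /=; apply: le_trans (cnD _ _) _; apply: le_trans (lerD IH (bd z hz K)) _.
    have n2 : (2 ^+ K : R) != 0 by rewrite gt_eqF ?exp2_gt0.
    by rewrite [2 ^+ K.+1]exprS; apply: le_of_eq; field.
  move=> z; apply: lamP => //; apply: geom_shr; exact: rmodc_geom.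
have bS i z : cn (psum (ra z) i) <= k%:R * polysum (q z) ^+ i.
  have G1 := polysum_ge1 (q z).
  apply: le_trans (cn_sum _ _ _) _; apply: (@le_trans _ _ (\sum_(a <- ra z) polysum (q z) ^+ i)).
    rewrite big_seq [leRHS]big_seq; apply: ler_sum => a /Hroot ha; rewrite cnX.
    apply: lerXn2r; rewrite ?nnegrE ?cn_ge0 //; first lra.
    exact: root_polysum.
  rewrite big_const_seq count_predT iter_addr addr0 -[_ *+ size _]mulr_natl ler_wpM2r //.
    by rewrite exprn_ge0 //; lra.
  by rewrite ler_nat.
have pS i : is_poly (fun z => psum (ra z) i).
  apply: pgrow_poly => //.
  have pp : pgrow (fun z => rc (polysum (q z))).
    apply: (@pgrow_dom _ _ _ (fun z => 1 + \sum_(j < k) rc (cn (q z)`_j))) => [|z].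
      by apply: pgrowD; [exact: pgrow_cst|apply: pgrow_sum => j _; exact: pgrow_rc].
    rewrite psE rcD rc1; apply: le_of_eq; congr (cn (_ + _)); exact: (rmorph_sum (real_complex R)).
  apply: (@pgrow_dom _ _ _ (fun z => k%:R * rc (polysum (q z)) ^+ i)) => [|z].
    by apply: pgrowM; [exact: pgrow_cst|exact: pgrowX].
  rewrite cnM cn_nat cnX cn_rc ger0_norm ?bS //; have := polysum_ge1 (q z); lra.
(* The number of zeros is the power sum of exponent 0: entire and bounded, hence constant by
   Liouville's theorem. *)
pose m := size (ra 0).
have mE z : size (ra z) = m.
  have h0 w : cn (psum (ra w) 0) <= k%:R by rewrite psum0 cn_nat ler_nat.
  have := hol_bounded_cst (hS 0%N) h0 z.
  by rewrite !psum0 => /eqP; rewrite eqr_nat => /eqP.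
move=> j; have [d] := ubnP (m - j); elim: d j => // d IH j jd.
have [jm|mj] := ltnP m j.
  apply: (@is_poly_ext _ _ (fun=> 0)) => [z|]; last exact: is_poly_cst.
  by rewrite nth_default // size_pol_of_roots mE.
move: mj; rewrite leq_eqVlt => /predU1P[->|jm].
  apply: (@is_poly_ext _ _ (fun=> 1)) => [z|]; last exact: is_poly_cst.
  have /eqP := pol_of_roots_monic (ra z); rewrite /lead_coef size_pol_of_roots mE /= => ->; by [].
(* The term i = 0 of Newton's identity is m times the coefficient of index j. Moved to the left it
   leaves the factor j - m, and the other terms involve higher coefficients only. *)
have nz : (j%:R - m%:R : C) != 0 by rewrite subr_eq0 eqr_nat ltn_eqF.
apply: (@is_poly_ext _ _ (fun z => (j%:R - m%:R)^-1 * \sum_(i < m) (pol_of_roots (ra z))`_(i.+1 + j) * psum (ra z) i.+1)) => [z|].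
  apply: (mulfI nz); rewrite mulrA mulfV // mul1r mulrBl.
  have := @newton _ (ra z) j m.+1; rewrite mE ltnSn => /(_ isT) ->.
  rewrite big_ord_recl /= add0n psum0 mE.
  by rewrite [_ * m%:R]mulrC [X in X - _]addrC addrK.
apply: is_polyM; first exact: is_poly_cst.
apply: is_poly_sum => i _; apply: is_polyM => //; apply: IH; lia.
Qed.

(** Constant coefficients suffice: at x = 0 the factorizations on the lines give p = tau A B, where
    A and B are the constant coefficients of the root polynomials belonging to u and v. A zero of u
    is a zero of A; if A is constant, it is not 0 because p is not, so u has no zeros. The same
    holds for v and B. *)
Lemma zero_free_factor (p : mp) (u v : Cn -> C) : p != 0 -> irreducible_mpoly p -> hol u -> hol v ->
  (forall z, u z * v z = peval p z) -> (forall z, u z != 0) \/ (forall z, v z != 0).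
Proof.
move=> p0 irr hu hv huv.
have [b [tau [P [t0 HP]]]] := monic_direction p0.
have [sP cP eP] := HP; set k := (msize p).-1 in sP cP.
pose q (z : Cn) : {poly C} := tau^-1 *: map_poly (meval (z ord0)) P.
have sq z : size (q z) = k.+1.
  apply/eqP; rewrite eqn_leq; apply/andP; split.
    by apply: leq_trans (size_scale_leq _ _) _; apply: leq_trans (size_poly _ _) _.
  rewrite ltnNge; apply/negP => h; have : (q z)`_k = 0 by apply: nth_default.
  by rewrite /q coefZ coef_map_id0 ?meval0 // cP mevalC mulVf // => /eqP; rewrite oner_eq0.
have mq z : q z \is monic.
  by rewrite monicE /lead_coef sq /= /q coefZ coef_map_id0 ?meval0 // cP mevalC mulVf.
have qE z (x : C) : peval p (z + x *: b) = tau * (q z).[x] by rewrite eP hornerZ mulrA divff ?mul1r.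
have /choice[F HF] : forall z, exists F : (seq C * seq C) * ((C -> C) * (C -> C)),
    [/\ entire1 F.2.1, entire1 F.2.2, q z = pol_of_roots F.1.1 * pol_of_roots F.1.2 &
    [/\ forall x : C, u (z + x *: b) = (pol_of_roots F.1.1).[x] * F.2.1 x,
        forall x : C, v (z + x *: b) = (pol_of_roots F.1.2).[x] * F.2.2 x &
        forall x, F.2.1 x * F.2.2 x = tau]].
  move=> z; have [|ra [rb [E [E' H]]]] := poly_factorization (mq z) (hu.1 z b) (hv.1 z b) (tau := tau).
    by move=> x; rewrite huv qE.
  by exists ((ra, rb), (E, E')).
pose ra z := (F z).1.1; pose rb z := (F z).1.2.
have derl (f : Cn -> C) z : hol f -> (fun x : C => der (fun x : C => f (z + x *: b)) x) = (fun x : C => dd b f (z + x *: b)).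
  by move=> hf; apply/funext => x; apply: derE; apply: ddP.
have rtq z a : a \in ra z \/ a \in rb z -> root (q z) a.
  have [_ _ -> _] := HF z; rewrite rootM !root_prod_XsubC -/(ra z) -/(rb z).
  by case=> ->; rewrite ?orbT.
have sz z : (size (ra z) + size (rb z) = k)%N.
  have [_ _ qz _] := HF z; have := sq z.
  rewrite qz size_monicM ?pol_of_roots_monic ?monic_neq0 ?pol_of_roots_monic //.
  by rewrite !size_pol_of_roots -/(ra z) -/(rb z); lia.
have pa : is_poly (fun z => (pol_of_roots (ra z))`_0).
  apply: (zero_free_factor_aux t0 HP hu hv huv) => [z i|z a ha|z].
  - have [dE dE' qz [h1 h2 h3]] := HF z.
    rewrite -(poly_factorization_psum i (mq z) dE dE' qz h1 h2 h3).
    apply: (f_equal (lam _)); apply/funext => x.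
    exact: (congr1 (fun g : C -> C => v (z + x *: b) * g x) (esym (derl u z hu))).
  - by apply: rtq; left.
  by rewrite -/k -(sz z) leq_addr.
have pb : is_poly (fun z => (pol_of_roots (rb z))`_0).
  have hvu z : v z * u z = peval p z by rewrite mulrC.
  apply: (zero_free_factor_aux t0 HP hv hu hvu) => [z i|z a ha|z].
  - have [dE dE' qz [h1 h2 h3]] := HF z.
    have qz' : q z = pol_of_roots (F z).1.2 * pol_of_roots (F z).1.1 by rewrite mulrC.
    have h3' x : (F z).2.2 x * (F z).2.1 x = tau by rewrite mulrC.
    rewrite -(poly_factorization_psum i (mq z) dE' dE qz' h2 h1 h3').
    apply: (f_equal (lam _)); apply/funext => x.
    exact: (congr1 (fun g : C -> C => u (z + x *: b) * g x) (esym (derl v z hv))).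
  - by apply: rtq; right.
  by rewrite -/k -(sz z) leq_addl.
have [A hA] := pa; have [B hB] := pb.
have pE : p = (tau *: A) * B.
  apply: peval_inj => z; rewrite pevalM pevalZ -hA -hB; have [_ _ qz _] := HF z.
  have := qE z 0; rewrite scale0r addr0 => ->; rewrite qz hornerM !horner_coef0 mulrA //.
have u0 z : u z = 0 -> peval A z = 0.
  move=> uz; have [_ _ _ [h1 _ h3]] := HF z; have := h1 0; rewrite scale0r addr0 uz -hA horner_coef0.
  move/esym/eqP; rewrite mulf_eq0 => /orP[/eqP//|/eqP E0].
  by move: (h3 0) t0; rewrite E0 mul0r => <-; rewrite eqxx.
have v0 z : v z = 0 -> peval B z = 0.
  move=> vz; have [_ _ _ [_ h2 h3]] := HF z; have := h2 0; rewrite scale0r addr0 vz -hB horner_coef0.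
  move/esym/eqP; rewrite mulf_eq0 => /orP[/eqP//|/eqP E0].
  by move: (h3 0) t0; rewrite E0 mulr0 => <-; rewrite eqxx.
case: (irr _ _ pE) => -[c cE].
  left => z; apply/eqP => /u0 Az.
  have c0 : c = 0 by rewrite -(pevalC (n := n) c z) -cE pevalZ Az mulr0.
  by move: p0; rewrite pE cE c0 mpolyC0 mul0r eqxx.
right => z; apply/eqP => /v0 Bz.
have c0 : c = 0 by rewrite -(pevalC (n := n) c z) -cE.
by move: p0; rewrite pE cE c0 mpolyC0 mulr0 eqxx.
Qed.

End Factor.

(** * Growth with respect to an entire function *)

Section Growth.
Variables (R : realType) (n : nat).
Local Notation C := (Cplx R).
Local Notation Cn := 'rV[C]_n.
Implicit Types (f g h : Cn -> C) (a z b : Cn) (r : R).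

(** The maximum modulus on the polydisc about a, raised by 1 so that its logarithm is
    nonnegative. *)
Definition mu (phi : Cn -> C) a r : R := 1 + sup [set cn (phi z) | z in [set z | pdisc r (z - a)]].

Lemma mu_has_sup phi a r : hol phi -> 0 <= r ->
  has_sup [set cn (phi z) | z in [set z | pdisc r (z - a)]].
Proof.
move=> hf r0; split; first by exists (cn (phi a)), a => //=; rewrite subrr; exact: pdisc0.
have [M HM] := (hol_shift a hf).2 r; exists M => _ [z /= hz <-].
by have := HM _ hz; rewrite subrK.
Qed.

Lemma le_mu phi a r z : hol phi -> 0 <= r -> pdisc r (z - a) -> cn (phi z) <= mu phi a r.
Proof.
move=> hf r0 hz; apply: (@le_trans _ _ (mu phi a r - 1)); last by rewrite gerBl.
rewrite /mu addrC addKr; apply: ub_le_sup; last by exists z.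
exact: (mu_has_sup a hf r0).2.
Qed.

Lemma mu_le phi a r K : hol phi -> 0 <= r -> (forall z, pdisc r (z - a) -> cn (phi z) <= K) ->
  mu phi a r <= 1 + K.
Proof.
move=> hf r0 H; rewrite lerD2l; apply: ge_sup; first exact: (mu_has_sup a hf r0).1.
by move=> _ [z /= hz <-]; exact: H.
Qed.

Lemma mu_mono phi a r s : hol phi -> 0 <= r -> r <= s -> mu phi a r <= mu phi a s.
Proof.
move=> hf r0 rs; rewrite -[leRHS](subrK 1) addrC; apply: mu_le => // z hz.
rewrite /mu [1 + _]addrC addrK; apply: ub_le_sup; first exact: (mu_has_sup a hf (le_trans r0 rs)).2.
by exists z => //=; apply: pdisc_le hz.
Qed.

Lemma mu_ge1 phi a r : hol phi -> 0 <= r -> 1 <= mu phi a r.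
Proof.
move=> hf r0; rewrite lerDl; apply: (@le_trans _ _ (cn (phi a))); first exact: cn_ge0.
apply: ub_le_sup; first exact: (mu_has_sup a hf r0).2.
by exists a => //=; rewrite subrr; exact: pdisc0.
Qed.

(* The coefficients occurring below are polynomial in phi, psi and their derivatives, hence grow at
   most like a power of the maximum of phi on a slightly larger polydisc, while the exponentials grow
   exponentially in it. *)
Definition beta phi a r d := r * mu phi a (r + d) / d.
Definition small phi a h := hol h /\ exists K N, forall r d, 1 <= r -> 0 < d -> d <= 1 ->
  forall z, pdisc r (z - a) -> cn (h z) <= K * beta phi a r d ^+ N.

Section Small.
Variables (phi : Cn -> C) (a : Cn).
Hypothesis hphi : hol phi.

Lemma beta_ge r d : 1 <= r -> 0 < d -> d <= 1 ->
  [/\ 1 <= beta phi a r d, r <= beta phi a r d, mu phi a (r + d) <= beta phi a r d,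
     r / d <= beta phi a r d & d^-1 <= beta phi a r d].
Proof.
move=> r1 d0 d1; rewrite /beta; have m1 : 1 <= mu phi a (r + d) by apply: mu_ge1 => //; lra.
have v1 : 1 <= d^-1 by rewrite -[1]invr1 lef_pV2 ?posrE.
move: (mu _ _ _) (d^-1) m1 v1 => m v m1 v1.
have rm : r * 1 <= r * m by rewrite ler_wpM2l //; lra.
have mr : 1 * m <= r * m by rewrite ler_wpM2r //; lra.
have rmv : r * m * 1 <= r * m * v by rewrite ler_wpM2l //; lra.
have rv : r * v <= r * m * v by rewrite ler_wpM2r //; lra.
have vv : 1 * v <= r * m * v by rewrite ler_wpM2r //; lra.
by split; lra.
Qed.

Lemma small_pos h : small phi a h -> exists2 K, 0 <= K & exists N, forall r d, 1 <= r -> 0 < d -> d <= 1 ->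
  forall z, pdisc r (z - a) -> cn (h z) <= K * beta phi a r d ^+ N.
Proof.
move=> [_ [K [N H]]]; exists K; last by exists N.
have [b1 _ _ _ _] := beta_ge (lexx 1) ltr01 (lexx 1).
have := H 1 1 (lexx 1) ltr01 (lexx 1) a; rewrite subrr => /(_ (@pdisc0 R n 1 ler01)) h1.
have := le_trans (cn_ge0 _) h1; rewrite pmulr_lge0 // exprn_gt0 //; lra.
Qed.

Lemma small_weaken h K N N' : hol h -> 0 <= K -> (N <= N')%N -> (forall r d, 1 <= r -> 0 < d -> d <= 1 ->
  forall z, pdisc r (z - a) -> cn (h z) <= K * beta phi a r d ^+ N) ->
  forall r d, 1 <= r -> 0 < d -> d <= 1 ->
  forall z, pdisc r (z - a) -> cn (h z) <= K * beta phi a r d ^+ N'.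
Proof.
move=> hh K0 NN H r d r1 d0 d1 z hz; apply: le_trans (H r d r1 d0 d1 z hz) _.
by have [b1 _ _ _ _] := beta_ge r1 d0 d1; rewrite ler_wpM2l // ler_weXn2l.
Qed.

Lemma smallD h g : small phi a h -> small phi a g -> small phi a (fun z => h z + g z).
Proof.
move=> sh sg; have [hh _] := sh; have [hg _] := sg; split; first exact: holD.
have [K K0 [N H]] := small_pos sh; have [K' K'0 [N' H']] := small_pos sg.
exists (K + K'), (N + N')%N => r d r1 d0 d1 z hz; apply: le_trans (cnD _ _) _; rewrite mulrDl.
apply: lerD.
  exact: (small_weaken hh K0 (leq_addr N' N) H).
exact: (small_weaken hg K'0 (leq_addl N N') H').
Qed.

Lemma smallM h g : small phi a h -> small phi a g -> small phi a (fun z => h z * g z).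
Proof.
move=> sh sg; have [hh _] := sh; have [hg _] := sg; split; first exact: holM.
have [K K0 [N H]] := small_pos sh; have [K' K'0 [N' H']] := small_pos sg.
exists (K * K'), (N + N')%N => r d r1 d0 d1 z hz.
by rewrite cnM exprD mulrACA ler_pM ?cn_ge0 ?H ?H'.
Qed.

Lemma small_poly h : is_poly h -> small phi a h.
Proof.
move=> ph; have hh := is_poly_hol ph; split=> //.
have [K K0 [d H]] := pgrow_pos (pgrow_is_poly ph); have [s s0 hs] := pdisc_ex a.
exists (K * (1 + s) ^+ d), d => r e r1 e0 e1 z hz.
have hz' : pdisc (r + s) z by rewrite -(subrK a z); apply: pdiscD.
apply: le_trans (H (r + s) _ _ hz') _; first lra.
have [_ br _ _ _] := beta_ge r1 e0 e1.
rewrite -mulrA -exprMn ler_wpM2l //; apply: lerXn2r; rewrite ?nnegrE; nra.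
Qed.

Lemma small_cst c : small phi a (fun=> c).
Proof. by apply: small_poly; exact: is_poly_cst. Qed.
Lemma smallZ c h : small phi a h -> small phi a (fun z => c * h z).
Proof. by apply: smallM; exact: small_cst. Qed.
Lemma small_ext h g : (forall z, h z = g z) -> small phi a h -> small phi a g.
Proof. by move=> /funext ->. Qed.
Lemma smallN h : small phi a h -> small phi a (fun z => - h z).
Proof. by move=> /(smallZ (-1)); apply: small_ext => z; rewrite mulN1r. Qed.
Lemma smallB h g : small phi a h -> small phi a g -> small phi a (fun z => h z - g z).
Proof. by move=> sh /smallN; apply: smallD. Qed.

Lemma small_self : small phi a phi.
Proof.
split=> //; exists 1, 1%N => r d r1 d0 d1 z hz; rewrite mul1r expr1.
have [_ _ bm _ _] := beta_ge r1 d0 d1; apply: le_trans bm.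
by apply: le_mu => //; [lra|apply: pdisc_le hz; lra].
Qed.

Lemma beta_half r d : 1 <= r -> 0 < d -> d <= 1 ->
  beta phi a (r + d / 2) (d / 2) <= 4 * beta phi a r d.
Proof.
move=> r1 d0 d1; rewrite /beta -addrA -splitr.
have m1 : 1 <= mu phi a (r + d) by apply: mu_ge1 => //; lra.
have -> : (r + d / 2) * mu phi a (r + d) / (d / 2) = (2 * r + d) * mu phi a (r + d) / d.
  by field; rewrite gt_eqF.
rewrite !mulrA ler_wpM2r ?invr_ge0 ?(ltW d0) // ler_wpM2r //; lra.
Qed.

(** Half of the margin d pays for Cauchy's estimate, the other half for the bound on h; [beta] grows
    by a constant factor only when its margin is halved. *)
Lemma small_dd j h : small phi a h -> small phi a (dd (ej R j) h).
Proof.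
move=> sh; have [hh _] := sh; split; first exact: hol_dd.
have [K K0 [N H]] := small_pos sh.
exists (K * 4 ^+ N * 4), N.+1 => r d r1 d0 d1 z hz.
have d2 : 0 < d / 2 by rewrite divr_gt0.
have [b1 _ _ _ bv] := beta_ge r1 d0 d1.
have b0 : 0 <= beta phi a r d by lra.
have -> : dd (ej R j) h z = dd (ej R j) (fun w => h (w + a)) (z - a) by rewrite dd_shift subrK.
apply: le_trans (dd_bound d2 (hol_shift a hh) (M := K * (4 * beta phi a r d) ^+ N) _ hz (ej_pdisc R j)) _.
  move=> w hw; apply: le_trans (H (r + d / 2) (d / 2) _ d2 _ _ _) _; [lra|lra|by rewrite addrK|].
  rewrite ler_wpM2l //; apply: lerXn2r; rewrite ?nnegrE; last exact: beta_half.
    by have [h1 _ _ _ _] := @beta_ge (r + d / 2) (d / 2) ltac:(lra) d2 ltac:(lra); lra.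
  by rewrite mulr_ge0.
have -> : 2 * (K * (4 * beta phi a r d) ^+ N) / (d / 2) = K * 4 ^+ N * 4 * beta phi a r d ^+ N * d^-1.
  by rewrite exprMn; field; rewrite gt_eqF.
by rewrite exprSr mulrA ler_wpM2l // !mulr_ge0 ?exprn_ge0.
Qed.

End Small.

Lemma jensen_schwarz_pdisc psi B a (rho r S : R) : hol psi -> hol B -> B a != 0 -> 0 < rho -> rho < r ->
  (forall z, pdisc r (z - a) -> cn (B z) * expR (Num.max (re (psi z)) 0) <= expR S) ->
  forall z, pdisc rho (z - a) ->
  cn (psi z - psi a) <= (4 * (S - ln (cn (B a) / 2)) + 2 * cn (psi a)) * (rho / (r - rho)).
Proof.
move=> hp hB Ba rho0 rr H z hz.
have rn : rc rho != 0 by rewrite -cn_eq0 cn_rc normr_eq0 gt_eqF.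
have cr : cn (rc rho) = rho by rewrite cn_rc gtr0_norm.
pose b := (rc rho)^-1 *: (z - a).
have hb : pdisc 1 b.
  by rewrite -(mulVf (lt0r_neq0 rho0)); apply: pdiscZ hz _; rewrite cnV cr.
have zE : z = a + rc rho *: b by rewrite scalerA divff // scale1r addrC subrK.
have := @jensen_schwarz_bound R (fun x => psi (a + x *: b)) (fun x => B (a + x *: b)) r S (rc rho)
  (hp.1 a b) (hB.1 a b) (lt_trans rho0 rr).
rewrite scale0r addr0 cr -zE; apply=> // x xr; apply: H.
by rewrite addrAC subrr add0r -[r]mulr1; apply: pdiscZ => //; rewrite xr.
Qed.

Lemma ln_le (x : R) : 0 < x -> ln x <= x.
Proof. by move=> x0; have := expR_ge1Dx (ln x); rewrite lnK ?posrE //; lra. Qed.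

(* Borel's growth lemma. *)
Lemma growth_lemma (la : R -> R) : (forall r s, 1 <= r -> r <= s -> la r <= la s) ->
  (forall r, 1 <= r -> 0 <= la r) ->
  forall r0, 1 <= r0 -> exists2 r, r0 <= r & la (r + expR (- la r / 4)) <= la r + 1.
Proof.
move=> mono pos r0 r01; apply: contrapT => nex.
have step r : r0 <= r -> la r + 1 < la (r + expR (- la r / 4)).
  by move=> h; rewrite ltNge; apply/negP => h'; apply: nex; exists r.
(* If the claim failed throughout, la would gain more than 1 at every step. The k-th increment is
   then at most q^k, so the points stay below r0 + Q although la is at least k at the k-th. *)
pose u := fix u k := if k is k'.+1 then u k' + expR (- la (u k') / 4) else r0.
pose q := expR (- 1 / 4 : R); have q0 : 0 < q by exact: expR_gt0.
have q1 : q < 1 by rewrite -expR0 ltr_expR; lra.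
pose Q := (1 - q)^-1; have Q0 : 0 < Q by rewrite invr_gt0; lra.
have inv k : [/\ r0 <= u k, k%:R <= la (u k) & u k <= r0 + Q - Q * q ^+ k].
  elim: k => [|k [h1 h2 h3]]; first by split=> //=; [exact: pos|rewrite mulr1 addrK].
  have e0 := expR_gt0 (- la (u k) / 4).
  split=> /=; first lra.
    by apply: le_trans (ltW (step _ h1)); rewrite -natr1 lerD2r.
  have eq : expR (- la (u k) / 4) <= q ^+ k.
    by rewrite -expRM_natl ler_expR; move: h2; set x := (k%:R); lra.
  apply: le_trans (lerD h3 eq) _; rewrite exprS.
  have : Q * (1 - q) * q ^+ k = q ^+ k by rewrite /Q mulVf ?mul1r //; rewrite gt_eqF //; lra.
  move: (q ^+ k) => X; lra.
pose L := la (r0 + Q); have := archi_boundP (pos (r0 + Q) ltac:(lra)).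
set N := Num.bound _; have [h1 h2 h3] := inv N.
have : la (u N) <= la (r0 + Q).
  apply: mono; first lra.
  by apply: le_trans h3 _; rewrite gerBl mulr_ge0 ?exprn_ge0 ?ltW.
lra.
Qed.

(** The hypothesis is used twice. With the growth lemma it bounds mu by C r^4 for arbitrarily large
    r, so phi is a polynomial of degree at most 4 on each line through a. Then ln beta is O(ln r),
    and the hypothesis with r = 2 rho makes the growth of phi too slow for a polynomial of positive
    degree. *)
Lemma slow_growth_cst phi a (K : R) : hol phi -> 0 <= K ->
  (forall rho r d : R, 1 <= rho -> rho < r -> 0 < d -> d <= 1 ->
     mu phi a rho <= K * (1 + ln (beta phi a r d)) * (r / (r - rho))) ->
  forall z, phi z = phi a.
Proof.
move=> hphi K0 H.
pose la r := ln (mu phi a r).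
have m1 r : 0 <= r -> 1 <= mu phi a r by apply: mu_ge1.
have mE r : 0 <= r -> mu phi a r = expR (la r).
  by move=> r0; rewrite /la lnK // posrE; have := m1 r r0; lra.
have laP r : 1 <= r -> 0 <= la r by move=> r1; rewrite ln_ge0 // m1 //; lra.
have laM r s : 1 <= r -> r <= s -> la r <= la s.
  move=> r1 rs; rewrite -ler_expR -!mE; [apply: mu_mono => //; lra|lra|lra].
pose C1 := (56 * K) ^+ 2.
have freq r0 : 1 <= r0 -> exists2 r, r0 <= r & mu phi a r <= C1 * r ^+ 4.
  move=> r01; have [r rr hr] := growth_lemma laM laP r01; exists r => //.
  have r1 : 1 <= r by lra.
  have l0 := laP r r1; set l := la r in hr l0.
  (* t is the fourth root of mu at r. The right-hand side of H is then at most 56 K r^2 t^2 against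
     t^4 on the left: the exponent 1/4 in the growth lemma leaves room for both factors t, one from
     ln beta and one from r / (r - rho). *)
  pose t := expR (l / 4); have t1 : 1 <= t by rewrite -expR0 ler_expR; lra.
  have tV : expR (- l / 4) = t^-1 by rewrite mulNr expRN.
  pose d := t^-1 / 2; have d0 : 0 < d by rewrite !divr_gt0 ?invr_gt0 //; lra.
  have tV1 : t^-1 <= 1 by rewrite invf_le1 //; lra.
  have d1 : d <= 1 / 2 by rewrite /d; lra.
  have := H r (r + d) d r1 ltac:(lra) d0 ltac:(lra).
  have -> : (r + d) / (r + d - r) = (r + d) * (2 * t).
    by rewrite /d; field; rewrite !gt_eqF //=; lra.
  have muE : mu phi a r = t ^+ 4.
    by rewrite mE; [rewrite -expRM_natl; congr expR; rewrite /l; field|lra].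
  have l4 : l <= 4 * t by have := expR_ge1Dx (l / 4); rewrite -/t; lra.
  have lnb : ln (beta phi a (r + d) d) <= 4 * r + 8 * t + 1.
    have md : mu phi a (r + d + d) <= expR (l + 1).
      rewrite mE; last lra.
      by rewrite ler_expR (_ : r + d + d = r + t^-1) -?tV // /d; lra.
    have b0 : 0 < beta phi a (r + d) d.
      by rewrite divr_gt0 // mulr_gt0 //; [lra|have := m1 (r + d + d); lra].
    have bb : beta phi a (r + d) d <= expR (ln (4 * r) + (l + 1) + l / 4).
      rewrite [leRHS]expRD [X in _ <= X * _]expRD lnK ?posrE; last by rewrite mulr_gt0 //; lra.
      rewrite /beta -/t; have -> : d^-1 = 2 * t by rewrite /d; field; rewrite gt_eqF //; lra.
      apply: (@le_trans _ _ (2 * r * expR (l + 1) * (2 * t))); last by apply: le_of_eq; ring.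
      rewrite ler_wpM2r //; first lra.
      apply: ler_pM => //; [lra|have := m1 (r + d + d); lra|lra].
    rewrite -ler_expR lnK ?posrE //; apply: le_trans bb _; rewrite ler_expR.
    have := @ln_le (4 * r) ltac:(lra); lra.
  rewrite muE => h.
  have {}h : t ^+ 4 <= K * (14 * (r * t)) * (4 * r * t).
    apply: le_trans h _; apply: ler_pM.
    - rewrite mulr_ge0 // addr_ge0 // ln_ge0 //.
      by have [h1 _ _ _ _] := beta_ge a hphi (r := r + d) (d := d) ltac:(lra) d0 ltac:(lra).
    - by rewrite mulr_ge0 //; lra.
    - rewrite ler_wpM2l //; nra.
    nra.
  have t2 : t ^+ 2 <= 56 * K * r ^+ 2.
    have tt : 0 < t ^+ 2 by rewrite exprn_gt0 //; lra.
    by rewrite -(ler_pM2r tt); apply: le_trans (_ : t ^+ 4 <= _); [apply: le_of_eq; ring|apply: le_trans h _; apply: le_of_eq; ring].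
  have -> : t ^+ 4 = (t ^+ 2) ^+ 2 by ring.
  have -> : C1 * r ^+ 4 = (56 * K * r ^+ 2) ^+ 2 by rewrite /C1; ring.
  apply: lerXn2r; rewrite ?nnegrE //; first by rewrite exprn_ge0 //; lra.
  by rewrite !mulr_ge0 ?exprn_ge0 //; lra.
have C10 : 0 <= C1 by exact: sqr_ge0.
have line_in b r (x : C) : pdisc 1 b -> cn x <= r -> pdisc r (a + x *: b - a).
  by move=> hb hx; rewrite addrAC subrr add0r -[r]mulr1; apply: pdiscZ.
have tcb b j r : pdisc 1 b -> 0 < r -> cn (tcoef (fun x => phi (a + x *: b)) j) <= mu phi a r * (4 / r) ^+ j.
  move=> hb r0; apply: tcoef_bound => //; first exact: hphi.1.
  by move=> x hx; apply: le_mu => //; [exact: ltW|exact: line_in].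
(* Arbitrarily large radii with mu <= C1 r^4 suffice to annihilate the coefficients of index above
   4. *)
have tc0 b j : pdisc 1 b -> (5 <= j)%N -> tcoef (fun x => phi (a + x *: b)) j = 0.
  move=> hb j5; apply/eqP; rewrite -cn_eq0 eq_le cn_ge0 andbT; apply: le_of_lee => e e0; rewrite add0r.
  have [r rr hr] := freq (1 + C1 * 4 ^+ j / e) ltac:(by rewrite lerDl divr_ge0 ?mulr_ge0 ?exprn_ge0 // ltW).
  have Q0 : 0 <= C1 * 4 ^+ j / e by rewrite divr_ge0 ?mulr_ge0 ?exprn_ge0 // ltW.
  have r1 : 1 <= r by lra.
  have r0 : 0 < r by lra.
  apply: le_trans (tcb b j r hb r0) _.
  apply: (@le_trans _ _ (C1 * r ^+ 4 * (4 / r) ^+ j)).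
    by rewrite ler_wpM2r // exprn_ge0 // divr_ge0 // ltW.
  apply: (@le_trans _ _ (C1 * 4 ^+ j / r)).
    have rE : r ^+ j = r ^+ (j - 5) * r ^+ 5 by rewrite -exprD subnK.
    have rj : 1 <= r ^+ (j - 5) by rewrite exprn_ege1.
    rewrite expr_div_n rE; move: (4 ^+ j) (r ^+ (j - 5)) rj (exprn_ge0 j (ler0n R 4)) => X Y Y1 X0.
    have -> : C1 * r ^+ 4 * (X / (Y * r ^+ 5)) = C1 * X / r / Y.
      by field; rewrite !gt_eqF //; lra.
    rewrite ler_pdivrMr; last lra.
    by rewrite ler_peMr // divr_ge0 ?mulr_ge0 // ltW.
  rewrite ler_pdivrMr // -ler_pdivrMl //; rewrite mulrC; lra.
have phiE b (x : C) : pdisc 1 b -> phi (a + x *: b) = \sum_(j < 5) tcoef (fun x => phi (a + x *: b)) j * x ^+ j.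
  move=> hb; apply: climit_uniq (taylor_limit x (hphi.1 a b)) _ => e e0; exists 5%N => N N5.
  rewrite -(subnKC N5) big_split_ord /= [X in _ + X - _]big1 ?addr0 ?subrr ?cn0 ?(ltW e0) // => j _.
  by rewrite tc0 ?mul0r // leq_addr.
pose m := mu phi a 1; have mm : 1 <= m by apply: m1.
have dir z r : 0 < r -> pdisc r (z - a) -> exists2 b, pdisc 1 b & z = a + rc r *: b.
  move=> r0 hz; have rn : rc r != 0 by rewrite -cn_eq0 cn_rc normr_eq0 gt_eqF.
  exists ((rc r)^-1 *: (z - a)); last by rewrite scalerA divff // scale1r addrC subrK.
  by rewrite -(mulVf (lt0r_neq0 r0)); apply: pdiscZ hz _; rewrite cnV cn_rc gtr0_norm.
pose C2 := 1 + 5 * (m * 4 ^+ 4).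
have mu4 r : 1 <= r -> mu phi a r <= C2 * r ^+ 4.
  move=> r1; have r41 : 1 <= r ^+ 4 by rewrite exprn_ege1.
  have X0 : 0 <= m * 4 ^+ 4 by rewrite mulr_ge0 ?exprn_ge0 //; lra.
  apply: (@le_trans _ _ (1 + 5 * (m * 4 ^+ 4 * r ^+ 4))); last by rewrite /C2; nra.
  apply: mu_le => //; first lra.
  move=> z hz; have r0 : 0 < r by lra.
  have [b hb ->] := dir z r r0 hz; rewrite phiE //; apply: le_trans (cn_sum _ _ _) _.
  apply: (@le_trans _ _ (\sum_(j < 5) m * 4 ^+ 4 * r ^+ 4)); last first.
    by rewrite sumr_const card_ord -[leLHS]mulr_natl.
  apply: ler_sum => j _; rewrite cnM cnX cn_rc gtr0_norm //.
  apply: ler_pM; rewrite ?cn_ge0 ?exprn_ge0 //; [lra| |].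
    apply: le_trans (tcb b j 1 hb ltr01) _; rewrite divr1 -/m ler_wpM2l //; first lra.
    by rewrite ler_weXn2l ?ler1n // -ltnS.
  by rewrite ler_weXn2l // -ltnS.
have C21 : 1 <= C2 by rewrite /C2 lerDl mulr_ge0 // mulr_ge0 ?exprn_ge0 //; lra.
(* With radius t^2 the bound ln(r^5) = 10 ln t <= 10 t gives growth of the order of the square root
   of the radius, which excludes all positive degrees. *)
have small_mu t : 1 <= t -> mu phi a (t ^+ 2) <= 2 * K * (1 + ln (162 * C2) + 10 * t).
  move=> t1; have r1 : 1 <= t ^+ 2 by rewrite exprn_ege1.
  set r := t ^+ 2 in r1 *; have := H r (2 * r) 1 r1 ltac:(lra) ltr01 (lexx 1).
  have -> : 2 * r / (2 * r - r) = 2 by field; rewrite gt_eqF //; lra.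
  move=> h; apply: le_trans h _; rewrite mulrAC -[2 * K]mulrC ler_wpM2l ?mulr_ge0 //.
  rewrite -addrA lerD2l.
  have b1 : 1 <= beta phi a (2 * r) 1 by have [] := beta_ge a hphi (r := 2 * r) (d := 1) ltac:(lra) ltr01 (lexx 1).
  have bb : beta phi a (2 * r) 1 <= 162 * C2 * r ^+ 5.
    rewrite /beta divr1; have := mu4 (2 * r + 1) ltac:(lra) => h1.
    have h2 : (2 * r + 1) ^+ 4 <= (3 * r) ^+ 4 by apply: lerXn2r; rewrite ?nnegrE; lra.
    apply: (@le_trans _ _ (2 * r * (C2 * (3 * r) ^+ 4))); last by apply: le_of_eq; ring.
    rewrite ler_wpM2l //; first lra.
    by apply: le_trans h1 _; rewrite ler_wpM2l //; lra.
  have p1 : 0 < 162 * C2 by lra.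
  have p2 : 0 < r ^+ 5 by rewrite exprn_gt0 //; lra.
  apply: (@le_trans _ _ (ln (162 * C2 * r ^+ 5))).
    by rewrite ler_ln ?posrE //; [lra|exact: mulr_gt0].
  rewrite lnM ?posrE // lerD2l /r -exprM lnXn ?posrE; last lra.
  by rewrite -[_ *+ _]mulr_natl ler_wpM2l //; apply: ln_le; lra.
have tcz b j : pdisc 1 b -> (0 < j)%N -> tcoef (fun x => phi (a + x *: b)) j = 0.
  move=> hb j0; apply/eqP; rewrite -cn_eq0 eq_le cn_ge0 andbT; apply: le_of_lee => e e0; rewrite add0r.
  have L0 : 0 <= ln (162 * C2) by rewrite ln_ge0 //; lra.
  pose c := 2 * K * (11 + ln (162 * C2)) * 4 ^+ j.
  have c0 : 0 <= c by rewrite !mulr_ge0 ?exprn_ge0 //; lra.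
  pose t := 1 + c / e; have ce : 0 <= c / e by rewrite divr_ge0 // ltW.
  have t1 : 1 <= t by rewrite lerDl.
  have t0 : 0 < t by lra.
  have r0 : 0 < t ^+ 2 by rewrite exprn_gt0.
  apply: le_trans (tcb b j _ hb r0) _.
  have h1 : (4 / t ^+ 2) ^+ j <= 4 ^+ j / t ^+ 2.
    rewrite expr_div_n ler_wpM2l ?exprn_ge0 // lef_pV2 ?posrE ?exprn_gt0 //.
    rewrite -{1}[t ^+ 2]expr1 ler_weXn2l // exprn_ege1 //.
  have h2 : mu phi a (t ^+ 2) <= 2 * K * (11 + ln (162 * C2)) * t.
    apply: le_trans (small_mu t t1) _; rewrite -[leRHS]mulrA ler_wpM2l ?mulr_ge0 //; nra.
  apply: (@le_trans _ _ (2 * K * (11 + ln (162 * C2)) * t * (4 ^+ j / t ^+ 2))).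
    by apply: ler_pM => //; [have := m1 (t ^+ 2); lra|rewrite exprn_ge0 // divr_ge0 ?exprn_ge0 // ltW].
  have -> : 2 * K * (11 + ln (162 * C2)) * t * (4 ^+ j / t ^+ 2) = c / t.
    by rewrite /c; field; rewrite gt_eqF.
  rewrite ler_pdivrMr // /t mulrDr mulr1 mulrCA divff ?mulr1 ?gt_eqF // lerDr; exact: ltW.
move=> z; have [r r0 hr] := pdisc_ex (z - a).
have [b hb ->] := dir z r r0 hr.
rewrite phiE // big_ord_recl /= mulr1 big1 ?addr0 => [|j _]; last by rewrite tcz ?mul0r.
by rewrite /tcoef /= scale0r addr0.
Qed.

End Growth.

(** * Identities between exponentials *)

Section ExponentialIdentities.
Variables (R : realType) (n : nat).
Local Notation C := (Cplx R).
Local Notation Cn := 'rV[C]_n.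
Implicit Types (f g h phi psi A B E F : Cn -> C) (a z : Cn).

(* If B a != 0, then B e^(2 phi) = - A bounds |B| e^((Re 2 phi)^+) by a power of the maximum of phi, so
   that by the Jensen and Schwarz formulas phi grows at most like the logarithm of its own maximum. *)
Lemma two_term phi A B a : hol phi -> small phi a A -> small phi a B ->
  (forall z, A z * cexp (- phi z) + B z * cexp (phi z) = 0) ->
  (exists z, phi z != phi a) -> A a = 0 /\ B a = 0.
Proof.
move=> hp sA sB H [z0 nc].
suff Ba : B a = 0.
  split=> //; have := H a; rewrite Ba mul0r addr0 => /eqP; rewrite mulf_eq0.
  by rewrite (negPf (cexp_neq0 _)) orbF => /eqP.
apply/eqP; apply: contraT => Ba; move: nc; rewrite (_ : phi z0 = phi a) ?eqxx //.
have [KA KA0 [NA HA]] := small_pos hp sA; have [KB KB0 [NB HB]] := small_pos hp sB.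
have [hA _] := sA; have [hB _] := sB.
pose K1 := 1 + KA + KB; pose N := (NA + NB)%N; pose c := ln (cn (B a) / 2).
have L10 : 0 <= ln K1 by rewrite ln_ge0 // /K1; lra.
apply: (@slow_growth_cst _ _ phi a (1 + 5 * cn (phi a) + 4 * ln K1 + 4 * N%:R + 4 * `|c|) hp) => [|rho r d rho1 rr d0 d1].
  have := cn_ge0 (phi a); have := normr_ge0 c; have : (0 : R) <= N%:R by []; lra.
have r1 : 1 <= r by lra.
have [b1 _ _ _ _] := beta_ge a hp r1 d0 d1; set be := beta phi a r d in b1 *.
have l0 : 0 <= ln be by rewrite ln_ge0.
have bN : 0 < be ^+ N by rewrite exprn_gt0 //; lra.
have K1p : 0 < K1 by rewrite /K1; lra.
have hp2 : hol (fun z => 2 * phi z) by apply: holZ.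
have bound z : pdisc r (z - a) -> cn (B z) * expR (Num.max (re (2 * phi z)) 0) <= expR (ln K1 + N%:R * ln be).
  move=> hz; rewrite expRD lnK ?posrE // expRM_natl lnK ?posrE; last lra.
  have bA := small_weaken hp hA KA0 (leq_addr NB NA) HA r1 d0 d1 hz.
  have bB := small_weaken hp hB KB0 (leq_addl NA NB) HB r1 d0 d1 hz.
  have hh : be ^+ N * 0 <= be ^+ N by rewrite mulr0 ltW.
  rewrite -/be -/N in bA bB.
  case: (leP (re (2 * phi z)) 0) => h.
    by rewrite expR0 mulr1; apply: le_trans bB _; rewrite ler_wpM2r ?(ltW bN) // /K1; lra.
  have e : B z * cexp (2 * phi z) = - A z.
    have := H z; have -> : 2 * phi z = phi z + phi z by ring.
    rewrite cexpD cexpNV; set y := cexp _; have y0 : y != 0 by apply: cexp_neq0.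
    by move=> h'; apply/eqP; rewrite -addr_eq0 -(mulfK y0 (A z)) -(mulfK y0 (A z * y)) mulrA;
       apply/eqP; transitivity ((A z / y + B z * y) * y); [field|rewrite h' mul0r].
  rewrite -cn_cexp -cnM e cnN; apply: le_trans bA _.
  by rewrite ler_wpM2r ?(ltW bN) // /K1; lra.
have JS := jensen_schwarz_pdisc hp2 hB Ba (lt_le_trans ltr01 rho1) rr bound.
have Y1 : rho / (r - rho) <= r / (r - rho) by rewrite ler_wpM2r ?invr_ge0 //; lra.
have Y2 : 1 <= r / (r - rho) by rewrite ler_pdivlMr; lra.
have Y0 : 0 <= rho / (r - rho) by rewrite divr_ge0 //; lra.
move: JS; rewrite -/c; move: (r / (r - rho)) (rho / (r - rho)) Y1 Y2 Y0 => Y y Y1 Y2 Y0 JS.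
have NN : (0 : R) <= N%:R by [].
have nc := ler_norm (- c); rewrite normrN in nc.
have c0 := cn_ge0 (phi a).
pose T := 4 * (ln K1 + N%:R * ln be + `|c|) + 4 * cn (phi a).
have T0 : 0 <= T by have := mulr_ge0 NN l0; rewrite /T; have := normr_ge0 c; lra.
apply: (@le_trans _ _ (1 + (cn (phi a) + T * Y))).
  apply: mu_le => //; first lra.
  move=> z hz; have := JS z hz; rewrite /= -mulrBr !cnM !cn_nat => h.
  have h3 : 2 * cn (phi z - phi a) <= T * Y.
    apply: le_trans h _; apply: (@le_trans _ _ (T * y)); last by rewrite ler_wpM2l.
    by rewrite ler_wpM2r // /T; lra.
  have := cn_dist (phi z) (phi a); have := cn_ge0 (phi z - phi a); lra.
have N0 := mulr_ge0 NN l0; have h4 := mulr_ge0 L10 l0; have h5 := mulr_ge0 c0 l0.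
have h6 := mulr_ge0 (normr_ge0 c) l0.
have h7 : T + 1 + cn (phi a) <= (1 + 5 * cn (phi a) + 4 * ln K1 + 4 * N%:R + 4 * `|c|) * (1 + ln be).
  rewrite /T; lra.
apply: (@le_trans _ _ ((T + 1 + cn (phi a)) * Y)); last by rewrite ler_wpM2r //; lra.
nra.
Qed.

(** Where Re psi > 0, the factor e^(-psi) is bounded and the relation bounds |F e^psi| by e^beta
    times a power of beta. Jensen's and Schwarz's formulas at a, where F does not vanish, turn this
    into a bound for psi by a power of beta. The margin d is split between the two radii and the
    maximum modulus of phi. *)
Lemma small_psi phi psi A B E F a : hol phi -> hol psi ->
  small phi a A -> small phi a B -> small phi a E -> small phi a F -> F a != 0 ->
  (forall z, A z * cexp (- phi z) + B z * cexp (phi z) = E z * cexp (- psi z) + F z * cexp (psi z)) ->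
  small phi a psi.
Proof.
move=> hp hq sA sB sE sF Fa H; split=> //.
have [hA _] := sA; have [hB _] := sB; have [hE _] := sE; have [hF _] := sF.
have [KA KA0 [NA HA]] := small_pos hp sA; have [KB KB0 [NB HB]] := small_pos hp sB.
have [KE KE0 [NE HE]] := small_pos hp sE; have [KF KF0 [NF HF]] := small_pos hp sF.
pose N := (NA + NB + NE + NF)%N; pose K1 := 1 + KA + KB + KE + KF.
have K1p : 0 < K1 by rewrite /K1; lra.
pose c := ln (cn (F a) / 2).
exists (cn (psi a) + 8 * (K1 * 4 ^+ N + 4 + `|c|) + 4 * cn (psi a)), (N + 3)%N => rho d rho1 d0 d1 z hz.
pose r := rho + d / 2; have r1 : 1 <= r by rewrite /r; lra.
have d20 : 0 < d / 2 by lra.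
have d21 : d / 2 <= 1 by lra.
have rr : rho < r by rewrite /r; lra.
have [be1 _ _ _ bev] := beta_ge a hp rho1 d0 d1; set be := beta phi a rho d in be1 bev *.
have [b1 _ bm _ _] := beta_ge a hp r1 d20 d21; set be' := beta phi a r (d / 2) in b1 bm *.
have bb : be' <= 4 * be by exact: beta_half.
have bN : 0 < be' ^+ N by rewrite exprn_gt0 //; lra.
have bound w : pdisc r (w - a) -> cn (F w) * expR (Num.max (re (psi w)) 0) <= expR (ln (K1 * be' ^+ N) + be').
  move=> hw; rewrite expRD lnK ?posrE ?mulr_gt0 //.
  have lA : (NA <= N)%N by rewrite /N; clear; lia.
  have bA := small_weaken hp hA KA0 lA HA r1 d20 d21 hw; rewrite -/be' in bA.
  have lB : (NB <= N)%N by rewrite /N; clear; lia.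
  have bB := small_weaken hp hB KB0 lB HB r1 d20 d21 hw; rewrite -/be' in bB.
  have lE : (NE <= N)%N by rewrite /N; clear; lia.
  have bE := small_weaken hp hE KE0 lE HE r1 d20 d21 hw; rewrite -/be' in bE.
  have lF : (NF <= N)%N by rewrite /N; clear; lia.
  have bF := small_weaken hp hF KF0 lF HF r1 d20 d21 hw; rewrite -/be' in bF.
  have e1 : 1 <= expR be' by rewrite -expR0 ler_expR; lra.
  have phb : `|re (phi w)| <= be'.
    apply: le_trans (re_le _) _; apply: le_trans bm; apply: le_mu => //; first lra.
    by apply: pdisc_le hw; lra.
  move: (be' ^+ N) bN bA bB bE bF => X X0 bA bB bE bF.
  case: (leP (re (psi w)) 0) => h.
    rewrite expR0 mulr1; apply: le_trans bF _; apply: (@le_trans _ _ (K1 * X * 1)).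
      by rewrite mulr1 ler_wpM2r ?(ltW X0) // /K1; lra.
    by rewrite ler_wpM2l // mulr_ge0 ?ltW.
  rewrite -cn_cexp -cnM.
  have -> : F w * cexp (psi w) = A w * cexp (- phi w) + B w * cexp (phi w) - E w * cexp (- psi w).
    by rewrite H; ring.
  have eb (s : C) : re s <= be' -> cn (cexp s) <= expR be' by move=> hs; rewrite cn_cexp ler_expR.
  have em : cn (cexp (- phi w)) <= expR be'.
    by apply: eb; rewrite reN; move: phb; rewrite ler_norml => /andP[]; lra.
  have ep : cn (cexp (phi w)) <= expR be'.
    by apply: eb; move: phb; rewrite ler_norml => /andP[].
  have es : cn (cexp (- psi w)) <= expR be' by apply: eb; rewrite reN; lra.
  apply: le_trans (cnB _ _) _; apply: le_trans (lerD (cnD _ _) (lexx _)) _; rewrite !cnM.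
  have t1 : cn (A w) * cn (cexp (- phi w)) <= KA * X * expR be' by apply: ler_pM; rewrite ?cn_ge0.
  have t2 : cn (B w) * cn (cexp (phi w)) <= KB * X * expR be' by apply: ler_pM; rewrite ?cn_ge0.
  have t3 : cn (E w) * cn (cexp (- psi w)) <= KE * X * expR be' by apply: ler_pM; rewrite ?cn_ge0.
  have X1 : 0 <= X * expR be' by rewrite mulr_ge0 ?expR_ge0 // ltW.
  have t4 := mulr_ge0 KF0 X1.
  apply: le_trans (lerD (lerD t1 t2) t3) _; rewrite /K1; lra.
have JS := jensen_schwarz_pdisc hq hF Fa (lt_le_trans ltr01 rho1) rr bound hz.
have y0 : 0 < rho / (r - rho) by rewrite divr_gt0 //; lra.
have yb : rho / (r - rho) <= 2 * be.
  have -> : r - rho = d / 2 by rewrite /r; lra.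
  have [_ _ _ bd _] := beta_ge a hp rho1 d0 d1.
  have -> : rho / (d / 2) = 2 * (rho / d) by field; rewrite gt_eqF.
  by rewrite ler_wpM2l.
have lnb : ln (K1 * be' ^+ N) <= K1 * 4 ^+ N * be ^+ N.
  apply: le_trans (ln_le _) _; first exact: mulr_gt0.
  rewrite -mulrA -exprMn ler_wpM2l ?(ltW K1p) //; apply: lerXn2r; rewrite ?nnegrE //; lra.
have nc := ler_norm (- c); rewrite normrN in nc.
have := cn_dist (psi z) (psi a); set P := cn (psi a) in JS *.
have P0 : 0 <= P := cn_ge0 _.
rewrite -/c in JS => hd.
have q1 : 1 <= be ^+ N by rewrite exprn_ege1.
have h1 : 4 * (ln (K1 * be' ^+ N) + be' - c) + 2 * P <= (4 * (K1 * 4 ^+ N + 4 + `|c|) + 2 * P) * be ^+ N.+1.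
  have K4 : 0 <= K1 * 4 ^+ N by rewrite mulr_ge0 ?exprn_ge0 // ltW.
  have g1 : be ^+ N <= be ^+ N.+1 by rewrite ler_weXn2l.
  have g2 : be <= be ^+ N.+1 by rewrite -{1}[be]expr1 ler_weXn2l.
  have g3 : 1 <= be ^+ N.+1 by rewrite exprn_ege1.
  have k1 : K1 * 4 ^+ N * be ^+ N <= K1 * 4 ^+ N * be ^+ N.+1 by rewrite ler_wpM2l.
  have k2 := ler_wpM2l (normr_ge0 c) g3.
  have k3 := ler_wpM2l P0 g3.
  move: (be ^+ N.+1) g1 g2 g3 k1 k2 k3 lnb => Z g1 g2 g3 k1 k2 k3 lnb; lra.
have h2 : (4 * (K1 * 4 ^+ N + 4 + `|c|) + 2 * P) * be ^+ N.+1 * (rho / (r - rho)) <=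
   (4 * (K1 * 4 ^+ N + 4 + `|c|) + 2 * P) * be ^+ N.+1 * (2 * be).
  rewrite ler_wpM2l // mulr_ge0 ?exprn_ge0 //; last lra.
  by have : 0 <= K1 * 4 ^+ N by [rewrite mulr_ge0 ?exprn_ge0 // ltW]; have := normr_ge0 c; lra.
have h3 := le_trans JS (le_trans (ler_wpM2r (ltW y0) h1) h2).
have e3 : be ^+ N.+1 * (2 * be) = 2 * be ^+ (N + 2) by rewrite addn2 !exprS; ring.
rewrite -mulrA [be ^+ N.+1 * _]mulrC in h3.
have g4 : be ^+ (N + 2) <= be ^+ (N + 3) by rewrite ler_weXn2l // leq_add2l.
have g5 : 1 <= be ^+ (N + 3) by rewrite exprn_ege1.
have W0 : 0 <= 4 * (K1 * 4 ^+ N + 4 + `|c|) + 2 * P.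
  by have : 0 <= K1 * 4 ^+ N by [rewrite mulr_ge0 ?exprn_ge0 // ltW]; have := normr_ge0 c; lra.
rewrite [_ * be ^+ N.+1]mulrC e3 in h3.
have k5 := ler_wpM2l W0 g4; have k6 := ler_wpM2l P0 g5.
move: (be ^+ (N + 2)) (be ^+ (N + 3)) g4 g5 k5 k6 h3 hd => Z1 Z2 g4 g5 k5 k6 h3 hd.
have -> : cn (psi z) = cn (psi z) - P + P by ring.
lra.
Qed.

(** f / g has derivative 0 near a, where g does not vanish; the identity theorem carries f = k g to
    all of C^n. *)
Lemma proportional f g a : hol f -> hol g -> g a != 0 ->
  (forall j z, dd (ej R j) f z * g z = f z * dd (ej R j) g z) -> exists k, forall z, f z = k * g z.
Proof.
move=> hf hg ga H; exists (f a / g a) => z; apply/eqP; rewrite -subr_eq0; apply/eqP.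
have c0 : 0 < cn (g a) by rewrite cn_gt0.
have [d d0 Hd] := hol_cont a hg (divr_gt0 c0 (ltr0n _ 2)).
have nz w : pdisc d (w - a) -> g w != 0.
  move=> /Hd h; rewrite -cn_gt0; have := cn_dist (g a) (g w); rewrite cnBC; lra.
have Hb b w : dd b f w * g w = f w * dd b g w.
  rewrite !(@dd_coord _ _ b) // mulr_suml mulr_sumr; apply: eq_bigr => j _.
  by rewrite -mulrA H; ring.
apply: (@hol_identity _ _ (fun z => f z - f a / g a * g z) a d) => // [|w hw].
  by apply: holB => //; apply: holZ.
suff : f w / g w - f a / g a = 0.
  by move/eqP; rewrite subr_eq0 => /eqP <-; rewrite divfK ?subrr // nz.
apply/eqP; rewrite -cn_eq0 eq_le cn_ge0 andbT.
have := @mean_value_le R (fun x : C => f (a + x *: (w - a)) / g (a + x *: (w - a))) 0 1 0.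
rewrite add0r !scale1r !scale0r !addr0 [a + _]addrC subrK mul0r; apply => x; rewrite subr0 cn1 => hx.
have gx : g (a + x *: (w - a)) != 0.
  by apply: nz; rewrite addrAC subrr add0r -[d]mul1r; apply: pdiscZ.
have := cderM (ddP a (w - a) x hf) (cderV gx (ddP a (w - a) x hg)).
move=> dl; eexists; first exact: dl.
rewrite (_ : _ + _ = (dd (w - a) f (a + x *: (w - a)) * g (a + x *: (w - a)) -
   f (a + x *: (w - a)) * dd (w - a) g (a + x *: (w - a))) / g (a + x *: (w - a)) ^+ 2).
  by rewrite Hb subrr mul0r cn0.
by field.
Qed.

(** Division by e^(chi / 2) gives a relation between two terms, A e^(chi / 2) - B e^(-chi / 2) = 0,
    with polynomial coefficients. *)
Lemma poly_exp_cst chi A B : hol chi -> is_poly A -> is_poly B -> (exists z, A z != 0) ->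
  (forall z, A z * cexp (chi z) = B z) -> forall z, chi z = chi 0.
Proof.
move=> hc pA pB [a Aa] H.
pose phi z := 2^-1 * chi z; have hp : hol phi by exact: holZ.
suff E z : phi z = phi a.
  have E2 z : chi z = chi a by apply: (mulfI (_ : 2^-1 != 0)); rewrite ?invr_eq0 ?pnatr_eq0 //; exact: E.
  by move=> z; rewrite !E2.
apply: contrapT => /eqP nc.
have [] := @two_term phi (fun z => - B z) A a hp _ _ _ _; last by move=> _ /eqP; rewrite (negPf Aa).
- by apply: (smallN hp); apply: (small_poly a hp).
- exact: (small_poly a hp).
- move=> w; rewrite -H cexpNV /phi.
  have -> : cexp (chi w) = cexp (2^-1 * chi w) * cexp (2^-1 * chi w) by rewrite -cexpD; congr cexp; field.
  have := cexp_neq0 (2^-1 * chi w); move: (cexp _) => y y0; by field.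
by exists z.
Qed.

End ExponentialIdentities.

(** * Relations between several exponentials *)

Section ExponentialSums.
Variables (R : realType) (n : nat).
Local Notation C := (Cplx R).
Local Notation Cn := 'rV[C]_n.
Implicit Types (f g h phi psi A B E F P Q S : Cn -> C) (a z : Cn).

Lemma small_double phi a h : hol phi -> small phi a h -> small (fun z => 2 * phi z) a h.
Proof.
move=> hp sh; have hp2 : hol (fun z => 2 * phi z) by exact: holZ.
split; first exact: sh.1.
have [K K0 [N H]] := small_pos hp sh; exists (K * 2 ^+ N), N => r d r1 d0 d1 z hz.
apply: le_trans (H r d r1 d0 d1 z hz) _; rewrite -mulrA -exprMn ler_wpM2l //.
have rd0 : 0 <= r + d by lra.
have b0 s : 1 <= s -> 0 <= r * s / d by move=> s1; rewrite divr_ge0 ?mulr_ge0 ?ltW //; lra.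
have m2 : 1 <= mu (fun z => 2 * phi z) a (r + d) by exact: mu_ge1.
apply: lerXn2r; rewrite ?nnegrE; first by apply: b0; exact: mu_ge1.
  by rewrite mulr_ge0 // b0.
rewrite /beta mulrA [2 * _]mulrCA; rewrite ler_wpM2r ?invr_ge0 ?(ltW d0) // ler_wpM2l //; first lra.
apply: (@le_trans _ _ (1 + mu (fun z => 2 * phi z) a (r + d))); last lra.
apply: mu_le => // w hw; have := le_mu hp2 rd0 hw; rewrite cnM cn_nat; have := cn_ge0 (phi w); lra.
Qed.

Section Fixed.
Variables (phi F : Cn -> C).
Hypotheses (hp : hol phi) (nphi : exists z, phi z != phi 0) (hF : hol F) (nF : exists z, F z != 0).

(** Smallness of psi is obtained by Jensen's formula at a base point where F does not vanish, hence
    for such base points only. This is enough: an entire function that vanishes off the zeros of F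
    vanishes identically. *)
Definition small_off h := hol h /\ forall a, F a != 0 -> small phi a h.

Lemma small_offD f g : small_off f -> small_off g -> small_off (fun z => f z + g z).
Proof. by move=> [hf sf] [hg sg]; split=> [|a Fa]; [exact: holD|apply: (smallD hp); [exact: sf|exact: sg]]. Qed.
Lemma small_offM f g : small_off f -> small_off g -> small_off (fun z => f z * g z).
Proof. by move=> [hf sf] [hg sg]; split=> [|a Fa]; [exact: holM|apply: (smallM hp); [exact: sf|exact: sg]]. Qed.
Lemma small_offZ (c : C) f : small_off f -> small_off (fun z => c * f z).
Proof. by move=> [hf sf]; split=> [|a Fa]; [exact: holZ|apply: (smallZ hp); exact: sf]. Qed.
Lemma small_offB f g : small_off f -> small_off g -> small_off (fun z => f z - g z).
Proof. by move=> [hf sf] [hg sg]; split=> [|a Fa]; [exact: holB|apply: (smallB hp); [exact: sf|exact: sg]]. Qed.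
Lemma small_off_dd j f : small_off f -> small_off (dd (ej R j) f).
Proof. by move=> [hf sf]; split=> [|a Fa]; [exact: hol_dd|apply: (small_dd hp); exact: sf]. Qed.
Lemma small_off_self : small_off phi.
Proof. by split=> // a Fa; apply: small_self. Qed.
Lemma small_off_poly f : is_poly f -> small_off f.
Proof. by move=> pf; split=> [|a Fa]; [exact: is_poly_hol|exact: (small_poly a hp)]. Qed.

Lemma hol_zero_off h : hol h -> (forall a, F a != 0 -> h a = 0) -> forall z, h z = 0.
Proof.
move=> hh H; have hF0 z : h z * F z = 0.
  by case: (eqVneq (F z) 0) => [->|/H ->]; rewrite ?mulr0 ?mul0r.
by have [//|F0] := hol_domain hh hF hF0; have [z] := nF; rewrite F0 eqxx.
Qed.

Lemma nonconstant a : exists z, phi z != phi a.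
Proof.
have [z hz] := nphi; case: (eqVneq (phi z) (phi a)) => [e|]; last by exists z.
by exists 0; rewrite -e eq_sym.
Qed.

Lemma two_term_off A B : small_off A -> small_off B ->
  (forall z, A z * cexp (- phi z) + B z * cexp (phi z) = 0) ->
  (forall z, A z = 0) /\ (forall z, B z = 0).
Proof.
move=> [hA sA] [hB sB] H.
have T a : F a != 0 -> A a = 0 /\ B a = 0.
  by move=> Fa; apply: (two_term hp (sA a Fa) (sB a Fa) H (nonconstant a)).
by split; apply: hol_zero_off => // a /T[].
Qed.

Lemma two_term_sqr A B : small_off A -> small_off B ->
  (forall z, A z * cexp (- phi z) ^+ 2 + B z * cexp (phi z) ^+ 2 = 0) ->
  (forall z, A z = 0) /\ (forall z, B z = 0).
Proof.
move=> [hA sA] [hB sB] H.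
have T a : F a != 0 -> A a = 0 /\ B a = 0.
  move=> Fa; apply: (@two_term _ _ (fun z => 2 * phi z)); first exact: holZ.
  - by apply: small_double => //; exact: sA.
  - by apply: small_double => //; exact: sB.
  - by move=> z; rewrite -(H z) !expr2 -!cexpD; congr (_ * cexp _ + _ * cexp _); ring.
  have [z hz] := nonconstant a; exists z; apply: contra_neq hz.
  by apply: mulfI; rewrite pnatr_eq0.
by split; apply: hol_zero_off => // a /T[].
Qed.

(** The coefficient of e^chi in the partial derivative of h e^chi. *)
Definition lie j (chi : Cn -> C) (h : Cn -> C) : Cn -> C := fun z => dd (ej R j) h z + dd (ej R j) chi z * h z.

Lemma dd_lie j chi h z : hol chi -> hol h ->
  dd (ej R j) (fun z => h z * cexp (chi z)) z = lie j chi h z * cexp (chi z).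
Proof.
by move=> hc hh; rewrite ddMf ?dd_cexp //; [rewrite /lie; ring|exact: hol_cexp].
Qed.

Lemma small_off_lie j chi h : small_off chi -> small_off h -> small_off (lie j chi h).
Proof. by move=> sc sh; apply: small_offD; [|apply: small_offM => //]; exact: small_off_dd. Qed.

Lemma lie_proportional j (c : C) P Q : small_off P -> small_off Q ->
  (forall z, Q z * lie j (fun z => c * phi z) P z - dd (ej R j) Q z * P z = 0) ->
  forall z, dd (ej R j) (fun z => P z * cexp (c * phi z)) z * Q z =
    P z * cexp (c * phi z) * dd (ej R j) Q z.
Proof.
move=> [hP _] [hQ _] H z; rewrite (dd_lie _ _ (holZ c hp) hP).
have /eqP := H z; rewrite subr_eq0 => /eqP e; rewrite mulrAC [lie _ _ _ _ * _]mulrC e; ring.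
Qed.

(** If Q is not 0, it is eliminated between the relation and its derivatives. The remaining
    relations of two terms say that Wronskians vanish, so P e^(-2 phi) = k Q and S e^(2 phi) = l Q.
    These are again relations of two terms, hence P = S = 0 and then Q = 0. *)
Lemma three_exponentials P Q S : small_off P -> small_off Q -> small_off S ->
  (forall z, P z * cexp (- 2 * phi z) + Q z + S z * cexp (2 * phi z) = 0) ->
  [/\ forall z, P z = 0, forall z, Q z = 0 & forall z, S z = 0].
Proof.
move=> sP sQ sS H.
have [hP _] := sP; have [hQ _] := sQ; have [hS _] := sS.
have em z : cexp (- 2 * phi z) = cexp (- phi z) ^+ 2 by rewrite expr2 -cexpD; congr cexp; ring.
have ep z : cexp (2 * phi z) = cexp (phi z) ^+ 2 by rewrite expr2 -cexpD; congr cexp; ring.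
have [Q0|/existsNP[a /eqP Qa]] := pselect (forall z, Q z = 0).
  have [] := two_term_sqr sP sS; last by split.
  by move=> z; rewrite -em -ep -(H z) Q0 addr0.
have hX (c : C) T : hol T -> hol (fun z => T z * cexp (c * phi z)).
  by move=> hT; apply: holM => //; apply: hol_cexp; exact: holZ.
have D j z : lie j (fun z => - 2 * phi z) P z * cexp (- 2 * phi z) + dd (ej R j) Q z +
    lie j (fun z => 2 * phi z) S z * cexp (2 * phi z) = 0.
  rewrite -(dd_lie j z (holZ (- 2) hp) hP) -(dd_lie j z (holZ 2 hp) hS).
  have h1 := hX (- 2) _ hP; have h2 := hX 2 _ hS.
  by rewrite -(ddDf _ z h1 hQ) -(ddDf _ z (holD h1 hQ) h2) (dd_ext _ z H) dd_cst.
have W j : (forall z, Q z * lie j (fun z => - 2 * phi z) P z - dd (ej R j) Q z * P z = 0) /\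
    (forall z, Q z * lie j (fun z => 2 * phi z) S z - dd (ej R j) Q z * S z = 0).
  have sc (c : C) := small_offZ c small_off_self.
  apply: two_term_sqr => [||z].
  - by apply: small_offB; apply: small_offM => //; [exact: small_off_lie|exact: small_off_dd].
  - by apply: small_offB; apply: small_offM => //; [exact: small_off_lie|exact: small_off_dd].
  rewrite -em -ep; transitivity (Q z * (lie j (fun z => - 2 * phi z) P z * cexp (- 2 * phi z) + dd (ej R j) Q z +
    lie j (fun z => 2 * phi z) S z * cexp (2 * phi z)) - dd (ej R j) Q z *
    (P z * cexp (- 2 * phi z) + Q z + S z * cexp (2 * phi z))); last by rewrite D H; ring.
  ring.
have [k Hk] := proportional (hX _ _ hP) hQ Qa (fun j => lie_proportional sP sQ (W j).1).
have [l Hl] := proportional (hX _ _ hS) hQ Qa (fun j => lie_proportional sS sQ (W j).2).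
have [P0 _] : (forall z, P z = 0) /\ (forall z, - k * Q z = 0).
  apply: two_term_off => // [|z]; first exact: small_offZ.
  have := Hk z; rewrite em cexpNV; have := cexp_neq0 (phi z); move: (cexp _) => y y0 e.
  by rewrite mulNr mulNr -e; field.
have [S0 _] : (forall z, S z = 0) /\ (forall z, - l * Q z = 0).
  have [|//|z|] := @two_term_off (fun z => - l * Q z) S; [exact: small_offZ| |by split].
  have := Hl z; rewrite ep cexpNV; have := cexp_neq0 (phi z); move: (cexp _) => y y0 e.
  by rewrite mulNr mulNr -e; field.
by move: Qa; have := H a; rewrite P0 S0 !mul0r add0r addr0 => ->; rewrite eqxx.
Qed.

End Fixed.

Lemma hol_term phi A : hol phi -> hol A -> hol (fun z => A z * cexp (phi z)).
Proof. by move=> hp hA; apply: holM => //; exact: hol_cexp. Qed.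

Lemma dd_sum_terms phi chi A B j z : hol phi -> hol chi -> hol A -> hol B ->
  dd (ej R j) (fun z => A z * cexp (phi z) + B z * cexp (chi z)) z =
  lie j phi A z * cexp (phi z) + lie j chi B z * cexp (chi z).
Proof. by move=> hp hc hA hB; rewrite ddDf ?dd_lie //; exact: hol_term. Qed.

Lemma small_off_rhs phi psi A B E F : hol phi -> hol psi -> is_poly E -> is_poly F ->
  small_off phi F A -> small_off phi F B ->
  (forall z, A z * cexp (- phi z) + B z * cexp (phi z) = E z * cexp (- psi z) + F z * cexp (psi z)) ->
  small_off phi F psi.
Proof.
move=> hp hq pE pF [_ sA] [_ sB] H; split=> // a Fa.
apply: (small_psi hp hq (sA a Fa) (sB a Fa) _ _ Fa H); exact: (small_poly a hp).
Qed.

(** Eliminating F e^psi with the derived relations makes both terms on the left multiples of it, say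
    by k and l. Then l A e^(-phi) - k B e^phi = 0, so l A = 0 and k B = 0. *)
Lemma three_term phi psi A B F : hol phi -> (exists z, phi z != phi 0) -> hol psi ->
  is_poly F -> (exists z, F z != 0) -> small_off phi F A -> small_off phi F B ->
  (forall z, A z * cexp (- phi z) + B z * cexp (phi z) = F z * cexp (psi z)) ->
  (forall z, A z = 0) \/ (forall z, B z = 0).
Proof.
move=> hp nphi hq pF nF sA sB H.
have hF := is_poly_hol pF; have [hA _] := sA; have [hB _] := sB.
have hN : hol (fun z => - phi z) by exact: holN.
have sq : small_off phi F psi.
  apply: (@small_off_rhs phi psi A B (fun=> 0) F) => // [|z]; first exact: is_poly_cst.
  by rewrite H mul0r add0r.
have sp : small_off phi F phi by exact: small_off_self.
have sN : small_off phi F (fun z => - phi z).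
  by move: (small_offZ hp (- 1) sp); congr small_off; apply/funext => z; rewrite mulN1r.
have sF : small_off phi F F by exact: small_off_poly.
have D j z : lie j (fun z => - phi z) A z * cexp (- phi z) + lie j phi B z * cexp (phi z) =
    lie j psi F z * cexp (psi z).
  by rewrite -dd_sum_terms // -dd_lie //; exact: dd_ext.
have W j : (forall z, lie j psi F z * A z - F z * lie j (fun z => - phi z) A z = 0) /\
    (forall z, lie j psi F z * B z - F z * lie j phi B z = 0).
  apply: (two_term_off hp nphi hF nF) => [||z].
  - by apply: small_offB => //; apply: small_offM => //; exact: small_off_lie.
  - by apply: small_offB => //; apply: small_offM => //; exact: small_off_lie.
  transitivity (lie j psi F z * (A z * cexp (- phi z) + B z * cexp (phi z)) - F z *
    (lie j (fun z => - phi z) A z * cexp (- phi z) + lie j phi B z * cexp (phi z))); first ring.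
  by rewrite H D; ring.
have [a Fa] := nF; have Ya : F a * cexp (psi a) != 0 by rewrite mulf_neq0 ?cexp_neq0.
have pr (chi : Cn -> C) T : hol chi -> hol T -> (forall j z, lie j psi F z * T z - F z * lie j chi T z = 0) ->
    exists k, forall z, T z * cexp (chi z) = k * (F z * cexp (psi z)).
  move=> hc hT HT; apply: (proportional (hol_term hc hT) (hol_term hq hF) Ya) => j z.
  rewrite !dd_lie //; have /eqP := HT j z; rewrite subr_eq0 => /eqP e.
  transitivity (F z * lie j chi T z * cexp (chi z) * cexp (psi z)); first ring.
  by rewrite -e; ring.
have [k Hk] := pr _ _ hN hA (fun j => (W j).1).
have [l Hl] := pr _ _ hp hB (fun j => (W j).2).
have [lA kB] : (forall z, l * A z = 0) /\ (forall z, - k * B z = 0).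
  apply: (two_term_off hp nphi hF nF) => [||z]; try exact: small_offZ.
  by rewrite -!mulrA Hk Hl; ring.
case: (eqVneq l 0) => [l0|ln]; [right|left] => z.
  by have /eqP := Hl z; rewrite l0 mul0r mulf_eq0 (negPf (cexp_neq0 _)) orbF => /eqP.
by have /eqP := lA z; rewrite mulf_eq0 (negPf ln) => /eqP.
Qed.

(* Eliminating with the derived relation expresses Delta e^psi and Delta e^(-psi), for a Wronskian Delta
   of E e^(-psi) and F e^psi, through e^phi and e^(-phi); the product of both expressions is a relation
   between e^(-2 phi), 1 and e^(2 phi). *)
Lemma four_term phi psi A B E F : hol phi -> (exists z, phi z != phi 0) ->
  hol psi -> (exists z, psi z != psi 0) ->
  is_poly E -> (exists z, E z != 0) -> is_poly F -> (exists z, F z != 0) ->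
  small_off phi F A -> small_off phi F B ->
  (forall z, A z * cexp (- phi z) + B z * cexp (phi z) = E z * cexp (- psi z) + F z * cexp (psi z)) ->
  (forall z, A z * cexp (- phi z) = E z * cexp (- psi z) /\ B z * cexp (phi z) = F z * cexp (psi z)) \/
  (forall z, A z * cexp (- phi z) = F z * cexp (psi z) /\ B z * cexp (phi z) = E z * cexp (- psi z)).
Proof.
move=> hp nphi hq npsi pE nE pF nF sA sB H.
have hF := is_poly_hol pF; have hE := is_poly_hol pE; have [hA _] := sA; have [hB _] := sB.
have hN : hol (fun z => - phi z) by exact: holN.
have hM : hol (fun z => - psi z) by exact: holN.
have sq : small_off phi F psi by exact: (@small_off_rhs phi psi A B E F).
have sp : small_off phi F phi by exact: small_off_self.
have sN (chi : Cn -> C) : small_off phi F chi -> small_off phi F (fun z => - chi z).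
  by move=> /(small_offZ hp (- 1)); congr small_off; apply/funext => z; rewrite mulN1r.
have sF : small_off phi F F by exact: small_off_poly.
have sE : small_off phi F E by exact: small_off_poly.
pose A1 j := lie j (fun z => - phi z) A; pose B1 j := lie j phi B.
pose E1 j := lie j (fun z => - psi z) E; pose F1 j := lie j psi F.
have sA1 j : small_off phi F (A1 j) by apply: small_off_lie => //; exact: sN.
have sB1 j : small_off phi F (B1 j) by exact: small_off_lie.
have sE1 j : small_off phi F (E1 j) by apply: small_off_lie => //; exact: sN.
have sF1 j : small_off phi F (F1 j) by exact: small_off_lie.
have D j z : A1 j z * cexp (- phi z) + B1 j z * cexp (phi z) = E1 j z * cexp (- psi z) + F1 j z * cexp (psi z).
  by rewrite -!dd_sum_terms //; exact: dd_ext.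
(* If all these Wronskians vanished, F e^psi would be a constant multiple of E e^(-psi), and F e^(2
   psi) a polynomial, which forces psi to be constant. *)
have [j [w Dw]] : exists j z, E z * F1 j z - E1 j z * F z != 0.
  apply: contrapT => nD.
  have [a Ea] := nE; have Ya : E a * cexp (- psi a) != 0 by rewrite mulf_neq0 ?cexp_neq0.
  have [k Hk] : exists k, forall z, F z * cexp (psi z) = k * (E z * cexp (- psi z)).
    apply: (proportional (hol_term hq hF) (hol_term hM hE) Ya) => j z; rewrite !dd_lie //.
    have : E z * F1 j z - E1 j z * F z = 0.
      by apply: contrapT => h; apply: nD; exists j, z; apply/eqP.
    move=> /eqP; rewrite subr_eq0 => /eqP e; rewrite -/(F1 j) -/(E1 j).
    transitivity (E z * F1 j z * cexp (psi z) * cexp (- psi z)); first ring.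
    by rewrite e; ring.
  have [z] := npsi; apply/negP; rewrite negbK; apply/eqP.
  have c2 : (2 : C) != 0 by rewrite pnatr_eq0.
  apply: (mulfI c2); apply: (@poly_exp_cst _ _ (fun z => 2 * psi z) F (fun z => k * E z)) => //; first exact: holZ.
    by apply: is_polyM => //; exact: is_poly_cst.
  move=> x; have -> : 2 * psi x = psi x + psi x by ring.
  rewrite cexpD mulrA Hk cexpNV; have := cexp_neq0 (psi x); move: (cexp _) => y y0; by field.
pose Dl z := E z * F1 j z - E1 j z * F z.
pose a z := E z * A1 j z - E1 j z * A z; pose b z := E z * B1 j z - E1 j z * B z.
pose a' z := F1 j z * A z - F z * A1 j z; pose b' z := F1 j z * B z - F z * B1 j z.
have sD : small_off phi F Dl by apply: small_offB => //; exact: small_offM.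
have sa : small_off phi F a by apply: small_offB => //; exact: small_offM.
have sb : small_off phi F b by apply: small_offB => //; exact: small_offM.
have sa' : small_off phi F a' by apply: small_offB => //; exact: small_offM.
have sb' : small_off phi F b' by apply: small_offB => //; exact: small_offM.
have ep z : Dl z * cexp (psi z) = a z * cexp (- phi z) + b z * cexp (phi z).
  transitivity (E z * (A1 j z * cexp (- phi z) + B1 j z * cexp (phi z)) -
    E1 j z * (A z * cexp (- phi z) + B z * cexp (phi z))); last by rewrite /a /b; ring.
  by rewrite H D /Dl; ring.
have em z : Dl z * cexp (- psi z) = a' z * cexp (- phi z) + b' z * cexp (phi z).
  transitivity (F1 j z * (A z * cexp (- phi z) + B z * cexp (phi z)) - F z *
    (A1 j z * cexp (- phi z) + B1 j z * cexp (phi z))); last by rewrite /a' /b'; ring.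
  by rewrite H D /Dl; ring.
have [P0 Q0 S0] : [/\ forall z, a z * a' z = 0, forall z, a z * b' z + a' z * b z - Dl z ^+ 2 = 0 &
    forall z, b z * b' z = 0].
  apply: (three_exponentials hp nphi hF nF) => [|||z].
  - exact: small_offM.
  - apply: small_offB => //; first by apply: small_offD => //; exact: small_offM.
    by under eq_fun do rewrite expr2; exact: small_offM.
  - exact: small_offM.
  have -> : Dl z ^+ 2 = (Dl z * cexp (psi z)) * (Dl z * cexp (- psi z)).
    by rewrite cexpNV; have := cexp_neq0 (psi z); move: (cexp _) => y y0; field.
  rewrite ep em.
  have -> : cexp (- 2 * phi z) = cexp (- phi z) * cexp (- phi z) by rewrite -cexpD; congr cexp; ring.
  have -> : cexp (2 * phi z) = cexp (phi z) * cexp (phi z) by rewrite -cexpD; congr cexp; ring.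
  by rewrite cexpNV; have := cexp_neq0 (phi z); move: (cexp _) => y y0; field.
have hD : hol Dl := sD.1.
have canc h g : hol h -> hol g -> (forall z, Dl z * h z = Dl z * g z) -> forall z, h z = g z.
  move=> hh hg Hc; have [|D0|e z] := hol_domain hD (holB hh hg).
  - by move=> z; rewrite mulrBr Hc subrr.
  - by move: Dw; rewrite -/(Dl w) D0 eqxx.
  by apply/eqP; rewrite -subr_eq0 e.
have hw := hol_term hq hF; have hx := hol_term hp hB; have hx' := hol_term hN hA.
(* By [Q0], neither a = b = 0 nor a' = b' = 0 is possible, as Dl is not 0. So a = 0 goes with b' =
   0, and a' = 0 with b = 0: these are the two pairings of terms. *)
have [a0|a'0] := hol_domain sa.1 sa'.1 P0.
  have b'0 : forall z, b' z = 0.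
    have [b0|//] := hol_domain sb.1 sb'.1 S0.
    by move: Dw; rewrite -/(Dl w) -sqrf_eq0; have := Q0 w; rewrite a0 b0 mul0r mulr0 addr0 sub0r => /eqP; rewrite oppr_eq0 => ->.
  left; have e z : B z * cexp (phi z) = F z * cexp (psi z).
    apply: (canc _ _ hx hw) => {}z.
    transitivity (F z * (Dl z * cexp (psi z))); last ring.
    rewrite ep a0 mul0r add0r mulrA mulrA; congr (_ * _).
    apply/eqP; rewrite -subr_eq0; apply/eqP; transitivity (E z * b' z); last by rewrite b'0 mulr0.
    by rewrite /Dl /b' /b; ring.
  move=> z; split=> //; apply: (addIr (B z * cexp (phi z))); rewrite H e; ring.
have b0 : forall z, b z = 0.
  have [//|b'0] := hol_domain sb.1 sb'.1 S0.
  by move: Dw; rewrite -/(Dl w) -sqrf_eq0; have := Q0 w; rewrite a'0 b'0 mul0r mulr0 addr0 sub0r => /eqP; rewrite oppr_eq0 => ->.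
right; have e z : A z * cexp (- phi z) = F z * cexp (psi z).
  apply: (canc _ _ hx' hw) => {}z.
  transitivity (F z * (Dl z * cexp (psi z))); last ring.
  rewrite ep b0 mul0r addr0 mulrA mulrA; congr (_ * _).
  apply/eqP; rewrite -subr_eq0; apply/eqP; transitivity (E z * a' z); last by rewrite a'0 mulr0.
    by rewrite /Dl /a' /a; ring.
move=> z; split=> //; apply: (addrI (A z * cexp (- phi z))); rewrite H e; ring.
Qed.

End ExponentialSums.

(** * Partial degrees *)

Section PartialDegree.
Variables (R : realType) (n : nat) (j : 'I_n).
Local Notation C := (Cplx R).
Local Notation mp := (mpoly n C).
Implicit Types (a b d h : mp) (m : multinom n).

Definition graded_var (i : 'I_n) : {poly mp} :=
  (mpolyX C (mnm1 i))%:P * (if i == j then 'X else 1).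

(* Substituting X * x_j for x_j turns the partial degree into a size, and the multiplicativity of
   the former into that of the latter. *)
Definition graded (b : mp) : {poly mp} := mmap (polyC \o @mpolyC n C) graded_var b.

Lemma gradedM b d : graded (b * d) = graded b * graded d.
Proof. exact: rmorphM. Qed.
Lemma gradedD b d : graded (b + d) = graded b + graded d.
Proof. exact: rmorphD. Qed.
Lemma gradedN b : graded (- b) = - graded b.
Proof. exact: rmorphN. Qed.

Lemma graded_monomial m : mmap1 graded_var m = (mpolyX C m)%:P * 'X^(m j).
Proof.
rewrite /mmap1 /graded_var; under eq_bigr do rewrite exprMn.
rewrite big_split /=; congr (_ * _).
  by rewrite [mpolyX C m]mpolyXE_id rmorph_prod; apply: eq_bigr => i _; rewrite rmorphXn.
by rewrite (bigD1 j) //= eqxx big1 ?mulr1 // => i /negPf ->; rewrite expr1n.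
Qed.

Lemma coef_graded b k m : mcoeff m (graded b)`_k = if m j == k then mcoeff m b else 0.
Proof.
rewrite /graded /mmap coef_sum raddf_sum /=.
transitivity (\sum_(m' <- msupp b) mcoeff m (mcoeff m' b *: mpolyX C m') *+ (k == m j)).
  apply: eq_bigr => m' _; rewrite graded_monomial mulrA -polyCM coefCM coefXn mulr_natr raddfMn /=.
  rewrite mcoeffCM mcoeffZ mcoeffX; case: (eqVneq m' m) => [->|_] //.
  by rewrite mulr0 !mul0rn.
rewrite sumrMnl -raddf_sum -mpolyE eq_sym; by case: eqP.
Qed.

(** One more than the degree in x_j, and 0 for the zero polynomial. *)
Definition psize b := size (graded b).

Lemma graded_eq0 b : (graded b == 0) = (b == 0).
Proof.
apply/eqP/eqP => [e|->]; last exact: rmorph0.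
by apply/mpolyP => m; rewrite mcoeff0; have := coef_graded b (m j) m; rewrite e coef0 mcoeff0 eqxx.
Qed.

Lemma psize_eq0 b : (psize b == 0%N) = (b == 0).
Proof. by rewrite /psize size_poly_eq0 graded_eq0. Qed.

Lemma psizeM b d : b != 0 -> d != 0 -> psize (b * d) = (psize b + psize d).-1.
Proof. by move=> b0 d0; rewrite /psize gradedM size_mul ?graded_eq0. Qed.

Lemma psizeN b : psize (- b) = psize b.
Proof. by rewrite /psize gradedN size_polyN. Qed.

Lemma psizeM_le b d : (psize (b * d)%R <= (psize b + psize d).-1)%N.
Proof. by rewrite /psize gradedM size_polyMleq. Qed.

Lemma mem_psize b m : m \in msupp b -> (m j < psize b)%N.
Proof.
rewrite mcoeff_msupp; apply: contra_neqT; rewrite -leqNgt => h.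
by have := coef_graded b (m j) m; rewrite eqxx nth_default // mcoeff0.
Qed.

Lemma psize_leP b k : (forall m, m \in msupp b -> (m j < k)%N) -> (psize b <= k)%N.
Proof.
move=> H; apply/leq_sizeP => i ki; apply/mpolyP => m; rewrite coef_graded mcoeff0.
case: eqP => // e; apply/eqP; apply: contraTT ki; rewrite -mcoeff_msupp -ltnNge -e; exact: H.
Qed.

Lemma degE b : deg j b = if b == 0 then -oo%E else ((psize b).-1%:Z)%:E.
Proof.
rewrite /deg; case: eqP => // /eqP b0; congr (_%:E); congr Posz; apply/eqP; rewrite eqn_leq.
have S0 : (0 < psize b)%N by rewrite lt0n psize_eq0.
apply/andP; split.
  by apply/bigmax_leqP_seq => m hm _; rewrite -ltnS prednK // mem_psize.
rewrite -ltnS prednK //; apply: psize_leP => m hm; rewrite ltnS.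
exact: (@leq_bigmax_seq _ _ _ (fun m : multinom n => m j)).
Qed.

Lemma psize_deriv b : b != 0 -> (psize (mderiv j b) < psize b)%N.
Proof.
move=> b0; have S0 : (0 < psize b)%N by rewrite lt0n psize_eq0.
rewrite -(prednK S0) ltnS; apply: psize_leP => m.
rewrite mcoeff_msupp mcoeff_deriv => h; rewrite -ltnS prednK //.
have : mnm_add m (mnm1 j) \in msupp b by rewrite mcoeff_msupp; apply: contra_neq h => ->; rewrite mul0rn.
by move=> /mem_psize; rewrite mnmDE mnm1E eqxx addn1.
Qed.

Lemma degZ (x : C) b : x != 0 -> deg j (x *: b) = deg j b.
Proof.
move=> x0; rewrite !degE; have -> : psize (x *: b) = psize b.
  have [->|b0] := eqVneq b 0; first by rewrite scaler0.
  have X0 : mpolyC n x != 0 by rewrite mpolyC_eq0.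
  rewrite -mul_mpolyC psizeM //; suff -> : psize (mpolyC n x) = 1%N by [].
  apply/eqP; rewrite eqn_leq lt0n psize_eq0 X0 andbT; apply: psize_leP => m.
  by rewrite msuppC (negPf x0) inE => /eqP ->; rewrite mnm0E.
by rewrite -mul_mpolyC mulf_eq0 mpolyC_eq0 (negPf x0).
Qed.

Lemma psize_wronskian a d : a != 0 -> d != 0 ->
  (psize (a * mderiv j d - d * mderiv j a)%R < (psize a + psize d).-1)%N.
Proof.
move=> a0 d0; have A0 : (0 < psize a)%N by rewrite lt0n psize_eq0.
have D0 : (0 < psize d)%N by rewrite lt0n psize_eq0.
have da := psize_deriv a0; have dd := psize_deriv d0.
have h1 := psizeM_le a (mderiv j d); have h2 := psizeM_le d (mderiv j a).
have h3 : (psize (a * mderiv j d - d * mderiv j a)%R <= maxn (psize (a * mderiv j d)%R) (psize (d * mderiv j a)%R))%N.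
  by rewrite /psize gradedD gradedN -[X in maxn _ X]size_polyN size_polyD.
move: h1 h2 h3; rewrite ?gtn_max; lia.
Qed.

Lemma deg_sub a b h : a != 0 -> b != 0 -> h != 0 -> psize b = (psize h + psize a).-1 ->
  deg j h = (deg j b - deg j a)%E.
Proof.
move=> a0 b0 h0; rewrite !degE (negPf a0) (negPf b0) (negPf h0).
have : (0 < psize a)%N by rewrite lt0n psize_eq0.
have : (0 < psize h)%N by rewrite lt0n psize_eq0.
move: (psize a) (psize b) (psize h) => A B H' H0 A0 e.
by rewrite -EFinB; congr (_%:E); move: e H0 A0; clear; lia.
Qed.

Lemma deg_ge0 b : b != 0 -> (0 <= deg j b)%E.
Proof. by move=> b0; rewrite degE (negPf b0) lee_fin. Qed.

Lemma wronskian_deg_lt a b d : a != 0 -> d != 0 -> d * b = a * mderiv j d - d * mderiv j a ->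
  (deg j b < deg j a)%E.
Proof.
move=> a0 d0 e; rewrite !degE (negPf a0); case: eqP => [_|/eqP b0]; first exact: ltNyr.
have := psize_wronskian a0 d0; rewrite -e psizeM //.
have A0 : (0 < psize a)%N by rewrite lt0n psize_eq0.
have B0 : (0 < psize b)%N by rewrite lt0n psize_eq0.
have D0 : (0 < psize d)%N by rewrite lt0n psize_eq0.
by move=> h; rewrite lte_fin ltz_nat; lia.
Qed.

(** The Wronskian has smaller degree in x_j than a d, so it cannot affect the leading term of h a d,
    and the degree of d drops out. *)
Lemma wronskian_deg a b d h : a != 0 -> d != 0 -> h != 0 ->
  d * b = h * a * d + (a * mderiv j d - d * mderiv j a) ->
  b != 0 /\ psize b = (psize h + psize a).-1.
Proof.
move=> a0 d0 h0 e; have := psize_wronskian a0 d0.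
have A0 : (0 < psize a)%N by rewrite lt0n psize_eq0.
have D0 : (0 < psize d)%N by rewrite lt0n psize_eq0.
have H0 : (0 < psize h)%N by rewrite lt0n psize_eq0.
have s1 : psize (h * a * d) = (psize h + psize a + psize d).-2.
  by rewrite !psizeM ?mulf_neq0 //; lia.
move=> lt; have sdb : psize (d * b) = (psize h + psize a + psize d).-2.
  rewrite e /psize gradedD size_polyDl; first exact: s1.
  by apply: leq_trans lt _; rewrite [leqRHS]s1; clear -A0 D0 H0; lia.
have b0 : b != 0.
  apply/eqP => b0; have z0 : psize 0 = 0%N by apply/eqP; rewrite psize_eq0.
  by move: sdb; rewrite b0 mulr0 z0; clear -A0 D0 H0; lia.
have B0 : (0 < psize b)%N by rewrite lt0n psize_eq0.
move: sdb; rewrite psizeM // => e'; split=> //; clear -A0 D0 H0 B0 e'; lia.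
Qed.

End PartialDegree.

(** * The equation *)

Section Derivation.
Variables (R : realType) (n s : nat) (t : 'I_s -> 'I_n).
Local Notation C := (Cplx R).
Local Notation Cn := 'rV[C]_n.
Local Notation mp := (mpoly n C).
Variable q : 'I_s -> mp.
Implicit Types (f g h phi : Cn -> C) (b : mp).

Definition derivation f : Cn -> C := fun z => \sum_(j < s) peval (q j) z * dd (ej R (t j)) f z.
Definition poly_derivation b : mp := \sum_(j < s) q j * mderiv (t j) b.

Lemma diffopE f : entire f -> forall z, diffop t q f z = derivation f z.
Proof. by move=> hf z; apply: eq_bigr => j _; rewrite partialE. Qed.

Lemma hol_derivation f : hol f -> hol (derivation f).
Proof. by move=> hf; apply: hol_sum => j _; apply: holM; [exact: peval_is_hol|exact: hol_dd]. Qed.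

Lemma derivation_peval b z : derivation (peval b) z = peval (poly_derivation b) z.
Proof. by rewrite /derivation /poly_derivation peval_sum; apply: eq_bigr => j _; rewrite dd_peval pevalM. Qed.

Lemma derivation_ext f g z : (forall z, f z = g z) -> derivation f z = derivation g z.
Proof. by move=> /funext ->. Qed.

Lemma derivationM f g z : hol f -> hol g ->
  derivation (fun z => f z * g z) z = derivation f z * g z + f z * derivation g z.
Proof.
move=> hf hg; rewrite mulr_suml mulr_sumr -big_split /=; apply: eq_bigr => j _.
by rewrite ddMf //; ring.
Qed.

Lemma derivationB f g z : hol f -> hol g ->
  derivation (fun z => f z - g z) z = derivation f z - derivation g z.
Proof.
move=> hf hg; rewrite -sumrB; apply: eq_bigr => j _.
by rewrite ddBf //; ring.
Qed.

Lemma derivationZ (c : C) f z : hol f -> derivation (fun z => c * f z) z = c * derivation f z.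
Proof. by move=> hf; rewrite mulr_sumr; apply: eq_bigr => j _; rewrite ddZf //; ring. Qed.

Lemma derivation_cexp f z : hol f ->
  derivation (fun z => cexp (f z)) z = cexp (f z) * derivation f z.
Proof. by move=> hf; rewrite mulr_sumr; apply: eq_bigr => j _; rewrite dd_cexp //; ring. Qed.

Lemma small_off_derivation phi F f : hol phi -> small_off phi F f -> small_off phi F (derivation f).
Proof.
move=> hp sf; rewrite /derivation; elim: (index_enum _) => [|j r IH].
  by under eq_fun do rewrite big_nil; apply: small_off_poly => //; exact: is_poly_cst.
under eq_fun do rewrite big_cons; apply: small_offD => //; apply: small_offM => //.
  by apply: small_off_poly => //; exact: is_poly_peval.
exact: small_off_dd.
Qed.
End Derivation.

(** * The alternatives for the exponent *)

Section Alternatives.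
Variables (R : realType) (n s : nat) (t : 'I_s -> 'I_n).
Local Notation C := (Cplx R).
Local Notation Cn := 'rV[C]_n.
Local Notation mp := (mpoly n C).
Variables (q : 'I_s -> mp) (c : Cn).
Implicit Types (f g h phi : Cn -> C).

Lemma mul_neq0_ex f g : hol f -> hol g -> (exists z, f z != 0) -> (exists z, g z != 0) ->
  exists z, f z * g z != 0.
Proof.
move=> hf hg [z fz] [w gw]; apply: contrapT => H.
have [z'|f0|g0] := hol_domain hf hg; first by apply: contrapT => /eqP h; apply: H; exists z'.
  by rewrite f0 eqxx in fz.
by rewrite g0 eqxx in gw.
Qed.

Lemma shift_neq0 f : (exists z, f z != 0) -> exists z, f (z + c) != 0.
Proof. by move=> [z fz]; exists (z - c); rewrite subrK. Qed.

Lemma cancel_hol f g : hol f -> hol g -> (exists z, f z != 0) -> (forall z, f z * g z = 0) ->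
  forall z, g z = 0.
Proof. by move=> hf hg [z fz] H; have [f0|//] := hol_domain hf hg H; rewrite f0 eqxx in fz. Qed.

Lemma quadratic_expansion (x al be ga de g : C) :
  x ^+ 2 * be * de * g ^+ 2 + - (x ^+ 2 * (al * de + ga * be)) * g +
    (x ^+ 2 * al * ga - x * (al - g * be) * (x * (ga - g * de))) = 0.
Proof. ring. Qed.

Lemma is_poly_linear (al be : mp) g : be != 0 -> hol g ->
  (forall z, peval al z - g z * peval be z = 0) -> is_poly g.
Proof.
move=> b0 hg H; apply: pgrow_poly => //; apply: (pgrow_div b0 hg).
apply: pgrow_is_poly; exists al => z; have /eqP := H z; rewrite subr_eq0 => /eqP ->; exact: mulrC.
Qed.

Variables (p a1 a2 b1 b2 d1 d2 al ga : mp).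
Hypotheses (p0 : p != 0) (d20 : d2 != 0).
Hypotheses (ab1 : a1 = 0 -> b1 != 0) (ab2 : a2 = 0 -> b2 != 0) (a12 : a1 = 0 -> a2 != 0).
Hypotheses (al0 : a2 = 0 -> al = d2 * p * b2) (ga0 : a1 = 0 -> ga = - (d2 * b1)).
Variable phi : Cn -> C.
Hypothesis hp : hol phi.
Let G := derivation t q phi.
Let A z := peval d2 (z + c) * (peval al z - G z * peval (d2 * p * a2) z).
Let B z := peval d2 (z + c) * (peval ga z - G z * peval (d2 * a1) z).
Let psi z := phi (z + c).
Let E z := peval (d1 * d2) z * (peval p (z + c) * peval a2 (z + c)).
Let F z := - (peval (d1 * d2) z * peval a1 (z + c)).
Hypothesis H : forall z, A z * cexp (- phi z) + B z * cexp (phi z) =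
  E z * cexp (- psi z) + F z * cexp (psi z).

(** The degenerate cases for d1 != 0 need their own argument. If a1 = 0, then F = 0 and B is a
    nonzero polynomial free of G; hence A = 0, a linear equation for G, and B e^phi = E e^(-psi)
    makes psi + phi constant. The case a2 = 0 is symmetric. The hypotheses [ab1] and [ab2] exclude
    that the surviving coefficient vanishes. *)
Lemma exponent_alternatives : (forall z, phi z = phi 0) \/
  [/\ is_poly G,
   d1 != 0 -> is_cst (fun z => phi (z + c) + phi z) \/ is_cst (fun z => phi (z + c) - phi z) &
   d1 = 0 -> [/\ a1 != 0, a2 != 0, forall z, peval al z - G z * peval (d2 * p * a2) z = 0 &
     forall z, peval ga z - G z * peval (d2 * a1) z = 0]].
Proof.
have [|/existsNP[z1 /eqP hz1]] := pselect (forall z, phi z = phi 0); [by left|right].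
have nphi : exists z, phi z != phi 0 by exists z1.
have hG : hol G by exact: hol_derivation.
have hpsi : hol psi by exact: hol_shift.
have npsi : exists z, psi z != psi 0.
  have [w hw] := nonconstant nphi c; exists (w - c); rewrite /psi subrK add0r //.
have pe (b : mp) : is_poly (peval b) by exact: is_poly_peval.
have pes (b : mp) : is_poly (fun z => peval b (z + c)) by exact: is_poly_shift.
have he (b : mp) : hol (peval b) by exact: peval_is_hol.
have nes (b : mp) : b != 0 -> exists z, peval b (z + c) != 0 by move=> b0; apply: shift_neq0; exact: peval_neq0.
have nd := nes _ d20; have hd := is_poly_hol (pes d2).
have pE : is_poly E by apply: is_polyM => //; exact: is_polyM.
have pF : is_poly F by apply: is_polyN; exact: is_polyM.
have sm K : small_off phi K A /\ small_off phi K B.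
  have sG : small_off phi K G by apply: small_off_derivation => //; exact: small_off_self.
  by split; apply: (small_offM hp); try (exact: small_off_poly);
    apply: (small_offB hp); try (exact: small_off_poly); apply: (small_offM hp) => //; exact: small_off_poly.
have hA := (sm phi).1.1; have hB := (sm phi).2.1.
have hA0 : hol (fun z => peval al z - G z * peval (d2 * p * a2) z) by apply: holB => //; exact: holM.
have hB0 : hol (fun z => peval ga z - G z * peval (d2 * a1) z) by apply: holB => //; exact: holM.
have AG0 : (forall z, A z = 0) -> forall z, peval al z - G z * peval (d2 * p * a2) z = 0.
  by move=> A0; exact: (cancel_hol hd hA0 nd A0).
have BG0 : (forall z, B z = 0) -> forall z, peval ga z - G z * peval (d2 * a1) z = 0.
  by move=> B0; exact: (cancel_hol hd hB0 nd B0).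
have nA : a2 = 0 -> ~ (forall z, A z = 0).
  move=> a20 /AG0; rewrite a20 mulr0 al0 // => h.
  suff /eqP : d2 * p * b2 = 0 by rewrite !mulf_eq0 (negPf d20) (negPf p0) (negPf (ab2 a20)).
  by apply: peval_eq0 => z; have := h z; rewrite peval0 mulr0 subr0.
have nB : a1 = 0 -> ~ (forall z, B z = 0).
  move=> a10 /BG0; rewrite a10 mulr0 ga0 // => h.
  suff /eqP : - (d2 * b1) = 0 by rewrite oppr_eq0 mulf_eq0 (negPf d20) (negPf (ab1 a10)).
  by apply: peval_eq0 => z; have := h z; rewrite peval0 mulr0 subr0.
have [d10|d10] := eqVneq d1 0.
  have [A0 B0] : (forall z, A z = 0) /\ (forall z, B z = 0).
    have n1 : exists z : Cn, (fun=> 1 : C) z != 0 by exists 0; exact: oner_neq0.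
    apply: (two_term_off hp nphi (hol_cst _ 1) n1 (sm _).1 (sm _).2) => z.
    by rewrite H /E /F d10 mul0r peval0 !mul0r oppr0 mul0r addr0.
  have a1n : a1 != 0 by apply/eqP => /nB; apply.
  have a2n : a2 != 0 by apply/eqP => /nA; apply.
  split=> [|//|_]; last by split=> //; [exact: AG0|exact: BG0].
  by apply: (@is_poly_linear al (d2 * p * a2)) => //; [rewrite !mulf_neq0|exact: AG0].
have nE : a2 != 0 -> exists z, E z != 0.
  move=> a2n; apply: mul_neq0_ex => //; [exact: is_poly_hol (is_polyM _ _)|by apply: peval_neq0; rewrite mulf_neq0|].
  by apply: mul_neq0_ex; [exact: is_poly_hol|exact: is_poly_hol|exact: nes|exact: nes].
have nF : a1 != 0 -> exists z, F z != 0.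
  move=> a1n; have [z hz] : exists z, peval (d1 * d2) z * peval a1 (z + c) != 0.
    by apply: mul_neq0_ex; [|exact: is_poly_hol|apply: peval_neq0; rewrite mulf_neq0|exact: nes].
  by exists z; rewrite oppr_eq0.
have hN (f : Cn -> C) : hol f -> hol (fun z => - f z) by exact: holN.
have cstD P Q : is_poly P -> is_poly Q -> (exists z, P z != 0) ->
    (forall z, P z * cexp (psi z + phi z) = Q z) -> is_cst (fun z => phi (z + c) + phi z).
  move=> pP pQ nP e; exists (psi 0 + phi 0) => z.
  exact: (@poly_exp_cst _ _ (fun z => psi z + phi z) P Q (holD hpsi hp)).
have yy z : cexp (- phi z) * cexp (phi z) = 1 by rewrite -cexpD addNr cexp0.
have ww z : cexp (- psi z) * cexp (psi z) = 1 by rewrite -cexpD addNr cexp0.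
have [a10|a1n] := eqVneq a1 0.
  have F0 z : F z = 0 by rewrite /F a10 peval0 mulr0 oppr0.
  have nE' := nE (a12 a10).
  have [A0|/(nB a10)//] : (forall z, A z = 0) \/ (forall z, B z = 0).
    apply: (@three_term _ _ phi (fun z => - psi z) A B E) => //; [exact: hN|exact: (sm _).1|exact: (sm _).2|].
    by move=> z; rewrite H F0 mul0r addr0.
  split=> [|_|/eqP]; last by rewrite (negPf d10).
    by apply: (@is_poly_linear al (d2 * p * a2)) => //; [rewrite !mulf_neq0 // a12|exact: AG0].
  left; apply: (cstD B E) => //.
  - have -> : B = fun z => peval d2 (z + c) * peval ga z.
      by apply/funext => z; rewrite /B a10 mulr0 peval0 mulr0 subr0.
    exact: is_polyM.
  - by apply: contrapT => h; apply: (nB a10) => z; apply: contrapT => /eqP Bz; apply: h; exists z.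
  move=> z; rewrite [psi z + _]addrC cexpD mulrA; have := H z.
  by rewrite A0 F0 !mul0r add0r addr0 => ->; rewrite -mulrA ww mulr1.
have nF' := nF a1n.
have [a20|a2n] := eqVneq a2 0.
  have E0 z : E z = 0 by rewrite /E a20 peval0 !mulr0.
  have [/(nA a20)//|B0] : (forall z, A z = 0) \/ (forall z, B z = 0).
    apply: (@three_term _ _ phi psi A B F) => //; [exact: (sm _).1|exact: (sm _).2|].
    by move=> z; rewrite H E0 mul0r add0r.
  split=> [|_|/eqP]; last by rewrite (negPf d10).
    by apply: (@is_poly_linear ga (d2 * a1)) => //; [rewrite mulf_neq0|exact: BG0].
  left; apply: (cstD F A) => //.
    have -> : A = fun z => peval d2 (z + c) * peval al z.
      by apply/funext => z; rewrite /A a20 mulr0 peval0 mulr0 subr0.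
    exact: is_polyM.
  move=> z; rewrite cexpD mulrA; have := H z.
  by rewrite B0 E0 !mul0r add0r addr0 => <-; rewrite -mulrA yy mulr1.
have nE' := nE a2n.
have FT := four_term hp nphi hpsi npsi pE nE' pF nF' (sm F).1 (sm F).2 H.
have AB z : A z * B z = E z * F z.
  transitivity ((A z * cexp (- phi z)) * (B z * cexp (phi z))).
    by rewrite [RHS]mulrACA yy mulr1.
  transitivity ((E z * cexp (- psi z)) * (F z * cexp (psi z))); last by rewrite [LHS]mulrACA ww mulr1.
  case: FT => /(_ z)[e1 e2]; first exact: (f_equal2 *%R e1 e2).
  exact: etrans (f_equal2 *%R e1 e2) (mulrC _ _).
have pG : is_poly G.
  (* The leading coefficient of the quadratic equation for G has to be an element of [mpoly], so a
     polynomial e2 is substituted for the shifted factor. *)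
  have [e2 He2] : is_poly (fun z => peval d2 (z + c) ^+ 2) by under eq_fun do rewrite expr2; exact: is_polyM.
  have e20 : e2 * (d2 * p * a2) * (d2 * a1) != 0.
    rewrite !mulf_neq0 //; have [z hz] := nd; apply: contra_neq hz => e0.
    by have /eqP := He2 z; rewrite e0 peval0 sqrf_eq0 => /eqP.
  apply: (@quadratic_pgrow _ _ _ (fun z => - peval (e2 * (al * (d2 * a1) + ga * (d2 * p * a2))) z)
    (fun z => peval (e2 * al * ga) z - E z * F z) G e20 hG).
  - by apply: pgrow_is_poly; exact: is_polyN.
  - by apply: pgrow_is_poly; apply: is_polyB => //; exact: is_polyM.
  move=> z; rewrite -AB /A /B !pevalM pevalD !pevalM -He2; exact: quadratic_expansion.
split=> [//|_|/eqP]; last by rewrite (negPf d10).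
have pA : is_poly A by apply: is_polyM => //; apply: is_polyB => //; exact: is_polyM.
case: FT => FT; [right|left].
  have nA' : exists z, A z != 0.
    have [z Ez] := nE'; exists z; apply: contra_neq Ez => Az; have := (FT z).1.
    by rewrite Az mul0r => /esym/eqP; rewrite mulf_eq0 (negPf (cexp_neq0 _)) orbF => /eqP.
  exists (psi 0 - phi 0) => z.
  apply: (@poly_exp_cst _ _ (fun z => psi z - phi z) A E (holB hpsi hp)) => // {}z.
  by rewrite addrC cexpD mulrA (FT z).1 -mulrA ww mulr1.
apply: (cstD F A) => // z.
by rewrite cexpD mulrA -(FT z).1 -mulrA yy mulr1.
Qed.

End Alternatives.

(** * From a solution to its exponent *)

Section Solutions.
Variables (R : realType) (n s : nat) (t : 'I_s -> 'I_n).
Local Notation C := (Cplx R).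
Local Notation Cn := 'rV[C]_n.
Local Notation mp := (mpoly n C).
Variables (q : 'I_s -> mp) (c : Cn) (p p1 p2 p3 p4 p5 p6 : mp).
Hypotheses (p0 : p != 0) (irr : irreducible_mpoly p).
Let d1 : mp := p2 * p6 - p4 * p5.
Let d2 : mp := p3 * p5 - p1 * p6.
Hypotheses (D0 : p1 * p4 - p2 * p3 = 0) (d20 : d2 != 0).

Lemma sqri : 'i * 'i = - 1 :> C.
Proof. by rewrite -expr2 sqrCi. Qed.

Lemma entire_peval (b : mp) : entire (peval b).
Proof. exact: hol_entire (peval_is_hol b). Qed.

Section Factors.
Variables (f : Cn -> C) (ef : entire f).
Hypothesis sf : solution (diffop t q) c p p1 p2 p3 p4 p5 p6 f.
Let U z := peval p1 z * derivation t q f z + peval p2 z * f (z + c) + peval p5 z * f z.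
Let V z := peval p3 z * derivation t q f z + peval p4 z * f (z + c) + peval p6 z * f z.

Lemma solution_factors : exists k phi, [/\ k = 1 \/ k = - 1, hol phi,
  forall z, U z + 'i * k * V z = cexp (phi z) &
  forall z, U z - 'i * k * V z = peval p z * cexp (- phi z)].
Proof.
have hf : hol f by exact: entire_hol.
have hU : hol U.
  by apply: holD; [apply: holD|]; apply: holM => //; try exact: peval_is_hol;
    [exact: hol_derivation|exact: hol_shift].
have hV : hol V.
  by apply: holD; [apply: holD|]; apply: holM => //; try exact: peval_is_hol;
    [exact: hol_derivation|exact: hol_shift].
have UV z : (U z + 'i * V z) * (U z - 'i * V z) = peval p z.
  rewrite -(sf z) diffopE // /translate -/(U z) -/(V z) !expr2.
  transitivity (U z * U z - 'i * 'i * (V z * V z)); first ring.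
  by rewrite sqri; ring.
have hu : hol (fun z => U z + 'i * V z) by apply: holD => //; exact: holZ.
have hv : hol (fun z => U z - 'i * V z) by apply: holB => //; exact: holZ.
have div (x y w : C) : x * y = w -> x != 0 -> y = w / x by move=> <- x0; rewrite mulrAC divff ?mul1r.
have [/(hol_log hu)[phi hp e]|/(hol_log hv)[phi hp e]] := zero_free_factor p0 irr hu hv UV.
  exists 1, phi; split=> // [|z|z]; [by left|by rewrite mulr1|rewrite mulr1].
  by rewrite cexpNV -e; apply: div => //; rewrite e cexp_neq0.
exists (- 1), phi; split=> // [|z|z]; [by right|by rewrite mulrN1 mulNr e|rewrite mulrN1 mulNr opprK].
by rewrite cexpNV -e; apply: div => //; [rewrite mulrC|rewrite e cexp_neq0].
Qed.

End Factors.

Section Relation.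
Variables (f : Cn -> C) (hf : hol f) (k : C) (phi : Cn -> C) (hp : hol phi).
Hypothesis k2 : k * k = 1.
Let U z := peval p1 z * derivation t q f z + peval p2 z * f (z + c) + peval p5 z * f z.
Let V z := peval p3 z * derivation t q f z + peval p4 z * f (z + c) + peval p6 z * f z.
Hypothesis eU : forall z, U z + 'i * k * V z = cexp (phi z).
Hypothesis eV : forall z, U z - 'i * k * V z = peval p z * cexp (- phi z).
Let a1 := k *: p1 - 'i *: p3.
Let a2 := k *: p1 + 'i *: p3.
Let b1 := k *: p5 - 'i *: p6.
Let b2 := k *: p5 + 'i *: p6.
Let G := derivation t q phi.
Let al := d2 * poly_derivation t q (p * a2) - poly_derivation t q d2 * (p * a2) + d2 * p * b2.
Let ga := poly_derivation t q d2 * a1 - d2 * poly_derivation t q a1 - d2 * b1.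

Lemma solution_form z :
  2 * 'i * peval d2 z * f z = peval p z * peval a2 z * cexp (- phi z) - peval a1 z * cexp (phi z).
Proof.
have D w : peval p1 w * peval p4 w = peval p2 w * peval p3 w.
  by apply/eqP; rewrite -subr_eq0 -!pevalM -pevalB D0 peval0.
rewrite [peval p z * _ * _]mulrAC -eV -eU /a1 /a2 /d2 !(pevalB, pevalD, pevalM, pevalZ).
transitivity (2 * 'i * (peval p3 z * U z - peval p1 z * V z)).
  rewrite /U /V.
  transitivity (2 * 'i * ((peval p3 z * peval p5 z - peval p1 z * peval p6 z) * f z +
    (peval p2 z * peval p3 z - peval p1 z * peval p4 z) * f (z + c))); last ring.
  by rewrite D subrr; ring.
transitivity (2 * 'i * peval p3 z * U z - 2 * 'i * (k * k) * peval p1 z * V z); last ring.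
by rewrite k2; ring.
Qed.

Lemma derivation_form z :
  peval d2 z * derivation t q f z * (2 * 'i) = 2 * 'i * peval d1 z * f (z + c) +
    peval b1 z * cexp (phi z) - peval p z * peval b2 z * cexp (- phi z).
Proof.
rewrite [_ * _ * cexp (- phi z)]mulrAC -eV -eU /b1 /b2 /d1 /d2 !(pevalB, pevalD, pevalM, pevalZ).
transitivity (2 * 'i * (peval p2 z * peval p6 z - peval p4 z * peval p5 z) * f (z + c) +
  2 * 'i * ((k * k) * peval p5 z * V z - peval p6 z * U z)); last ring.
by rewrite k2 /U /V; ring.
Qed.

(** The elimination of f and L(f) at one point, with numbers as atoms for [ring]: x, P, y stand for
    d2, p a2, a1, b and b' for b1 and p b2, e and e' for e^phi and e^(-phi), g for L(phi), D for d1
    and S for f(z + c). *)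
Lemma leibniz_elimination (i2 x Lx P LP y Ly g e e' F LF D S b b' : C) :
  i2 * (x * F) = P * e' - y * e ->
  i2 * (Lx * F + x * LF) = LP * e' + P * (e' * - g) - (Ly * e + y * (e * g)) ->
  x * LF * i2 = i2 * D * S + b * e - b' * e' ->
  (x * LP - Lx * P + x * b' - g * (x * P)) * e' + (Lx * y - x * Ly - x * b - g * (x * y)) * e =
  i2 * D * x * S.
Proof.
move=> fw de dw.
transitivity (x * (LP * e' + P * (e' * - g) - (Ly * e + y * (e * g))) - Lx * (P * e' - y * e)
  - x * (b * e - b' * e')); first ring.
rewrite -fw -de; transitivity (x * (x * LF * i2 - (b * e - b' * e'))); first ring.
by rewrite dw; ring.
Qed.

Lemma shift_relation z :
  (peval al z - G z * peval (d2 * p * a2) z) * cexp (- phi z) +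
  (peval ga z - G z * peval (d2 * a1) z) * cexp (phi z) = 2 * 'i * peval d1 z * peval d2 z * f (z + c).
Proof.
have he (b : mp) : hol (peval b) by exact: peval_is_hol.
have hN : hol (fun z => - phi z) by exact: holN.
have hE : hol (fun z => cexp (phi z)) by exact: hol_cexp.
have hE' : hol (fun z => cexp (- phi z)) by exact: hol_cexp.
have dN w : derivation t q (fun z => - phi z) w = - G w.
  rewrite -[RHS]mulN1r -(derivationZ t q _ w hp); apply: derivation_ext => x; by rewrite mulN1r.
have e w : 2 * 'i * (peval d2 w * f w) = peval (p * a2) w * cexp (- phi w) - peval a1 w * cexp (phi w).
  by rewrite pevalM mulrA solution_form.
have := derivation_ext t q z e.
rewrite derivationZ ?derivationB ?derivationM ?derivation_cexp ?dN ?derivation_peval //; try exact: holM.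
move=> de; have dw := derivation_form z; have fw := e z.
have -> : peval al z = peval d2 z * peval (poly_derivation t q (p * a2)) z -
    peval (poly_derivation t q d2) z * peval (p * a2) z + peval d2 z * (peval p z * peval b2 z).
  by rewrite /al -[d2 * p * b2]mulrA !(pevalB, pevalD, pevalM).
have -> : peval ga z = peval (poly_derivation t q d2) z * peval a1 z -
    peval d2 z * peval (poly_derivation t q a1) z - peval d2 z * peval b1 z.
  by rewrite /ga !(pevalB, pevalD, pevalM).
rewrite -[d2 * p * a2]mulrA [peval (d2 * _) z]pevalM [peval (d2 * a1) z]pevalM.
exact: leibniz_elimination fw de dw.
Qed.

End Relation.

Lemma poly_derivation0 : poly_derivation t q 0 = 0.
Proof. by rewrite /poly_derivation big1 // => j _; rewrite raddf0 mulr0. Qed.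

Lemma wronskian_form (K : comNzRingType) (x x' y y' b h : K) :
  x * y' - x' * y + b - h * (x * y) = 0 -> b = h * y * x + (y * x' - x * y').
Proof. by move=> e; apply/eqP; rewrite -subr_eq0 -e; apply/eqP; ring. Qed.

Lemma solution_exponent f : entire f -> solution (diffop t q) c p p1 p2 p3 p4 p5 p6 f ->
  exists k phi, let a1 := k *: p1 - 'i *: p3 in let a2 := k *: p1 + 'i *: p3 in
  let b1 := k *: p5 - 'i *: p6 in let b2 := k *: p5 + 'i *: p6 in
  [/\ k = 1 \/ k = - 1, hol phi,
   forall z, 2 * 'i * peval d2 z * f z =
     peval p z * peval a2 z * cexp (- phi z) - peval a1 z * cexp (phi z) &
   (forall z, phi z = phi 0) \/
   exists h : mp, [/\ forall z, derivation t q phi z = peval h z,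
     d1 != 0 -> is_cst (fun z => phi (z + c) + phi z) \/ is_cst (fun z => phi (z + c) - phi z) &
     d1 = 0 -> [/\ a1 != 0, a2 != 0,
       d2 * (p * b2) = h * (p * a2) * d2 +
         (p * a2 * poly_derivation t q d2 - d2 * poly_derivation t q (p * a2)) &
       d2 * b1 = - h * a1 * d2 + (a1 * poly_derivation t q d2 - d2 * poly_derivation t q a1)]]].
Proof.
move=> ef sf; have hf : hol f by exact: entire_hol.
have [k [phi [k1 hp eU eV]]] := solution_factors ef sf; exists k, phi.
set a1 := _ - 'i *: p3; set a2 := _ + 'i *: p3; set b1 := _ - 'i *: p6; set b2 := _ + 'i *: p6 => /=.
have k2 : k * k = 1 by case: k1 => ->; rewrite ?mulrNN mulr1.
have form z := solution_form k2 eU eV z.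
split=> //.
(* Since the right-hand side is not 0, a1 = 0 forces a2 and b1 to be nonzero, and a2 = 0 forces b2
   to be nonzero: the nondegeneracy needed for the alternatives. *)
have id : a2 * b1 - a1 * b2 = (2 * 'i * k) *: d2.
  apply: peval_inj => z; rewrite /a1 /a2 /b1 /b2 /d2 !(pevalB, pevalD, pevalM, pevalZ); ring.
have kd : (2 * 'i * k) *: d2 != 0.
  have k0 : k != 0 by case: k1 => ->; rewrite ?oppr_eq0 oner_neq0.
  by rewrite -mul_mpolyC mulf_neq0 // mpolyC_eq0 !mulf_neq0 ?pnatr_eq0 ?neq0Ci.
have sh := shift_relation hf hp k2 eU eV.
pose al := d2 * poly_derivation t q (p * a2) - poly_derivation t q d2 * (p * a2) + d2 * p * b2.
pose ga := poly_derivation t q d2 * a1 - d2 * poly_derivation t q a1 - d2 * b1.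
have [|||||z||[[h hh] H1 H0]] := @exponent_alternatives R n s t q c p a1 a2 b1 b2 d1 d2 al ga p0 d20 _ _ _ _ _ phi hp.
- by move=> a10; apply: contra_neq kd => b10; rewrite -id a10 b10 mulr0 mul0r subrr.
- by move=> a20; apply: contra_neq kd => b20; rewrite -id a20 b20 mulr0 mul0r subrr.
- by move=> a10; apply: contra_neq kd => a20; rewrite -id a10 a20 !mul0r subrr.
- by move=> a20; rewrite /al a20 mulr0 poly_derivation0 !mulr0 subrr add0r.
- by move=> a10; rewrite /ga a10 poly_derivation0 !mulr0 subrr sub0r.
(* The relation is multiplied by d2(z + c), so that the representation of f applies at z + c as well
   without any division. *)
- rewrite -[X in X + _]mulrA -[X in _ + X]mulrA -mulrDr.
  rewrite [X in _ * X](sh z); transitivity (peval (d1 * d2) z * (2 * 'i * peval d2 (z + c) * f (z + c))).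
    by rewrite [peval (d1 * d2) z]pevalM; ring.
  by rewrite form mulrBr mulNr !mulrA.
- by left.
right; exists h; split=> // d10; have [a1n a2n e2 e1] := H0 d10; split=> //.
  apply: wronskian_form; apply: peval_eq0 => z.
  by have := e2 z; rewrite hh /al -2![d2 * p * _]mulrA -[peval h z * _]pevalM -pevalB.
apply: wronskian_form; apply: peval_eq0 => z; have := e1 z.
rewrite hh -pevalM -pevalB => e; rewrite -[RHS]oppr0 -e -pevalN; congr peval; rewrite /ga.
ring.
Qed.

End Solutions.

Theorem theorem4p1 (R : realType) (n : nat) (hn : (1 <= n)%N)
    (c : 'rV[Cplx R]_n) (hc : c != 0)
    (p p1 p2 p3 p4 p5 p6 : mpoly n (Cplx R))
    (hp0 : p != 0) (hp : irreducible_mpoly p)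
    (s : nat) (hs : (1 <= s <= n)%N)
    (t : 'I_s -> 'I_n) (ht : forall i j : 'I_s, (i < j)%N -> (t i < t j)%N)
    (q : 'I_s -> mpoly n (Cplx R)) (hq : forall j, q j != 0) :
  let L := diffop t q in
  let a1 (k : Cplx R) : mpoly n (Cplx R) := k *: p1 - 'i *: p3 in
  let a2 (k : Cplx R) : mpoly n (Cplx R) := k *: p1 + 'i *: p3 in
  let b1 (k : Cplx R) : mpoly n (Cplx R) := k *: p5 - 'i *: p6 in
  let b2 (k : Cplx R) : mpoly n (Cplx R) := k *: p5 + 'i *: p6 in
  let d1 : mpoly n (Cplx R) := p2 * p6 - p4 * p5 in
  let d2 : mpoly n (Cplx R) := p3 * p5 - p1 * p6 in
  let D : mpoly n (Cplx R) := p1 * p4 - p2 * p3 in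
  D = 0 -> d2 != 0 ->
  (forall f, entire f -> solution L c p p1 p2 p3 p4 p5 p6 f ->
     exists (k : Cplx R) (g : 'rV[Cplx R]_n -> Cplx R),
       [/\ k = 1 \/ k = -1, entire g, has_form p (a1 k) (a2 k) d2 g f &
         is_cst g \/
         [/\ is_poly (L g),
             d1 != 0 -> is_cst (fun z => translate c g z + g z) \/
                        is_cst (fun z => translate c g z - g z) &
             d1 = 0 -> a1 k * a2 k != 0]])
  /\
  (forall j : 'I_n,
     (forall h, entire h -> forall z, L h z = partial j h z) ->
     d1 = 0 ->
     forall f, entire f -> solution L c p p1 p2 p3 p4 p5 p6 f ->
     exists (k : Cplx R) (g : 'rV[Cplx R]_n -> Cplx R),
       [/\ k = 1 \/ k = -1, entire g, has_form p (a1 k) (a2 k) d2 g f &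
         [\/ is_cst g,
             (forall z, partial j g z = 0) /\
             ((deg j (b1 k) < deg j (a1 k))%E \/
              (deg j (b2 k) < deg j (a2 k))%E) |
             exists h : mpoly n (Cplx R),
               [/\ h != 0, forall z, partial j g z = peval h z,
                   deg j h = (deg j (b1 k) - deg j (a1 k))%E,
                   deg j h = (deg j (b2 k) - deg j (a2 k))%E &
                   (0 <= deg j h)%E]]]).
Proof.
move=> L a1 a2 b1 b2 d1 d2 D D0 d20.
have ii : - 'i * 'i = 1 :> Cplx R by rewrite mulNr sqri opprK.
have giE (phi : 'rV[Cplx R]_n -> Cplx R) z : 'i * (- 'i * phi z) = phi z.
  by rewrite mulrA mulrN -mulNr ii mul1r.
have i2 : 2 * 'i != 0 :> Cplx R by rewrite mulf_neq0 ?pnatr_eq0 ?neq0Ci.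
have form k phi f : (forall z, 2 * 'i * peval d2 z * f z = peval p z * peval (a2 k) z * cexp (- phi z) -
    peval (a1 k) z * cexp (phi z)) -> has_form p (a1 k) (a2 k) d2 (fun z => - 'i * phi z) f.
  by move=> H z dz; rewrite giE -H mulrAC divff ?mul1r // mulf_neq0.
have cst (x : Cplx R) (u v : 'rV[Cplx R]_n -> Cplx R) : (forall z, v z = x * u z) -> is_cst u -> is_cst v.
  by move=> e [y uy]; exists (x * y) => z; rewrite e uy.
split=> [f ef sf|j hL d10 f ef sf].
  have [k [phi [k1 hphi fp alt]]] := solution_exponent hp0 hp D0 d20 ef sf.
  have eg : entire (fun z => - 'i * phi z) by apply: hol_entire; exact: holZ.
  exists k, (fun z => - 'i * phi z); split=> //; first exact: form.
  case: alt => [phi0|[h [hh H1 H0]]]; first by left; exists (- 'i * phi 0) => z; rewrite phi0.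
  right; split.
  - by exists (- 'i *: h) => z; rewrite /L diffopE // derivationZ // hh pevalZ.
  - move=> /H1[] H; [left|right]; apply: (cst (- 'i)) H => z; rewrite /translate; ring.
  - by move=> /H0[a1n a2n _ _]; rewrite mulf_neq0.
have [k [phi [k1 hphi fp alt]]] := solution_exponent hp0 hp D0 d20 ef sf.
have eg : entire (fun z => - 'i * phi z) by apply: hol_entire; exact: holZ.
exists k, (fun z => - 'i * phi z); split=> //; first exact: form.
case: alt => [phi0|[h [hh _ /(_ d10)[a1n a2n e2 e1]]]].
  by apply: Or31; exists (- 'i * phi 0) => z; rewrite phi0.
(* The hypothesis on L concerns values at entire functions; applied to polynomial functions it
   becomes an identity of polynomials by [peval_inj]. *)
have dj b : poly_derivation t q b = mderiv j b.
  apply: peval_inj => z; rewrite -derivation_peval -diffopE; last exact: entire_peval.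
  by rewrite -/(L _ _) hL ?partialE ?dd_peval //; exact: entire_peval.
rewrite !dj in e1 e2.
have gj z : partial j (fun z => - 'i * phi z) z = peval (- 'i *: h) z.
  by rewrite -hL // /L diffopE // derivationZ // hh pevalZ.
have pa2n : p * a2 k != 0 by rewrite mulf_neq0.
have [h0|h0] := eqVneq h 0.
  apply: Or32; split=> [z|]; first by rewrite gj h0 scaler0 peval0.
  left; apply: wronskian_deg_lt a1n d20 _.
  by rewrite e1 h0 oppr0 !mul0r add0r.
have hN0 : - h != 0 by rewrite oppr_eq0.
have [b1n s1] := wronskian_deg a1n d20 hN0 e1.
have [pb2n s2] := wronskian_deg pa2n d20 h0 e2.
have b2n : b2 k != 0 by move: pb2n; rewrite mulf_eq0 negb_or => /andP[].
have ih0 : - 'i *: h != 0 by rewrite -mul_mpolyC mulf_neq0 // mpolyC_eq0 oppr_eq0 neq0Ci.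
have ni : - 'i != 0 :> Cplx R by rewrite oppr_eq0 neq0Ci.
apply: Or33; exists (- 'i *: h); split=> //; last exact: deg_ge0.
  by rewrite psizeN in s1; rewrite (degZ _ _ ni); exact: (deg_sub a1n b1n h0 s1).
(* The degree of p occurs on both sides, in p b2 and in p a2, and cancels. *)
rewrite (degZ _ _ ni); apply: (deg_sub a2n b2n h0); move: s2.
rewrite (psizeM _ hp0 b2n) (psizeM _ hp0 a2n).
have := psize_eq0 j (b2 k); have := psize_eq0 j (a2 k); have := psize_eq0 j p.
rewrite (negPf b2n) (negPf a2n) (negPf hp0).
move: (psize j p) (psize j (a2 k)) (psize j (b2 k)) (psize j h); clear; lia.
Qed.
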